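(* Let $\mathbf{C}_0$ be a full subcategory of $\mathbf{NG}_0$ such that (i) $\mathbf{C}_0$ contains all finite CW-complexes; (ii) $\mathbf{C}_0$ is closed under finite wedge sums; (iii) if $A\subset X$ is an inclusion of objects in $\mathbf{C}_0$ then its cofiber $X\cup CA$ belongs to $\mathbf{C}_0$ (in particular $\mathbf{C}_0$ is closed under suspension $X\mapsto\Sigma X$). For every linear enriched functor $T\colon\mathbf{C}_0\to\mathbf{NG}_0$ there exists a generalized homology theory $X\mapsto\{h_n(X;T)\}_{n\in\mathbf{Z}}$ defined on $\mathbf{C}_0$ such that $h_n(X;T)$ is isomorphic to $\pi_n TX$ if $n\ge 0$, and to $\pi_0T(\Sigma^{-n}X)$ if $n<0$.
   Context: A topological space is numerically generated if it has the final topology with respect to its singular simplexes (continuous maps from $\Delta^n$, $n\ge0$); $\mathbf{NG}_0$ is the category of pointed numerically generated spaces and pointed continuous maps. For a space $X$, $\nu X$ is its underlying set with the final topology with respect to its singular simplexes. $\mathbf{NG}_0$ is closed symmetric monoidal under the smash product $\wedge$ (the quotient of the product in $\mathbf{NG}_0$, i.e. $\nu$ of the topological product, by the wedge), with internal hom $F_0(X,Y)=Y^X=\nu\,\mathbf{smap}_0(X,Y)$. Here, for pointed spaces, $\mathbf{smap}_0(X,Y)$ is the set of pointed maps $f$ such that $f\sigma$ is continuous for every singular simplex $\sigma\colon \Delta^n\to X$, with the initial topology with respect to the maps $f\mapsto f\sigma\in\mathbf{map}(\Delta^n,Y)$ (compact-open topology), and basepoint the constant map. A functor $T\colon\mathbf{C}_0\to\mathbf{NG}_0$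 is enriched if for all $X,Y$ the map $F_0(X,Y)\to F_0(TX,TY)$, $f\mapsto Tf$, is continuous and basepoint preserving. Then a pointed map $X\wedge Y\to Z$ with $Y,Z\in\mathbf{C}_0$ induces, via $X\to F_0(Y,Z)\to F_0(TY,TZ)$ and adjunction, a pointed map $X\wedge TY\to TZ$; in particular $T$ carries pointed homotopies $I_+\wedge Y\to Z$ to pointed homotopies $I_+\wedge TY\to TZ$. For $f\colon X\to Y$ let $E(f)=\{(x,l)\in X\times\mathbf{map}(I,Y)\mid f(x)=l(0)\}$, $p\colon E(f)\to Y$, $p(x,l)=l(1)$, and let $F(f)$ be the fiber of $p$ over the basepoint. A sequence of pointed maps $Z\xrightarrow{i}X\xrightarrow{f}Y$ is a homotopy fibration sequence (with respect to a given pointed homotopy from $f\circ i$ to the constant map) if the induced map $Z\to F(f)$ is a weak homotopy equivalence. An enriched functor $T$ is linear if for every pair of objects $(X,A)$ of $\mathbf{C}_0$ with $A\subset X$, the sequence $TA\to TX\to T(X\cup CA)$ induced by $A\subset X\subset X\cup CA$ ($CA$ the reduced cone) is a homotopy fibration sequence with respect to the null homotopy of $TA\to T(X\cup CA)$ coming from the contraction of $A$ within $CA$. A generalized homology theory on $\mathbf{C}_0$ is a sequence of functors $h_n$ ($n\in\mathbf{Z}$) from $\mathbf{C}_0$ to abelian groups with natural isomorphisms $h_n(X)\cong h_{n+1}(\Sigma X)$, satisfying the homotopy axiom (pointed homotopic maps induce the same homomorphism) and the exactness axiom ($h_n(A)\to h_n(X)\to h_n(X\cup CA)$ is exact for every pair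 $A\subset X$ of objects). The operation on $\pi_nTX$ (in particular on $\pi_0$) is the composite $\pi_nTX\times\pi_nTX\cong\pi_nT(X\vee X)\to\pi_nTX$, where the first isomorphism is the inverse of the map induced by the two projections $X\vee X\to X$ and the second map is induced by the folding map $\nabla\colon X\vee X\to X$; for $n\geq 1$ it coincides with the usual operation on homotopy groups. *)

(* Defs.v *)
From HB Require Import structures.
From Stdlib Require Import Relation_Operators.
From mathcomp Require Import all_boot all_order all_algebra generic_quotient.
From mathcomp Require Import all_classical all_reals.
From mathcomp Require Import topology normedtype homotopy.

Set Implicit Arguments.
Unset Strict Implicit.
Unset Printing Implicit Defensive.

Import Order.TTheory GRing.Theory Num.Theory.
Import numFieldNormedType.Exports.
Local Open Scope classical_set_scope.
Local Open Scope ring_scope.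
Local Open Scope quotient_scope.

Definition Delta (R : realType) (n : nat) : Type :=
  set_type [set t : 'rV[R]_n.+1 |
    (forall i, 0 <= t ord0 i) /\ \sum_i t ord0 i = 1].
HB.instance Definition _ R n := Uniform.on (Delta R n).

(* Only the nontrivial half of finality: preimages of open sets under continuous
   singular simplexes are always open. *)
HB.mixin Record isNumGen (R : realType) T & Topological T := {
  numgen_open : forall U : set T,
    (forall n (s : Delta R n -> T), continuous s -> open (s @^-1` U)) ->
    open U
}.

#[short(type="ngType")]
HB.structure Definition PointedNumGen (R : realType) :=
  {T of PointedTopological T & isNumGen R T}.

Definition nu (R : realType) (T : Type) : Type := T.

Section nu.
Context {R : realType} {T : topologicalType}.

Definition nu_open : set_system (nu R T) :=
  [set U | forall n (s : Delta R n -> T), continuous s -> open (s @^-1` U)].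

Lemma nu_openT : nu_open setT.
Proof. by move=> n s _; rewrite preimage_setT; exact: openT. Qed.

Lemma nu_openI : setI_closed nu_open.
Proof.
by move=> U V oU oV n s cs; rewrite preimage_setI; apply: openI;
  [exact: oU|exact: oV].
Qed.

Lemma nu_open_bigcup (I : Type) (f : I -> set (nu R T)) :
  (forall i, nu_open (f i)) -> nu_open (\bigcup_i f i).
Proof.
move=> of_ n s cs; rewrite preimage_bigcup; apply: bigcup_open => i _.
exact: of_.
Qed.

HB.instance Definition _ := Choice.copy (nu R T) T.
HB.instance Definition _ :=
  isOpenTopological.Build (nu R T) nu_openT nu_openI nu_open_bigcup.

Lemma Delta_nu_continuous n (s : Delta R n -> T) :
  continuous s -> continuous (s : Delta R n -> nu R T).
Proof. by move=> cs; apply/continuousP => U oU; exact: oU. Qed.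

Lemma nu_numgen (U : set (nu R T)) :
  (forall n (s : Delta R n -> nu R T), continuous s -> open (s @^-1` U)) ->
  open U.
Proof.
move=> oU; suff: nu_open U by [].
by move=> n s cs; apply: oU; exact: Delta_nu_continuous.
Qed.

Lemma nu_id_continuous : continuous (id : nu R T -> T).
Proof.
apply/continuousP => U oU; suff: nu_open U by [].
by move=> n s /continuousP; exact.
Qed.

End nu.

HB.instance Definition _ (R : realType) (T : ptopologicalType) :=
  isPointed.Build (nu R T) (point : T).
HB.instance Definition _ (R : realType) (T : ptopologicalType) :=
  isNumGen.Build R (nu R T) (@nu_numgen R T).

Lemma numgen_continuous (R : realType) (X : ngType R) (Y : topologicalType)
  (f : X -> Y) :
  (forall n (s : Delta R n -> X), continuous s -> continuous (f \o s)) ->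
  continuous f.
Proof.
move=> cf; apply/continuousP => U oU; apply: numgen_open => n s cs.
by rewrite -comp_preimage; move/continuousP: (cf n s cs); exact.
Qed.

Lemma nu_continuous (R : realType) (T Y : topologicalType) (f : T -> Y) :
  (forall n (s : Delta R n -> T), continuous s -> continuous (f \o s)) ->
  continuous (f : nu R T -> Y).
Proof.
move=> cf; apply/continuousP => U oU; suff: @nu_open R T (f @^-1` U) by [].
move=> n s cs; by rewrite -comp_preimage; move/continuousP: (cf n s cs); exact.
Qed.

(* Quotient by the equivalence relation generated by [r]. *)
Section eqclosure_quot.
Variables (T : choiceType) (r : T -> T -> Prop).

Definition eqclosure (x y : T) : bool := `[< clos_refl_sym_trans T r x y >].

Lemma eqclosure_refl : reflexive eqclosure.
Proof. by move=> x; apply/asboolP; exact: rst_refl. Qed.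

Lemma eqclosure_sym : symmetric eqclosure.
Proof. by move=> x y; apply/asboolP/asboolP; exact: rst_sym. Qed.

Lemma eqclosure_trans : transitive eqclosure.
Proof.
by move=> y x z /asboolP xy /asboolP yz; apply/asboolP; exact: rst_trans yz.
Qed.

Definition eqclosure_equiv := EquivRel eqclosure
  eqclosure_refl eqclosure_sym eqclosure_trans.

Definition genquot : Type := {eq_quot eqclosure_equiv}.
HB.instance Definition _ := Quotient.on genquot.
HB.instance Definition _ := Choice.on genquot.

Definition class_of (x : T) : genquot := \pi_genquot x.

Lemma class_of_eq x y : r x y -> class_of x = class_of y.
Proof. by move=> rxy; apply/eqmodP/asboolP; exact: rst_step. Qed.

Lemma class_of_repr (q : genquot) : class_of (repr q) = q.
Proof. exact: reprK. Qed.

Lemma genquot_fun_class (Z : Type) (g : T -> Z) :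
  (forall x y, r x y -> g x = g y) ->
  forall x, g (repr (class_of x)) = g x.
Proof.
move=> gr x; rewrite /class_of; case: piP => y /eqmodP/asboolP.
by elim=> {x y} [x y /gr ->||x y _ ->|x y z _ -> _ ->].
Qed.

End eqclosure_quot.

Section relquot.
Variables (R : realType) (T : ngType R) (r : T -> T -> Prop).

Definition relquot : Type := genquot r.
HB.instance Definition _ := Quotient.on relquot.
HB.instance Definition _ :=
  Topological.copy relquot (quotient_topology (genquot r)).
HB.instance Definition _ := isPointed.Build relquot (class_of r point).

Definition to_relquot (x : T) : relquot := class_of r x.

Lemma to_relquot_continuous : continuous to_relquot.
Proof. exact: (@pi_continuous T (genquot r)). Qed.

Lemma relquot_fun_continuous (Z : topologicalType) (g : T -> Z) :
  continuous g -> (forall x y, r x y -> g x = g y) ->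
  continuous (g \o repr : relquot -> Z).
Proof.
move=> cg gr; apply/(@quotient_continuous T (genquot r)).
rewrite (_ : _ \o _ = g)//; apply/funext => x /=.
exact: (genquot_fun_class gr).
Qed.

Lemma relquot_numgen (U : set relquot) :
  (forall n (s : Delta R n -> relquot), continuous s -> open (s @^-1` U)) ->
  open U.
Proof.
move=> oU; suff: open (to_relquot @^-1` U) by [].
apply: numgen_open => n s cs; apply: (oU n (to_relquot \o s)) => x.
by apply: continuous_comp; [exact: cs|exact: to_relquot_continuous].
Qed.

HB.instance Definition _ := isNumGen.Build R relquot relquot_numgen.

End relquot.

Definition ngwedge (R : realType) (I : pointedType) (X : I -> ngType R) : Type :=
  pwedge (fun i => X i : ptopologicalType).

Section ngwedge.
Context (R : realType) (I : pointedType) (X : I -> ngType R).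

HB.instance Definition _ := Topological.on (ngwedge X).
HB.instance Definition _ := Pointed.on (ngwedge X).

Definition ngwedge_in (i : I) (x : X i) : ngwedge X :=
  wedge_lift (fun i => point : (X i : ptopologicalType)) x.

Lemma ngwedge_in_continuous i : continuous (@ngwedge_in i).
Proof. exact: wedge_lift_continuous. Qed.

Lemma ngwedge_in_point i : @ngwedge_in i point = point.
Proof. exact: (wedge_liftE _ (point : X point) (point : X i)). Qed.

Lemma ngwedge_numgen (U : set (ngwedge X)) :
  (forall n (s : Delta R n -> ngwedge X), continuous s -> open (s @^-1` U)) ->
  open U.
Proof.
move=> oU; apply/(wedge_openP U) => i; apply: numgen_open => n s cs.
apply: (oU n (@ngwedge_in i \o s)) => x.
by apply: continuous_comp; [exact: cs|exact: ngwedge_in_continuous].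
Qed.

HB.instance Definition _ := isNumGen.Build R (ngwedge X) ngwedge_numgen.

End ngwedge.

Lemma cts_comp (X Y Z : topologicalType) (f : X -> Y) (g : Y -> Z) :
  continuous f -> continuous g -> continuous (g \o f).
Proof. by move=> cf cg x; apply: continuous_comp; [exact: cf|exact: cg]. Qed.

Lemma cts_pair (X Y Z : topologicalType) (f : X -> Y) (g : X -> Z) :
  continuous f -> continuous g -> continuous (fun x => (f x, g x)).
Proof. by move=> cf cg x; apply: cvg_pair => //=; [exact: cf|exact: cg]. Qed.

Lemma cts_fst (X Y : topologicalType) : continuous (@fst X Y).
Proof. by move=> x; exact: cvg_fst. Qed.

Lemma cts_snd (X Y : topologicalType) : continuous (@snd X Y).
Proof. by move=> x; exact: cvg_snd. Qed.

Section set_type_topology.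
Context {X : topologicalType} (A : set X).

Lemma set_val_continuous : continuous (@set_val X A).
Proof. exact: initial_continuous. Qed.

Lemma to_set_type_continuous (Y : topologicalType) (f : Y -> set_type A) :
  continuous (@set_val X A \o f) -> continuous f.
Proof. exact: (@continuous_comp_initial _ _ _ (@set_val X A)). Qed.

Lemma set_type_compact : compact A -> compact [set: set_type A].
Proof.
move=> cA F PF _; have [|a [Aa cla]] := cA (@set_val X A @ F) _.
  have -> : (@set_val X A @ F) A = F setT.
    by congr F; apply/seteqP; split=> // x _; exact: set_valP.
  exact: filterT.
exists (SigSub (mem_set Aa)); split=> // P B FP [_ [[V oV <-] Va VB]].
have FP' : (@set_val X A @ F) (@set_val X A @` P).
  have PP : P `<=` @set_val X A @^-1` (@set_val X A @` P) by move=> y Py; exists y.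
  exact: filterS PP FP.
have nV : nbhs a V by apply: open_nbhs_nbhs; split=> //; move: Va; rewrite set_valE.
have [x [[y Py <-] Vx]] := cla _ _ FP' nV.
by exists y; split=> //; exact: VB.
Qed.

End set_type_topology.

Lemma mx_continuous (X T : topologicalType) m n (f : X -> 'M[T]_(m, n)) :
  (forall i j, continuous (fun x => f x i j)) -> continuous f.
Proof.
move=> cf x V [P nP PV].
have : \forall y \near x, forall i j, P i j (f y i j).
  apply: filter_forall => i; apply: filter_forall => j; exact/cf/nP.
by apply: filterS => y Py; apply: PV.
Qed.

Lemma sum_continuous (R : realType) (X : topologicalType) n
    (F : 'I_n -> X -> R) :
  (forall i, continuous (F i)) -> continuous (fun x => \sum_i F i x).
Proof.
by move=> cF; apply: continuous_big => [|i _]; [exact: add_continuous|exact: cF].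
Qed.

Section Delta_topology.
Variable R : realType.

Definition Delta_coord n (t : Delta R n) (i : 'I_n.+1) : R :=
  set_val t ord0 i.

Lemma Delta_coord_ge0 n (t : Delta R n) i : 0 <= Delta_coord t i.
Proof. by have /set_mem [/(_ i)] := valP t. Qed.

Lemma Delta_coord_sum n (t : Delta R n) : \sum_i Delta_coord t i = 1.
Proof. by have /set_mem [_] := valP t. Qed.

Lemma Delta_coord_continuous n i : continuous (fun t => @Delta_coord n t i).
Proof.
move=> t; apply: (@continuous_comp _ _ _ (@set_val _ _ : Delta R n -> _)
  (fun M : 'rV[R]_n.+1 => M ord0 i)).
  exact: set_val_continuous.
exact: coord_continuous.
Qed.

Definition mkDelta n (f : 'I_n.+1 -> R) (f0 : forall i, 0 <= f i)
  (f1 : \sum_i f i = 1) : Delta R n.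
Proof.
exists (\row_i f i); apply: mem_set; split=> [i|]; first by rewrite mxE.
by under eq_bigr do rewrite mxE.
Defined.

Lemma mkDeltaE n f f0 f1 i : Delta_coord (@mkDelta n f f0 f1) i = f i.
Proof. by rewrite /Delta_coord set_valE/= mxE. Qed.

Lemma Delta_ext n (t u : Delta R n) : Delta_coord t =1 Delta_coord u -> t = u.
Proof. by move=> tu; apply: val_inj; apply/rowP => i; exact: tu. Qed.

Lemma to_Delta_continuous n (X : topologicalType) (f : X -> Delta R n) :
  (forall i, continuous (fun x => Delta_coord (f x) i)) -> continuous f.
Proof.
move=> cf; apply: to_set_type_continuous; apply: mx_continuous => i j.
by rewrite [i]ord1; exact: cf.
Qed.

Lemma Delta_compact n : compact [set: Delta R n].
Proof.
apply: set_type_compact.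
apply: (@subclosed_compact _ _
  [set v : 'rV[R]_n.+1 | forall i, `[0, 1]%classic (v ord0 i)]); last 2 first.
- exact: (@rV_compact R n.+1 (fun=> `[0, 1]%classic)
    (fun=> @segment_compact R 0 1)).
- move=> t [t0 t1] i; rewrite /= in_itv/= t0/= -t1 (bigD1 i)//= lerDl.
  exact: sumr_ge0.
rewrite (_ : mkset _ = (\bigcap_i
    ((fun t : 'rV[R]_n.+1 => t ord0 i) @^-1` [set x | 0 <= x])) `&`
    (fun t : 'rV[R]_n.+1 => \sum_i t ord0 i) @^-1` [set 1]); last first.
  by apply/seteqP; split=> t [t0 t1]; split=> //;
    by [move=> i _; exact: t0|move=> i; exact: t0].
apply: closedI.
  apply: closed_bigI => i _; apply: closed_comp; last exact: closed_ge.
  by move=> t _; exact: coord_continuous.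
apply: closed_comp; last exact: closed_eq.
by move=> t _; apply: sum_continuous => i; exact: coord_continuous.
Qed.

Lemma Delta_regular n : regular_space (Delta R n).
Proof. exact: uniform_regular. Qed.

Lemma Delta_locally_compact n : locally_compact [set: Delta R n].
Proof.
move=> t _; exists setT; first by rewrite withinET; exact: filterT.
by split; [exact: Delta_compact|exact: closedT].
Qed.

End Delta_topology.

Section unit_interval.
Variable R : realType.

Definition I01 : Type := set_type (`[0, 1] : set R).
HB.instance Definition _ := Uniform.on I01.

Definition mkI01 (t : R) (t01 : 0 <= t <= 1) : I01 :=
  SigSub (mem_set (t01 : `[0, 1]%classic t)).

Definition i0 : I01 := @mkI01 0 (introT andP (conj (lexx _) ler01)).
Definition i1 : I01 := @mkI01 1 (introT andP (conj ler01 (lexx _))).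

(* The unit interval is based at 1: the reduced cone I /\ A then has its vertex
   at t = 1 and its base, a copy of A, at t = 0. *)
HB.instance Definition _ := isPointed.Build I01 i1.

Definition I01val (t : I01) : R := set_val t.

Lemma I01val_itv (t : I01) : 0 <= I01val t <= 1.
Proof. by have /set_mem /= := valP t; rewrite in_itv. Qed.

Lemma I01val_continuous : continuous I01val.
Proof. exact: set_val_continuous. Qed.

Lemma to_I01_continuous (X : topologicalType) (f : X -> I01) :
  continuous (I01val \o f) -> continuous f.
Proof. exact: to_set_type_continuous. Qed.

Lemma I01_to_Delta_subproof (t : I01) :
  let f := fun i : 'I_2 => if i == ord0 then 1 - I01val t else I01val t in
  (forall i, 0 <= f i) /\ \sum_i f i = 1.
Proof.
have /andP[t0 t1] := I01val_itv t.
split=> [i|]; first by case: ifP => // _; rewrite subr_ge0.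
by rewrite !big_ord_recl big_ord0 /= addr0 subrK.
Qed.

Definition I01_to_Delta (t : I01) : Delta R 1 :=
  let: conj f0 f1 := I01_to_Delta_subproof t in mkDelta f0 f1.

Lemma I01_to_Delta_continuous : continuous I01_to_Delta.
Proof.
apply: to_Delta_continuous => i; rewrite /I01_to_Delta.
rewrite (_ : (fun x => _) = fun t => if i == ord0 then 1 - I01val t else I01val t).
  case: (i == ord0); last exact: I01val_continuous.
  by move=> t; apply: continuousB;
    [exact: cst_continuous|exact: I01val_continuous].
by apply/funext => t; case: I01_to_Delta_subproof => f0 f1; rewrite mkDeltaE.
Qed.

Lemma Delta_to_I01_subproof (u : Delta R 1) : 0 <= Delta_coord u ord_max <= 1.
Proof.
rewrite Delta_coord_ge0/= -(Delta_coord_sum u) (bigD1 ord_max)//= lerDl.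
by apply: sumr_ge0 => i _; exact: Delta_coord_ge0.
Qed.

Definition Delta_to_I01 (u : Delta R 1) : I01 :=
  mkI01 (Delta_to_I01_subproof u).

Lemma Delta_to_I01_continuous : continuous Delta_to_I01.
Proof. apply: to_I01_continuous; exact: Delta_coord_continuous. Qed.

Lemma I01_to_DeltaK : cancel I01_to_Delta Delta_to_I01.
Proof.
move=> t; apply: val_inj => /=; rewrite /I01_to_Delta.
by case: I01_to_Delta_subproof => f0 f1; rewrite mkDeltaE.
Qed.

Lemma I01_nu_continuous (X : topologicalType) (f : I01 -> X) :
  continuous f -> continuous (f : I01 -> nu R X).
Proof.
move=> cf.
have cg : continuous (f \o Delta_to_I01).
  move=> t; apply: continuous_comp; [exact: Delta_to_I01_continuous|exact: cf].
rewrite (_ : f = (f \o Delta_to_I01) \o I01_to_Delta); last first.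
  by apply/funext => t; rewrite /= I01_to_DeltaK.
move=> t; apply: continuous_comp; first exact: I01_to_Delta_continuous.
exact: (Delta_nu_continuous cg).
Qed.

Lemma I01_numgen (U : set I01) :
  (forall n (s : Delta R n -> I01), continuous s -> open (s @^-1` U)) -> open U.
Proof.
move=> oU; have -> : U = id @^-1` U by [].
have /continuousP := I01_nu_continuous (fun x => @cvg_id _ (nbhs (x : I01))).
by apply; exact: oU.
Qed.

HB.instance Definition _ := isNumGen.Build R I01 I01_numgen.

End unit_interval.

Section Delta_prod.
Variable R : realType.

(* Delta^m x Delta^n is a retract of a simplex: a point of the latter is a joint
   distribution, sent to its two marginals, and the section is the product
   distribution. Hence nu does not change the topology of Delta^m x Delta^n. *)
Section marginals.
Variables m n : nat.
Let N := ((m.+1 * n.+1)%N).-1.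

Lemma card_mn : #|{: 'I_m.+1 * 'I_n.+1}| = N.+1.
Proof. by rewrite card_prod !card_ord. Qed.

Definition mn_of (k : 'I_N.+1) : ('I_m.+1 * 'I_n.+1)%type :=
  enum_val (cast_ord (esym card_mn) k).
Definition of_mn (p : ('I_m.+1 * 'I_n.+1)%type) : 'I_N.+1 :=
  cast_ord card_mn (enum_rank p).

Lemma mn_ofK : cancel mn_of of_mn.
Proof. by move=> k; rewrite /of_mn enum_valK cast_ordKV. Qed.
Lemma of_mnK : cancel of_mn mn_of.
Proof. by move=> k; rewrite /mn_of cast_ordK enum_rankK. Qed.

Lemma sum_mn (F : ('I_m.+1 * 'I_n.+1)%type -> R) :
  \sum_(k < N.+1) F (mn_of k) = \sum_i \sum_j F (i, j).
Proof.
rewrite pair_bigA /= (reindex of_mn) /=; last first.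
  by exists mn_of => k _; rewrite ?of_mnK ?mn_ofK.
by apply: eq_bigr => -[i j] _; rewrite of_mnK.
Qed.

Lemma marginal1_subproof (u : Delta R N) :
  let f := fun i => \sum_j Delta_coord u (of_mn (i, j)) in
  (forall i, 0 <= f i) /\ \sum_i f i = 1.
Proof.
split=> [i|]; first by apply: sumr_ge0 => j _; exact: Delta_coord_ge0.
rewrite -(sum_mn (fun p => Delta_coord u (of_mn p))) -(Delta_coord_sum u).
by apply: eq_bigr => k _; rewrite mn_ofK.
Qed.

Lemma marginal2_subproof (u : Delta R N) :
  let f := fun j => \sum_i Delta_coord u (of_mn (i, j)) in
  (forall i, 0 <= f i) /\ \sum_i f i = 1.
Proof.
split=> [i|]; first by apply: sumr_ge0 => j _; exact: Delta_coord_ge0.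
rewrite exchange_big/=.
rewrite -(sum_mn (fun p => Delta_coord u (of_mn p))) -(Delta_coord_sum u).
by apply: eq_bigr => k _; rewrite mn_ofK.
Qed.

Lemma coupling_subproof (p : (Delta R m * Delta R n)%type) :
  let f := fun k => Delta_coord p.1 (mn_of k).1 * Delta_coord p.2 (mn_of k).2 in
  (forall k, 0 <= f k) /\ \sum_k f k = 1.
Proof.
split=> [k|]; first by rewrite mulr_ge0// Delta_coord_ge0.
rewrite (sum_mn (fun q => Delta_coord p.1 q.1 * Delta_coord p.2 q.2))/=.
under eq_bigr do rewrite -mulr_sumr Delta_coord_sum mulr1.
exact: Delta_coord_sum.
Qed.

Definition marginal1 (u : Delta R N) : Delta R m :=
  let: conj f0 f1 := marginal1_subproof u in mkDelta f0 f1.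
Definition marginal2 (u : Delta R N) : Delta R n :=
  let: conj f0 f1 := marginal2_subproof u in mkDelta f0 f1.
Definition coupling (p : (Delta R m * Delta R n)%type) : Delta R N :=
  let: conj f0 f1 := coupling_subproof p in mkDelta f0 f1.

Lemma marginal1E u i :
  Delta_coord (marginal1 u) i = \sum_j Delta_coord u (of_mn (i, j)).
Proof. by rewrite /marginal1; case: marginal1_subproof => *; rewrite mkDeltaE. Qed.
Lemma marginal2E u j :
  Delta_coord (marginal2 u) j = \sum_i Delta_coord u (of_mn (i, j)).
Proof. by rewrite /marginal2; case: marginal2_subproof => *; rewrite mkDeltaE. Qed.
Lemma couplingE p k : Delta_coord (coupling p) k =
  Delta_coord p.1 (mn_of k).1 * Delta_coord p.2 (mn_of k).2.
Proof. by rewrite /coupling; case: coupling_subproof => *; rewrite mkDeltaE. Qed.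

Lemma marginal1_coupling p : marginal1 (coupling p) = p.1.
Proof.
apply: Delta_ext => i; rewrite marginal1E.
under eq_bigr do rewrite couplingE of_mnK/=.
by rewrite -mulr_sumr Delta_coord_sum mulr1.
Qed.

Lemma marginal2_coupling p : marginal2 (coupling p) = p.2.
Proof.
apply: Delta_ext => i; rewrite marginal2E.
under eq_bigr do rewrite couplingE of_mnK/=.
by rewrite -mulr_suml Delta_coord_sum mul1r.
Qed.

Lemma marginal1_continuous : continuous marginal1.
Proof.
apply: to_Delta_continuous => i; under eq_fun do rewrite marginal1E.
by apply: sum_continuous => j; exact: Delta_coord_continuous.
Qed.

Lemma marginal2_continuous : continuous marginal2.
Proof.
apply: to_Delta_continuous => i; under eq_fun do rewrite marginal2E.
by apply: sum_continuous => j; exact: Delta_coord_continuous.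
Qed.

Lemma coupling_continuous : continuous coupling.
Proof.
apply: to_Delta_continuous => k; under eq_fun do rewrite couplingE.
have c1 := cts_comp (@cts_fst (Delta R m) (Delta R n))
  (@Delta_coord_continuous R m (mn_of k).1).
have c2 := cts_comp (@cts_snd (Delta R m) (Delta R n))
  (@Delta_coord_continuous R n (mn_of k).2).
by move=> p; exact: (continuousM (c1 p) (c2 p)).
Qed.

End marginals.

Lemma Delta_prod_nu_continuous m n (X : topologicalType)
    (f : (Delta R m * Delta R n)%type -> X) :
  continuous f -> continuous (f : (Delta R m * Delta R n)%type -> nu R X).
Proof.
move=> cf; pose g u := f (marginal1 u, marginal2 u).
have cg : continuous g.
  exact: (cts_comp (cts_pair (@marginal1_continuous m n)
    (@marginal2_continuous m n)) cf).
rewrite (_ : f = g \o @coupling m n); last first.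
  apply/funext => p; rewrite /g/= marginal1_coupling marginal2_coupling.
  by rewrite -surjective_pairing.
exact: (cts_comp (@coupling_continuous m n) (Delta_nu_continuous cg)).
Qed.

End Delta_prod.

HB.instance Definition _ (X Y : ptopologicalType) := Pointed.on (X * Y)%type.

Record pointed_map (X Y : ptopologicalType) := PointedMap {
  pmap_fun :> X -> Y;
  pmap_cts : continuous pmap_fun;
  pmap_pt : pmap_fun point = point
}.

Lemma pmap_ext (X Y : ptopologicalType) (f g : pointed_map X Y) : f =1 g -> f = g.
Proof.
case: f g => [f cf pf] [g cg pg] /= /funext fg; rewrite -{}fg in cg pg *.
by congr PointedMap; exact: Prop_irrelevance.
Qed.

Lemma pmap_id_cts (X : ptopologicalType) : continuous (id : X -> X).
Proof. by move=> x; exact: cvg_id. Qed.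

Definition pmap_id (X : ptopologicalType) : pointed_map X X :=
  PointedMap (@pmap_id_cts X) (erefl point).

Lemma pmap_comp_pt (X Y Z : ptopologicalType) (g : pointed_map Y Z) (f : pointed_map X Y) :
  (g \o f) point = point.
Proof. by rewrite /= !pmap_pt. Qed.

Definition pmap_comp (X Y Z : ptopologicalType) (g : pointed_map Y Z) (f : pointed_map X Y) :
  pointed_map X Z := PointedMap (cts_comp (@pmap_cts _ _ f) (@pmap_cts _ _ g)) (pmap_comp_pt g f).

Lemma pmap_cst_cts (X Y : ptopologicalType) : continuous (fun _ : X => point : Y).
Proof. exact: cst_continuous. Qed.

Definition pmap_cst (X Y : ptopologicalType) : pointed_map X Y :=
  PointedMap (@pmap_cst_cts X Y) (erefl point).

Section smash.
Variable R : realType.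

Definition smash (X Y : ptopologicalType) : ngType R :=
  @relquot R (nu R (X * Y)%type)
    (fun p q => (p.1 = point \/ p.2 = point) /\ (q.1 = point \/ q.2 = point)).

Definition smash_in (X Y : ptopologicalType) (x : X) (y : Y) : smash X Y :=
  to_relquot _ ((x, y) : nu R (X * Y)%type).

Lemma smash_in_continuous (X Y : ptopologicalType) :
  continuous ((fun p => smash_in p.1 p.2) : nu R (X * Y)%type -> smash X Y).
Proof.
rewrite (_ : (fun p => _) = to_relquot _)//; last first.
  by apply/funext => -[x y].
exact: to_relquot_continuous.
Qed.

Lemma smash_in_pointl (X Y : ptopologicalType) (y : Y) :
  smash_in (point : X) y = point.
Proof. by apply: class_of_eq; split; left. Qed.

Lemma smash_in_pointr (X Y : ptopologicalType) (x : X) :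
  smash_in x (point : Y) = point.
Proof. by apply: class_of_eq; split; [right|left]. Qed.

Definition S1 : ngType R :=
  @relquot R (I01 R) (fun s t => (s = i0 R \/ s = i1 R) /\ (t = i0 R \/ t = i1 R)).

Definition cone (X : ptopologicalType) : ngType R := smash (I01 R) X.

Definition susp (X : ptopologicalType) : ngType R := smash S1 X.

Section susp_map.
Variables (X Y : ptopologicalType) (f : pointed_map X Y).

Definition susp_fun : susp X -> susp Y :=
  (fun p : nu R (S1 * X)%type => smash_in p.1 (f p.2)) \o repr.

Lemma susp_fun_in (s : S1) (x : X) : susp_fun (smash_in s x) = smash_in s (f x).
Proof.
rewrite /susp_fun/= /smash_in/to_relquot.
apply: (@genquot_fun_class _ _ _ (fun p : nu R (S1 * X)%type => smash_in p.1 (f p.2))).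
move=> [s1 x1] [s2 x2] /= [h1 h2]; apply: class_of_eq; split=> /=.
  by case: h1 => ->; [left|right; exact: pmap_pt].
by case: h2 => ->; [left|right; exact: pmap_pt].
Qed.

Lemma nu_map_continuous (S T : topologicalType) (g : S -> T) :
  continuous g -> continuous (g : nu R S -> nu R T).
Proof.
move=> cg; apply: nu_continuous => n s cs.
exact: (Delta_nu_continuous (cts_comp cs cg)).
Qed.

Lemma susp_fun_cts : continuous susp_fun.
Proof.
apply: relquot_fun_continuous.
  have cg : continuous (fun p : (S1 * X)%type => (p.1, f p.2)).
    exact: (cts_pair (@cts_fst S1 X) (cts_comp (@cts_snd S1 X) (@pmap_cts _ _ f))).
  exact: (cts_comp (nu_map_continuous cg) (@smash_in_continuous S1 Y)).
move=> [s1 x1] [s2 x2] /= [h1 h2]; apply: class_of_eq; split=> /=.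
  by case: h1 => ->; [left|right; exact: pmap_pt].
by case: h2 => ->; [left|right; exact: pmap_pt].
Qed.

Lemma susp_fun_pt : susp_fun point = point.
Proof.
by rewrite -(smash_in_pointl S1 (point : X)) susp_fun_in smash_in_pointl.
Qed.

Definition susp_map : pointed_map (susp X) (susp Y) := PointedMap susp_fun_cts susp_fun_pt.

End susp_map.

Section cofiber.
Variables (A X : ngType R) (i : pointed_map A X).

(* X u CA as the pushout in NG_0: the wedge (coproduct) of X and CA, with i a
   identified with the point [0, a] of the cone. *)
Definition cof_summand (b : bool) : ngType R := if b then X else cone A.

Definition cofiber : ngType R :=
  @relquot R (ngwedge cof_summand)
    (fun u v => exists a : A,
      u = @ngwedge_in R bool cof_summand true (i a) /\
      v = @ngwedge_in R bool cof_summand false (smash_in (i0 R) a)).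

Definition cofiber_in_fun (x : X) : cofiber :=
  to_relquot _ (@ngwedge_in R bool cof_summand true x).

Definition cofiber_cone_fun (c : cone A) : cofiber :=
  to_relquot _ (@ngwedge_in R bool cof_summand false c).

Lemma cofiber_in_cts : continuous cofiber_in_fun.
Proof.
exact: (cts_comp (@ngwedge_in_continuous R bool cof_summand true)
  (@to_relquot_continuous R _ _)).
Qed.

Lemma cofiber_cone_cts : continuous cofiber_cone_fun.
Proof.
exact: (cts_comp (@ngwedge_in_continuous R bool cof_summand false)
  (@to_relquot_continuous R _ _)).
Qed.

Lemma cofiber_in_pt : cofiber_in_fun point = point.
Proof. by congr class_of; exact: (@ngwedge_in_point R bool cof_summand true). Qed.

Lemma cofiber_cone_pt : cofiber_cone_fun point = point.
Proof. by congr class_of; exact: (@ngwedge_in_point R bool cof_summand false). Qed.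

Definition cofiber_in : pointed_map X cofiber := PointedMap cofiber_in_cts cofiber_in_pt.

Lemma cofiber_glue a : cofiber_in_fun (i a) = cofiber_cone_fun (smash_in (i0 R) a).
Proof. by apply: class_of_eq; exists a. Qed.

End cofiber.

Definition wedge_self (X : ngType R) : ngType R :=
  ngwedge (fun _ : bool => X).

Section wedge_self.
Variable X : ngType R.

Definition wedge_self_fun (g : bool -> pointed_map X X) (w : wedge_self X) : X :=
  wedge_fun (p0 := fun _ : bool => point : X) (fun b => g b : X -> X) w.

Lemma wedge_self_fun_cts g : continuous (wedge_self_fun g).
Proof.
apply: wedge_fun_continuous => [b|b c]; first exact: pmap_cts.
by rewrite !pmap_pt.
Qed.

Lemma wedge_self_fun_in g b x :
  wedge_self_fun g (@ngwedge_in R bool (fun=> X) b x) = g b x.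
Proof.
apply: (@wedge_lift_funE bool (fun=> X) (fun=> point) X (fun b => g b : X -> X)).
by move=> c d; rewrite !pmap_pt.
Qed.

Lemma wedge_self_fun_pt g : wedge_self_fun g point = point.
Proof.
rewrite -(@ngwedge_in_point R bool (fun=> X) true) wedge_self_fun_in.
exact: pmap_pt.
Qed.

Definition wedge_self_map g : pointed_map (wedge_self X) X :=
  PointedMap (@wedge_self_fun_cts g) (wedge_self_fun_pt g).

Definition wedge_proj (b : bool) : pointed_map (wedge_self X) X :=
  wedge_self_map (fun c => if c == b then pmap_id X else pmap_cst X X).

Definition wedge_fold : pointed_map (wedge_self X) X := wedge_self_map (fun=> pmap_id X).

End wedge_self.

End smash.

Section function_space.
Variables (R : realType) (X Y : ptopologicalType).

Record smap0 := SMap {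
  smap_fun :> X -> Y;
  smap_cts : forall n (s : Delta R n -> X),
    continuous s -> continuous (smap_fun \o s);
  smap_pt : smap_fun point = point
}.

HB.instance Definition _ := gen_eqMixin smap0.
HB.instance Definition _ := gen_choiceMixin smap0.

Definition smap_restrict (f : smap0) :
    prod_topology (fun s : {n & continuousType (Delta R n) X} =>
      {compact-open, Delta R (projT1 s) -> Y}) :=
  fun s => f \o projT2 s.

HB.instance Definition _ :=
  Topological.copy smap0 (initial_topology smap_restrict).

Lemma smap_cst_cts n (s : Delta R n -> X) :
  continuous s -> continuous ((fun _ : X => point : Y) \o s).
Proof. by move=> _; exact: cst_continuous. Qed.

HB.instance Definition _ :=
  isPointed.Build smap0 (SMap smap_cst_cts (erefl point)).

Definition F0 : ngType R := nu R smap0.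

Lemma to_smap0_continuous (Z : topologicalType) (F : Z -> smap0) :
  (forall n (s : Delta R n -> X), continuous s ->
    continuous (fun z => F z \o s : {compact-open, Delta R n -> Y})) ->
  continuous F.
Proof.
move=> cF; apply: (@continuous_comp_initial _ _ _ smap_restrict) => z.
apply/cvg_sup => -[n s] U [_ [[V oV <-] Vz VU]].
have nV : nbhs z [set z' | V (F z' \o s)].
  by apply: (cF n s (@cts_fun _ _ s) z V); exact: open_nbhs_nbhs.
suff: nbhs z ((smap_restrict \o F) @^-1` U) by [].
by apply: filterS nV => z' Vz'; exact: VU.
Qed.

Lemma smap0_comp_continuous n (s : Delta R n -> X) : continuous s ->
  continuous (fun f : smap0 => f \o s : {compact-open, Delta R n -> Y}).
Proof.
move=> cs; pose s' : {n & continuousType (Delta R n) X} := 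
    existT _ n (mkcts cs : continuousType _ _).
exact: (cts_comp (@initial_continuous _ _ smap_restrict) (@proj_continuous _ _ s')).
Qed.

Lemma smap0_eval_continuous n (F : Delta R n -> smap0) (s : Delta R n -> X) :
  continuous F -> continuous s -> continuous (fun t => F t (s t)).
Proof.
move=> cF cs.
have cG := cts_comp cF (smap0_comp_continuous cs).
have cu := continuous_uncurry_regular (@Delta_locally_compact R n)
  (@Delta_regular R n) cG (fun t => @smap_cts (F t) n s cs).
exact: (cts_comp (cts_pair (fun t => @cvg_id _ (nbhs t))
  (fun t => @cvg_id _ (nbhs t))) cu).
Qed.

End function_space.

(* When X is numerically generated, the elements of smap_0(X, Y) are exactly the
   pointed continuous maps. *)
Section F0_pmap.
Variables (R : realType) (X Y : ngType R).

Definition F0_of_pmap (f : pointed_map X Y) : F0 R X Y :=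
  SMap (fun n (s : Delta R n -> X) cs => cts_comp cs (@pmap_cts _ _ f))
    (pmap_pt f).

Definition pmap_of_F0 (f : F0 R X Y) : pointed_map X Y :=
  PointedMap (numgen_continuous (@smap_cts R X Y f)) (smap_pt f).

Lemma F0_of_pmapK : cancel F0_of_pmap pmap_of_F0.
Proof. by move=> f; exact: pmap_ext. Qed.

End F0_pmap.

Section phomotopy.
Variable R : realType.

(* Pointed maps I_+ /\ Y -> Z, unfolded: maps on the product in NG that send
   I x {basepoint} to the basepoint. *)
Record phomotopy (Y Z : ptopologicalType) := PHomotopy {
  ph_fun :> nu R (I01 R * Y)%type -> Z;
  ph_cts : continuous ph_fun;
  ph_pt : forall t, ph_fun (t, point) = point
}.

Definition phomotopic (Y Z : ptopologicalType) (f g : pointed_map Y Z) : Prop :=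
  exists H : phomotopy Y Z,
    (forall y, H (i0 R, y) = f y) /\ (forall y, H (i1 R, y) = g y).

Definition null_homotopy (Y Z : ptopologicalType) (g : pointed_map Y Z)
    (H : phomotopy Y Z) : Prop :=
  (forall y, H (i0 R, y) = g y) /\ (forall y, H (i1 R, y) = point).

Lemma nu_slice_continuous (Y : ngType R) (t : I01 R) :
  continuous (fun y : Y => (t, y) : nu R (I01 R * Y)%type).
Proof.
apply: numgen_continuous => n s cs; apply: Delta_nu_continuous.
exact: (cts_pair (@cst_continuous _ _ t) cs).
Qed.

Definition ph_at (Y : ngType R) (Z : ptopologicalType) (H : phomotopy Y Z)
    (t : I01 R) : pointed_map Y Z :=
  PointedMap (cts_comp (@nu_slice_continuous Y t) (@ph_cts _ _ H)) (ph_pt H t).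

Lemma ph_F0_continuous (Y Z : ngType R) (H : phomotopy Y Z) n
    (s : Delta R n -> I01 R) : continuous s ->
  continuous (fun u => F0_of_pmap (ph_at H (s u)) : F0 R Y Z).
Proof.
move=> cs; apply: (@Delta_nu_continuous R (smap0 R Y Z)).
apply: to_smap0_continuous => m r cr.
have cf : continuous (fun p : (Delta R n * Delta R m)%type => (s p.1, r p.2)).
  exact: (cts_pair (cts_comp (@cts_fst _ _) cs) (cts_comp (@cts_snd _ _) cr)).
exact: (continuous_curry_fun (cts_comp (Delta_prod_nu_continuous cf) (@ph_cts _ _ H))).
Qed.

(* The homotopy (t, a) |-> [t, a] of A within CA, from the inclusion (t = 0) to
   the constant map (t = 1), viewed in X u CA. *)
Definition contraction_fun (A X : ngType R) (i : pointed_map A X)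
    (p : nu R (I01 R * A)%type) : cofiber i :=
  cofiber_cone_fun i (smash_in R p.1 p.2).

Lemma contraction_cts (A X : ngType R) (i : pointed_map A X) :
  continuous (contraction_fun i).
Proof.
exact: (cts_comp (@smash_in_continuous R (I01 R) A) (@cofiber_cone_cts R A X i)).
Qed.

Lemma contraction_pt (A X : ngType R) (i : pointed_map A X) t :
  contraction_fun i (t, point) = point.
Proof.
by rewrite /contraction_fun smash_in_pointr (cofiber_cone_pt i).
Qed.

Definition contraction (A X : ngType R) (i : pointed_map A X) :
    phomotopy A (cofiber i) :=
  PHomotopy (@contraction_cts A X i) (contraction_pt i).

Lemma contraction_null (A X : ngType R) (i : pointed_map A X) :
  null_homotopy (pmap_comp (cofiber_in i) i) (contraction i).
Proof.
split=> a; first exact/esym/cofiber_glue.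
by rewrite /= /contraction_fun smash_in_pointl (cofiber_cone_pt i).
Qed.

End phomotopy.

Section functors.
Variables (R : realType) (C : ngType R -> Prop).

Record obj := Obj { obj_space :> ngType R; obj_in : C obj_space }.

Record pfunctor := PFunctor {
  pf_obj :> obj -> ngType R;
  pf_map : forall X Y : obj, pointed_map X Y -> pointed_map (pf_obj X) (pf_obj Y);
  pf_id : forall X : obj, pf_map (pmap_id X) = pmap_id (pf_obj X);
  pf_comp : forall (X Y Z : obj) (g : pointed_map Y Z) (f : pointed_map X Y),
    pf_map (pmap_comp g f) = pmap_comp (pf_map g) (pf_map f)
}.

Definition pf_F0 (T : pfunctor) (X Y : obj) (f : F0 R X Y) : F0 R (T X) (T Y) :=
  F0_of_pmap (pf_map T (pmap_of_F0 f)).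

Definition enriched (T : pfunctor) : Prop :=
  forall X Y : obj, continuous (@pf_F0 T X Y) /\ pf_F0 T (point : F0 R X Y) = point.

Record enriched_functor := EnrichedFunctor {
  ef_functor :> pfunctor;
  ef_enriched : enriched ef_functor
}.

Section induced_homotopy.
Variables (T : enriched_functor) (Y Z : obj) (H : phomotopy R Y Z).

(* The homotopy I_+ /\ TY -> TZ that T induces from H : I_+ /\ Y -> Z, as the
   adjoint of I_+ -> F_0(Y, Z) -> F_0(TY, TZ). *)
Definition ef_homotopy_fun (p : nu R (I01 R * T Y)%type) : T Z :=
  pf_map T (ph_at H p.1) p.2.

Lemma ef_homotopy_cts : continuous ef_homotopy_fun.
Proof.
apply: nu_continuous => n s cs.
have cH := @ph_F0_continuous R Y Z H n _ (cts_comp cs (@cts_fst _ _)).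
have cT := cts_comp (cts_comp cH (ef_enriched T Y Z).1) (@nu_id_continuous R _).
have cE := smap0_eval_continuous cT (cts_comp cs (@cts_snd _ _)).
suff <- : (fun u => (pf_F0 T (F0_of_pmap (ph_at H (s u).1)) : smap0 R _ _)
  (s u).2) = ef_homotopy_fun \o s by exact: cE.
by apply/funext => u /=; rewrite F0_of_pmapK.
Qed.

Lemma ef_homotopy_pt t : ef_homotopy_fun (t, point) = point.
Proof. exact: pmap_pt. Qed.

Definition ef_homotopy : phomotopy R (T Y) (T Z) :=
  PHomotopy ef_homotopy_cts ef_homotopy_pt.

End induced_homotopy.

Lemma ef_pcst (T : enriched_functor) (X Y : obj) (f : pointed_map X Y) :
  (forall x, f x = point) -> forall u, pf_map T f u = point.
Proof.
move=> f0 u; have /(congr1 (@smap_fun R (T X) (T Y))) := (ef_enriched T X Y).2.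
move=> /(congr1 (fun g => g u)) /= <-; congr (pf_map T _ u).
by apply: pmap_ext => x; rewrite f0.
Qed.

Lemma ef_homotopy_null (T : enriched_functor) (A X Y : obj) (i : pointed_map A X)
    (j : pointed_map X Y) (H : phomotopy R A Y) :
  null_homotopy (pmap_comp j i) H ->
  null_homotopy (pmap_comp (pf_map T j) (pf_map T i)) (ef_homotopy T H).
Proof.
move=> [H0 H1]; split=> u /=; rewrite /ef_homotopy_fun/=.
  rewrite (_ : ph_at H (i0 R) = pmap_comp j i) ?pf_comp//.
  by apply: pmap_ext => a; exact: H0.
by apply: ef_pcst => a; exact: H1.
Qed.

End functors.

Section homotopy_fiber.
Variable R : realType.

Definition paths (Y : topologicalType) : Type := continuousType (I01 R) Y.

Definition path_fun (Y : topologicalType) (l : paths Y) :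
  {compact-open, I01 R -> Y} := (l : continuousType (I01 R) Y).

HB.instance Definition _ (Y : topologicalType) :=
  Choice.copy (paths Y) (continuousType (I01 R) Y).
HB.instance Definition _ (Y : topologicalType) :=
  Topological.copy (paths Y) (initial_topology (@path_fun Y)).

Definition mk_paths (Y : topologicalType) (l : I01 R -> Y) (cl : continuous l) :
  paths Y := (mkcts cl : continuousType (I01 R) Y).

Section fiber.
Variables (X Y : ptopologicalType) (f : pointed_map X Y).

Definition mapping_path : topologicalType :=
  set_type [set e : (X * paths Y)%type | f e.1 = path_fun e.2 (i0 R)].

Definition mapping_path_end (e : mapping_path) : Y :=
  path_fun (set_val e).2 (i1 R).

Definition hfiber : Type :=
  set_type [set e : mapping_path | mapping_path_end e = point].
HB.instance Definition _ := Topological.on hfiber.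

Definition mk_mapping_path (x : X) (l : paths Y) (e : f x = path_fun l (i0 R)) :
  mapping_path := SigSub (mem_set (e : (mkset (fun e : (X * paths Y)%type =>
    f e.1 = path_fun e.2 (i0 R))) (x, l))).

Definition mk_hfiber (x : X) (l : paths Y) (e0 : f x = path_fun l (i0 R))
    (e1 : path_fun l (i1 R) = point) : hfiber :=
  SigSub (mem_set (e1 : (mkset (fun e : mapping_path =>
    mapping_path_end e = point)) (mk_mapping_path e0))).

Definition hfiber_fst (e : hfiber) : X := (set_val (set_val e)).1.
Definition hfiber_path (e : hfiber) : paths Y := (set_val (set_val e)).2.

Lemma hfiber_ext (e e' : hfiber) :
  hfiber_fst e = hfiber_fst e' -> hfiber_path e = hfiber_path e' -> e = e'.
Proof.
move=> h1 h2; apply: val_inj; apply: val_inj; rewrite -!set_valE.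
rewrite [LHS]surjective_pairing [RHS]surjective_pairing.
by congr pair; [exact: h1|exact: h2].
Qed.

HB.instance Definition _ := isPointed.Build hfiber
  (@mk_hfiber point (mk_paths (@cst_continuous _ _ point)) (pmap_pt f) erefl).

End fiber.

Section fibration_map.
Variables (Z : ngType R) (X Y : ptopologicalType).
Variables (i : pointed_map Z X) (f : pointed_map X Y) (H : phomotopy R Z Y).
Hypothesis H_null : null_homotopy (pmap_comp f i) H.

Lemma fibration_path_cts (z : Z) : continuous (fun t : I01 R => H (t, z)).
Proof.
have ct : continuous (fun t : I01 R => (t, z)).
  exact: (cts_pair (fun t => @cvg_id _ (nbhs t)) (@cst_continuous _ _ z)).
exact: (cts_comp (I01_nu_continuous ct) (@ph_cts _ _ _ H)).
Qed.

(* z |-> (i z, t |-> H (t, z)) *)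
Definition fibration_fun (z : Z) : hfiber f :=
  @mk_hfiber X Y f (i z) (mk_paths (@fibration_path_cts z))
    (esym (H_null.1 z)) (H_null.2 z).

Lemma fibration_fun_cts : continuous fibration_fun.
Proof.
apply: to_set_type_continuous; apply: to_set_type_continuous.
apply: (@cts_pair _ _ _ i (fun z => mk_paths (@fibration_path_cts z))).
  exact: pmap_cts.
apply: (@continuous_comp_initial _ _ _ (@path_fun Y)).
apply: numgen_continuous => n s cs.
have cf : continuous (fun p : (Delta R n * Delta R 1)%type =>
    (Delta_to_I01 p.2, s p.1)).
  exact: (cts_pair (cts_comp (@cts_snd _ _) (@Delta_to_I01_continuous R))
    (cts_comp (@cts_fst _ _) cs)).
have cg : continuous (fun p : (Delta R n * I01 R)%type => (p.1, I01_to_Delta p.2)).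
  exact: (cts_pair (@cts_fst _ _)
    (cts_comp (@cts_snd _ _) (@I01_to_Delta_continuous R))).
have cH := cts_comp cg
  (cts_comp (Delta_prod_nu_continuous cf) (@ph_cts _ _ _ H)).
have := continuous_curry_fun cH; set h := (X in curry X).
rewrite (_ : curry h = (@path_fun Y \o
  (fun z => mk_paths (@fibration_path_cts z))) \o s)//.
by apply/funext => u; apply/funext => t; rewrite /h/curry/= I01_to_DeltaK.
Qed.

Lemma fibration_fun_pt : fibration_fun point = point.
Proof.
apply: hfiber_ext; first exact: pmap_pt.
by apply/continuousEP => t; exact: ph_pt.
Qed.

Definition fibration_map : pointed_map Z (hfiber f) :=
  PointedMap fibration_fun_cts fibration_fun_pt.

End fibration_map.

End homotopy_fiber.

Section homotopy_groups.
Variable R : realType.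

Definition cube (n : nat) : topologicalType :=
  set_type [set t : 'rV[R]_n | forall i, 0 <= t ord0 i <= 1].

Definition cube_coord n (t : cube n) (i : 'I_n) : R := set_val t ord0 i.

Definition cube_bd n (t : cube n) : Prop :=
  exists i, cube_coord t i = 0 \/ cube_coord t i = 1.

Definition mk_cube n (f : 'I_n -> R) (f01 : forall i, 0 <= f i <= 1) : cube n.
Proof.
by exists (\row_i f i); apply: mem_set => i; rewrite mxE.
Defined.

Lemma mk_cubeE n (f : 'I_n -> R) f01 i : cube_coord (@mk_cube n f f01) i = f i.
Proof. by rewrite /cube_coord set_valE/= mxE. Qed.

Lemma cube_coord_itv n (t : cube n) i : 0 <= cube_coord t i <= 1.
Proof. exact: (set_valP t i). Qed.

Lemma cube_coord_continuous n i : continuous (fun t => @cube_coord n t i).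
Proof.
exact: (cts_comp (@set_val_continuous _ _) (@coord_continuous R 1 n ord0 i)).
Qed.

Lemma to_cube_continuous n (X : topologicalType) (f : X -> cube n) :
  (forall i, continuous (fun x => cube_coord (f x) i)) -> continuous f.
Proof.
move=> cf; apply: to_set_type_continuous; apply: mx_continuous => i j.
by rewrite [i]ord1; exact: cf.
Qed.

Section hgroup.
Variables (n : nat) (X : topologicalType) (x : X).

(* Maps of pairs (I^n, boundary) -> (X, x). For n = 0 the boundary is empty, so
   hgroup 0 x is the set of path components of X, for any x. *)
Record gloop := GLoop {
  gl_fun :> cube n -> X;
  gl_cts : continuous gl_fun;
  gl_bd : forall t, cube_bd t -> gl_fun t = x
}.
HB.instance Definition _ := gen_eqMixin gloop.
HB.instance Definition _ := gen_choiceMixin gloop.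

Definition gloop_homotopic (a b : gloop) : Prop :=
  exists H : (I01 R * cube n)%type -> X,
    [/\ continuous H,
        forall t, H (i0 R, t) = a t,
        forall t, H (i1 R, t) = b t &
        forall s t, cube_bd t -> H (s, t) = x].

Definition hgroup : Type := genquot gloop_homotopic.
HB.instance Definition _ := Choice.on hgroup.
HB.instance Definition _ := isPointed.Build hgroup
  (class_of gloop_homotopic
    (GLoop (@cst_continuous _ _ x) (fun _ _ => erefl x))).

End hgroup.

Section hgroup_map.
Variables (n : nat) (X Y : topologicalType) (f : X -> Y) (cf : continuous f).
Variables (x : X) (y : Y) (fx : f x = y).

Lemma gloop_map_bd (a : gloop n x) t : cube_bd t -> (f \o a) t = y.
Proof. by move=> bt; rewrite /= gl_bd. Qed.

Definition gloop_map (a : gloop n x) : gloop n y :=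
  GLoop (cts_comp (@gl_cts _ _ _ a) cf) (@gloop_map_bd a).

Definition hgroup_map (a : hgroup n x) : hgroup n y :=
  class_of (@gloop_homotopic n Y y) (gloop_map (repr a)).

End hgroup_map.

Section hgroup_mul.
Variables (n : nat) (X : topologicalType) (x : X).

Lemma cube_fst_subproof (t : cube n.+1) (i : 'I_n.+1) :
  0 <= (if i == ord0 then Num.min (2 * cube_coord t i) 1 else cube_coord t i) <= 1.
Proof.
have /andP[t0 t1] := cube_coord_itv t i; case: ifP => _; last by rewrite t0.
by rewrite le_min ler01 andbT ge_min lexx orbT andbT mulr_ge0.
Qed.

Lemma cube_snd_subproof (t : cube n.+1) (i : 'I_n.+1) :
  0 <= (if i == ord0 then Num.max (2 * cube_coord t i - 1) 0 else cube_coord t i)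
    <= 1.
Proof.
have /andP[t0 t1] := cube_coord_itv t i; case: ifP => _; last by rewrite t0.
rewrite le_max lexx orbT/= ge_max ler01 andbT lerBlDr.
by rewrite -[leRHS]/(2 : R) ler_piMr.
Qed.

Definition cube_fst (t : cube n.+1) : cube n.+1 := mk_cube (cube_fst_subproof t).
Definition cube_snd (t : cube n.+1) : cube n.+1 := mk_cube (cube_snd_subproof t).

Lemma cube_fst_continuous : continuous cube_fst.
Proof.
apply: to_cube_continuous => i; under eq_fun do rewrite mk_cubeE.
case: (i == ord0); last exact: cube_coord_continuous.
move=> t; apply: (@continuous_min R (cube n.+1)
  (fun t => 2 * cube_coord t i) (fun=> 1)); last exact: cst_continuous.
by apply: continuousM; [exact: cst_continuous|exact: cube_coord_continuous].
Qed.

Lemma cube_snd_continuous : continuous cube_snd.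
Proof.
apply: to_cube_continuous => i; under eq_fun do rewrite mk_cubeE.
case: (i == ord0); last exact: cube_coord_continuous.
move=> t; apply: (@continuous_max R (cube n.+1)
  (fun t => 2 * cube_coord t i - 1) (fun=> 0)); last exact: cst_continuous.
apply: continuousB; last exact: cst_continuous.
by apply: continuousM; [exact: cst_continuous|exact: cube_coord_continuous].
Qed.

(* The min and max in [cube_fst] and [cube_snd] only make these maps total. *)
Definition concat_fun (a b : gloop n.+1 x) (t : cube n.+1) : X :=
  if cube_coord t ord0 <= 2^-1 then a (cube_fst t) else b (cube_snd t).

Lemma concat_cts (a b : gloop n.+1 x) : continuous (concat_fun a b).
Proof.
pose A := [set t : cube n.+1 | cube_coord t ord0 <= 2^-1].
pose B := [set t : cube n.+1 | 2^-1 <= cube_coord t ord0].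
have AB : A `|` B = setT.
  by apply/seteqP; split=> // t _; case: (leP (cube_coord t ord0) 2^-1) => [|/ltW];
    [left|right].
have ca := cts_comp cube_fst_continuous (@gl_cts _ _ _ a).
have cb := cts_comp cube_snd_continuous (@gl_cts _ _ _ b).
apply/continuous_subspace_setT; rewrite -AB; apply: withinU_continuous.
- apply: (@closed_comp _ _ (fun t : cube n.+1 => cube_coord t ord0) [set y | y <= 2^-1]).
    by move=> t _; exact: cube_coord_continuous.
  exact: closed_le.
- apply: (@closed_comp _ _ (fun t : cube n.+1 => cube_coord t ord0) [set y | 2^-1 <= y]).
    by move=> t _; exact: cube_coord_continuous.
  exact: closed_ge.
- apply: (@subspace_eq_continuous _ A _ (a \o cube_fst)).
    move=> t /set_mem At; have {}At : cube_coord t ord0 <= 2^-1 := At.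
    by rewrite -[RHS]/(if cube_coord t ord0 <= 2^-1 then _ else _) At.
  exact: continuous_subspaceT.
- apply: (@subspace_eq_continuous _ B _ (b \o cube_snd)).
    move=> t /set_mem Bt; have {}Bt : 2^-1 <= cube_coord t ord0 := Bt.
    rewrite -[RHS]/(if cube_coord t ord0 <= 2^-1 then a (cube_fst t)
      else b (cube_snd t)); case: ifP => // At.
    rewrite -[LHS]/(b (cube_snd t)).
    have t2 : cube_coord t ord0 = 2^-1 by apply/eqP; rewrite eq_le At.
    have bd1 : cube_bd (cube_fst t).
      exists ord0; right; rewrite mk_cubeE eqxx t2 mulfV ?pnatr_eq0//.
      exact: minxx.
    have bd2 : cube_bd (cube_snd t).
      exists ord0; left; rewrite mk_cubeE eqxx t2 mulfV ?pnatr_eq0// subrr.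
      exact: maxxx.
    by rewrite (gl_bd b bd2) (gl_bd a bd1).
  exact: continuous_subspaceT.
Qed.

Lemma concat_bd (a b : gloop n.+1 x) t : cube_bd t -> concat_fun a b t = x.
Proof.
move=> [i hi]; rewrite /concat_fun; case: ifP => [le2|/negbT].
  apply: gl_bd; exists i; rewrite mk_cubeE; case: eqP hi => // -> [->|t1].
    by left; rewrite mulr0; apply/min_idPl.
  by move: le2; rewrite t1 leNgt invf_lt1 ?ltr0n// ltr1n.
rewrite -ltNge => gt2; apply: gl_bd; exists i; rewrite mk_cubeE.
case: eqP hi => // -> [t0|->].
  by move: gt2; rewrite t0 invr_lt0 ltrn0.
by right; rewrite mulr1 -[2]/(1 + 1) addrK; apply/max_idPl.
Qed.

Definition concat (a b : gloop n.+1 x) : gloop n.+1 x :=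
  GLoop (@concat_cts a b) (@concat_bd a b).

Definition hgroup_mul (a b : hgroup n.+1 x) : hgroup n.+1 x :=
  class_of (@gloop_homotopic n.+1 X x) (concat (repr a) (repr b)).

End hgroup_mul.

(* Z is pointed, hence nonempty, so that the case n = 0 at any z is the
   bijectivity on path components. *)
Definition weak_equiv (Z W : ptopologicalType) (g : pointed_map Z W) : Prop :=
  forall (n : nat) (z : Z),
    bijective (hgroup_map (n := n) (@pmap_cts _ _ g) (erefl (g z))).

Definition pi_n (n : nat) (X : ptopologicalType) : Type := hgroup n (point : X).
HB.instance Definition _ n X := Pointed.on (pi_n n X).

Definition pi_map (n : nat) (X Y : ptopologicalType) (f : pointed_map X Y) :
  pi_n n X -> pi_n n Y := hgroup_map (@pmap_cts _ _ f) (pmap_pt f).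

Definition hfibration_seq (Z : ngType R) (X Y : ptopologicalType)
    (i : pointed_map Z X) (f : pointed_map X Y) (H : phomotopy R Z Y)
    (H_null : null_homotopy (pmap_comp f i) H) : Prop :=
  weak_equiv (fibration_map H_null).

End homotopy_groups.

Section CW.
Variable R : realType.

Definition disk (n : nat) : topologicalType :=
  set_type [set t : 'rV[R]_n | \sum_i t ord0 i ^+ 2 <= 1].

Definition disk_interior n (t : disk n) : Prop :=
  \sum_i (set_val t ord0 i) ^+ 2 < 1.

(* Finite CW structure given by characteristic maps: the open cells partition X
   and each boundary point lies in an open cell of smaller dimension. As the
   complex is finite and Hausdorff, X has the quotient topology from its cells. *)
Definition finite_CW (X : topologicalType) : Prop :=
  hausdorff_space X /\
  exists (J : finType) (d : J -> nat) (Phi : forall j, disk (d j) -> X),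
  [/\ forall j, continuous (Phi j),
      forall x, exists! e : {j & disk (d j)},
        disk_interior (projT2 e) /\ Phi (projT1 e) (projT2 e) = x &
      forall j t, ~ disk_interior t ->
        exists e : {k & disk (d k)}, [/\ (d (projT1 e) < d j)%N,
          disk_interior (projT2 e) & Phi (projT1 e) (projT2 e) = Phi j t]].

End CW.

(* A has the subspace topology of its image: pairs A c X are encoded by pointed
   embeddings A -> X. *)
Definition embedding (A X : topologicalType) (i : A -> X) : Prop :=
  injective i /\
  forall U : set A, open U <-> exists2 V : set X, open V & U = i @^-1` V.

Section homology.
Variables (R : realType) (C : ngType R -> Prop).

(* The wedge sum over an empty family is a point, hence covered by [adm_CW].
   [adm_susp] is stated on its own because cofibers only yield a space
   homeomorphic to [susp R X], while C need not be closed under homeomorphism. *)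
Record admissible : Prop := Admissible {
  adm_CW : forall X : ngType R, finite_CW R X -> C X;
  adm_wedge : forall (I : pointedType) (X : I -> ngType R),
    finite_set [set: I] -> (forall i, C (X i)) -> C (ngwedge X);
  adm_cofiber : forall (A X : ngType R) (i : pointed_map A X),
    C A -> C X -> embedding i -> C (cofiber i);
  adm_susp : forall X : ngType R, C X -> C (susp R X)
}.

Hypothesis hC : admissible.

Definition cofiber_obj (A X : obj C) (i : pointed_map A X) (ei : embedding i) : obj C :=
  Obj (adm_cofiber hC (obj_in A) (obj_in X) ei).

Definition susp_obj (X : obj C) : obj C := Obj (adm_susp hC (obj_in X)).

Definition wedge_obj (X : obj C) : obj C :=
  Obj (adm_wedge hC (X := fun _ : bool => X) (@finite_finset bool setT)
    (fun=> obj_in X)).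

Definition susp_iter (n : nat) (X : obj C) : obj C := iter n susp_obj X.

Fixpoint susp_iter_map (n : nat) (X Y : obj C) (f : pointed_map X Y) :
    pointed_map (susp_iter n X) (susp_iter n Y) :=
  match n with
  | 0%N => f
  | m.+1 => susp_map R (susp_iter_map m f)
  end.

Definition linear_functor (T : enriched_functor C) : Prop :=
  forall (A X : obj C) (i : pointed_map A X) (ei : embedding i),
    hfibration_seq (@ef_homotopy_null R C T A X (cofiber_obj ei)
      i (cofiber_in i) (contraction i) (contraction_null i)).

Record homology_theory := HomologyTheory {
  hgrp : int -> obj C -> zmodType;
  hmap : forall n (X Y : obj C), pointed_map X Y -> {additive hgrp n X -> hgrp n Y};
  hmap_id : forall n (X : obj C), hmap n (pmap_id X) =1 id;
  hmap_comp : forall n (X Y Z : obj C) (g : pointed_map Y Z) (f : pointed_map X Y),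
    hmap n (pmap_comp g f) =1 hmap n g \o hmap n f;
  hsusp : forall n (X : obj C), {additive hgrp n X -> hgrp (n + 1) (susp_obj X)};
  hsusp_bij : forall n (X : obj C), bijective (hsusp n X);
  hsusp_natural : forall n (X Y : obj C) (f : pointed_map X Y) (a : hgrp n X),
    hsusp n Y (hmap n f a) =
    hmap (n + 1) (susp_map R f : pointed_map (susp_obj X) (susp_obj Y)) (hsusp n X a);
  hmap_homotopy : forall n (X Y : obj C) (f g : pointed_map X Y),
    phomotopic R f g -> hmap n f =1 hmap n g;
  hmap_exact : forall n (A X : obj C) (i : pointed_map A X) (ei : embedding i)
      (x : hgrp n X),
    hmap n (cofiber_in i : pointed_map X (cofiber_obj ei)) x = 0 <->
    exists a : hgrp n A, hmap n i a = x
}.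

Variable T : enriched_functor C.

Definition Tpi (n : nat) (X : obj C) : Type := pi_n R n (T X).

Definition Tpi_map (n : nat) (X Y : obj C) (f : pointed_map X Y) : Tpi n X -> Tpi n Y :=
  pi_map (pf_map T f).

Definition Tpi_proj (n : nat) (X : obj C) (c : Tpi n (wedge_obj X)) :
    Tpi n X * Tpi n X :=
  (Tpi_map (wedge_proj X true : pointed_map (wedge_obj X) X) c,
   Tpi_map (wedge_proj X false : pointed_map (wedge_obj X) X) c).

(* [xget] selects the preimage of (a, b), unique when [Tpi_proj] is bijective. *)
Definition Tpi_add (n : nat) (X : obj C) (a b : Tpi n X) : Tpi n X :=
  Tpi_map (wedge_fold X : pointed_map (wedge_obj X) X)
    (xget point [set c | Tpi_proj c = (a, b)]).

(* Group isomorphism of G onto pi_n(TX), whose operation is [Tpi_add]. This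
   includes the bijectivity of [Tpi_proj] on which that operation rests and, for
   n >= 1, its agreement with the usual product of homotopy classes. *)
Definition Tpi_iso (n : nat) (X : obj C) (G : zmodType) (phi : G -> Tpi n X) :
    Prop :=
  [/\ bijective phi,
      bijective (@Tpi_proj n X),
      forall a b, phi (a + b) = Tpi_add (phi a) (phi b) &
      match n return (G -> Tpi n X) -> Prop with
      | 0%N => fun=> True
      | m.+1 => fun phi => forall a b, phi (a + b) = hgroup_mul (phi a) (phi b)
      end phi].

End homology.

(* Main.v *)
Require Import Defs.
From HB Require Import structures.
From mathcomp Require Import all_boot all_order all_algebra.
From mathcomp Require Import all_classical all_reals.
From mathcomp Require Import topology normedtype homotopy.
From mathcomp Require Import lra.

(** Linearity makes TA -> TX -> T(X u CA) a homotopy fibration sequence, so a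
    class of pi_n TX that dies in T(X u CA) is represented by a map into the
    homotopy fiber and hence comes from pi_n TA ([fibration_exact]).  This is
    exactness in degrees n >= 0; the rest of the proof is about the suspension
    isomorphism, exactness in negative degrees, and the group structures.

    Suspension.  The inclusion of X as the base of its cone is an embedding
    into a contractible space, and its cofiber is homotopy equivalent to the
    suspension SX.  As T preserves contractions, the homotopy fiber of
    linearity becomes the loop space of T(SX), and TX -> Loops T(SX) is
    bijective on homotopy groups.  Explicitly it is adjoint to the homotopy I x TX -> T(SX)
    that T induces from (t, x) |-> [t, x], which makes naturality evident
    ([pi_loop_bijective], [Tpi_susp_bijective]).

    Negative degrees.  Here exactness is needed for T(S^k A) -> T(S^k X) ->
    T(S^k (X u CA)), but S^k A -> S^k X need not be an embedding when A is not
    closed in X (already for k = 1, X = [0, 1] based at 1 and A = ]0, 1]), so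
    that linearity does not apply to it.  The Puppe sequence A -> X -> Y =
    X u CA -> Z = Y u CX -> W = Z u CY -> W u CZ avoids this: all its maps are
    embeddings, and Z -> W -> W u CZ is homotopy equivalent to
    SA -> SX -> SY up to a sign, which a flip of the suspension coordinate
    absorbs.  So call a sequence coexact when it is homotopy equivalent to
    A -> X -> X u CA for some embedding A -> X; coexact sequences are stable
    under suspension ([coexact_susp]) and pi_n T is exact on them
    ([Tpi_exact]).

    Groups.  X -> X v X -> X (one inclusion, then the other projection) is
    coexact, hence so is its suspension, and pi_(n+1) T(S -) takes values in
    groups.  Split exactness therefore identifies pi_(n+1) T S(X v X) with the
    square of pi_(n+1) T(SX), and the suspension bijection carries this down
    to pi_n T, including n = 0 where no group law is available beforehand
    ([Tpi_proj_bijective]).  Under that bijection the operation on pi_n TX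
    becomes concatenation of loops in T(SX) ([Tpi_susp_add]), so it is a group
    law.  It is commutative because the products of the images of a and b
    under the two inclusions, taken in either order, have the same projections.

    All continuity questions are reduced to simplexes: a map out of a
    numerically generated space is continuous as soon as its composites with
    singular simplexes are.  Homotopies on quotients such as suspensions and
    cofibers are then checked on representatives, because quotient maps
    remain quotient maps, in this weak sense, after a product with any space
    ([final_prod]). *)

Set Implicit Arguments.
Unset Strict Implicit.
Unset Printing Implicit Defensive.

Import Order.TTheory GRing.Theory Num.Theory.
Import numFieldNormedType.Exports.
Local Open Scope classical_set_scope.
Local Open Scope ring_scope.

(** * Continuity on singular simplexes *)

Section simplexwise.
Variable R : realType.

(** Unlike continuity on [nu R X], this predicate composes and pairs over plain
    topological products, so that no retopologized product has to be carried
    around. *)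
Definition scts (X Y : topologicalType) (f : X -> Y) : Prop :=
  forall n (s : Delta R n -> X), continuous s -> continuous (f \o s).

Lemma cts_scts (X Y : topologicalType) (f : X -> Y) : continuous f -> scts f.
Proof. by move=> cf n s cs; exact: cts_comp. Qed.

Lemma scts_comp (X Y Z : topologicalType) (f : X -> Y) (g : Y -> Z) :
  scts f -> scts g -> scts (g \o f).
Proof. by move=> cf cg n s cs; exact: (cg n (f \o s) (cf n s cs)). Qed.

Lemma scts_pair (X Y Z : topologicalType) (f : X -> Y) (g : X -> Z) :
  scts f -> scts g -> scts (fun x => (f x, g x)).
Proof.
by move=> cf cg n s cs; exact: (cts_pair (cf n s cs) (cg n s cs)).
Qed.

Lemma scts_cst (X Y : topologicalType) (y : Y) : scts (fun _ : X => y).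
Proof. by apply: cts_scts; exact: cst_continuous. Qed.

Lemma scts_id (X : topologicalType) : scts (fun x : X => x).
Proof. by move=> n s. Qed.

Lemma scts_fst (X Y : topologicalType) : scts (@fst X Y).
Proof. exact/cts_scts/cts_fst. Qed.

Lemma scts_snd (X Y : topologicalType) : scts (@snd X Y).
Proof. exact/cts_scts/cts_snd. Qed.

Lemma scts_cts (X : ngType R) (Y : topologicalType) (f : X -> Y) :
  scts f -> continuous f.
Proof. exact: numgen_continuous. Qed.

Lemma scts_to_nu (X : topologicalType) : scts (id : X -> nu R X).
Proof. by move=> n s; exact: Delta_nu_continuous. Qed.

Lemma scts_of_nu (X : topologicalType) : scts (id : nu R X -> X).
Proof. exact/cts_scts/nu_id_continuous. Qed.

Lemma nu_scts (X Y : topologicalType) (f : X -> Y) :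
  scts f -> continuous (f : nu R X -> Y).
Proof. exact: nu_continuous. Qed.

Lemma scts_nu (X Y : topologicalType) (f : X -> Y) :
  continuous (f : nu R X -> Y) -> scts f.
Proof. by move=> cf; exact: (scts_comp (@scts_to_nu X) (cts_scts cf)). Qed.

(** On such spaces (the interval, cubes and their products) the two notions of
    continuity agree, which is how maps built by [scts] become loops and
    homotopies of loops. *)
Definition simplex_retract (K : topologicalType) : Prop :=
  exists N (s : K -> Delta R N) (r : Delta R N -> K),
    [/\ continuous s, continuous r & cancel s r].

Lemma simplex_retract_cts (K Y : topologicalType) (f : K -> Y) :
  simplex_retract K -> scts f -> continuous f.
Proof.
move=> [N [s [r [cs cr sr]]]] cf.
rewrite (_ : f = (f \o r) \o s); last by apply/funext => k /=; rewrite sr.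
exact: (cts_comp cs (cf _ _ cr)).
Qed.

Lemma simplex_retract_simplex n : simplex_retract (Delta R n).
Proof. by exists n, id, id; split=> // t; exact: cvg_id. Qed.

Lemma simplex_retract_I01 : simplex_retract (I01 R).
Proof.
exists 1%N, (@I01_to_Delta R), (@Delta_to_I01 R).
split; [exact: I01_to_Delta_continuous|exact: Delta_to_I01_continuous|].
exact: I01_to_DeltaK.
Qed.

Lemma simplex_retract_prod (K L : topologicalType) :
  simplex_retract K -> simplex_retract L -> simplex_retract (K * L)%type.
Proof.
move=> [m [s [r [cs cr sr]]]] [n [s' [r' [cs' cr' sr']]]].
exists ((m.+1 * n.+1)%N).-1, (fun k => coupling (s k.1, s' k.2)),
  (fun u => (r (marginal1 u), r' (marginal2 u))); split.
- have c := cts_pair (cts_comp (@cts_fst K L) cs) (cts_comp (@cts_snd K L) cs').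
  exact: (cts_comp c (@coupling_continuous R m n)).
- exact: (cts_pair (cts_comp (@marginal1_continuous R m n) cr)
    (cts_comp (@marginal2_continuous R m n) cr')).
- by move=> [k l]; rewrite marginal1_coupling marginal2_coupling/= sr sr'.
Qed.

(** The compact-open topology is only needed over a simplex: there
    Delta^m x Delta^n is again a retract of a simplex. *)
Lemma scts_curry (X Y : topologicalType) n (F : X * Delta R n -> Y) :
  scts F ->
  scts (fun x => (fun u => F (x, u)) : {compact-open, Delta R n -> Y}).
Proof.
move=> cF m s cs.
pose h (p : Delta R m * Delta R n) := F (s p.1, p.2).
have ch : continuous h.
  apply: simplex_retract_cts.
    by apply: simplex_retract_prod; exact: simplex_retract_simplex.
  apply: (scts_comp _ cF); apply: scts_pair; last exact: scts_snd.
  by apply: (scts_comp (@scts_fst _ _)); exact: cts_scts.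
exact: (continuous_curry_fun ch).
Qed.

Lemma paste_cts (K Y : topologicalType) (g : K -> R) (c : R) (f1 f2 : K -> Y) :
  continuous g -> continuous f1 -> continuous f2 ->
  (forall k, g k = c -> f1 k = f2 k) ->
  continuous (fun k => if g k <= c then f1 k else f2 k).
Proof.
move=> cg c1 c2 f12.
pose A := [set k | g k <= c]; pose B := [set k | c <= g k].
have AB : A `|` B = setT.
  by apply/seteqP; split=> // k _; case: (leP (g k) c) => [|/ltW]; [left|right].
apply/continuous_subspace_setT; rewrite -AB; apply: withinU_continuous.
- apply: (@preimage_closed _ _ g [set y | y <= c]); last exact: closed_le.
  by move=> k _; exact: cg.
- apply: (@preimage_closed _ _ g [set y | c <= y]); last exact: closed_ge.
  by move=> k _; exact: cg.
- apply: (@subspace_eq_continuous _ A _ f1); last exact: continuous_subspaceT.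
  by move=> k /set_mem; rewrite /A/from_subspace/= => ->.
- apply: (@subspace_eq_continuous _ B _ f2); last exact: continuous_subspaceT.
  move=> k /set_mem; rewrite /B/from_subspace/= => Bk; case: ifP => // Ak.
  by apply/esym/f12/eqP; rewrite eq_le Ak.
Qed.

Lemma paste_scts (K Y : topologicalType) (g : K -> R) (c : R) (f1 f2 : K -> Y) :
  scts g -> scts f1 -> scts f2 -> (forall k, g k = c -> f1 k = f2 k) ->
  scts (fun k => if g k <= c then f1 k else f2 k).
Proof.
move=> cg c1 c2 f12 n s cs.
apply: (paste_cts (cg n s cs) (c1 n s cs) (c2 n s cs)) => k; exact: f12.
Qed.

Lemma scts_ext (X Y : topologicalType) (f g : X -> Y) :
  f =1 g -> scts f -> scts g.
Proof. by move=> /funext ->. Qed.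

Lemma sctsD (X : topologicalType) (f g : X -> R) :
  scts f -> scts g -> scts (fun x => f x + g x).
Proof. by move=> cf cg n s cs t; exact: (continuousD (cf n s cs t) (cg n s cs t)). Qed.

Lemma sctsN (X : topologicalType) (f : X -> R) :
  scts f -> scts (fun x => - f x).
Proof. by move=> cf n s cs t; exact: (continuousN (cf n s cs t)). Qed.

Lemma sctsM (X : topologicalType) (f g : X -> R) :
  scts f -> scts g -> scts (fun x => f x * g x).
Proof. by move=> cf cg n s cs t; exact: (continuousM (cf n s cs t) (cg n s cs t)). Qed.

Lemma scts_max (X : topologicalType) (f g : X -> R) :
  scts f -> scts g -> scts (fun x => Num.max (f x) (g x)).
Proof.
by move=> cf cg n s cs t; apply: continuous_max; [exact: cf|exact: cg].
Qed.

Lemma scts_min (X : topologicalType) (f g : X -> R) :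
  scts f -> scts g -> scts (fun x => Num.min (f x) (g x)).
Proof.
by move=> cf cg n s cs t; apply: continuous_min; [exact: cf|exact: cg].
Qed.

Lemma scts_I01val (X : topologicalType) (f : X -> I01 R) :
  scts f -> scts (fun x => I01val (f x)).
Proof. by move=> cf; exact: (scts_comp cf (cts_scts (@I01val_continuous R))). Qed.

Lemma clamp_subproof (x : R) : 0 <= Num.max 0 (Num.min x 1) <= 1.
Proof. by rewrite le_max lexx/= ge_max ler01 ge_min lexx orbT. Qed.

(** Formulas for homotopies are written with polynomials in real coordinates
    and truncated to the interval. *)
Definition clamp (x : R) : I01 R := mkI01 (clamp_subproof x).

Lemma clampE x : I01val (clamp x) = Num.max 0 (Num.min x 1).
Proof. by []. Qed.

Lemma I01_ext (s t : I01 R) : I01val s = I01val t -> s = t.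
Proof. by move=> st; exact: val_inj. Qed.

Lemma clampK t : clamp (I01val t) = t.
Proof.
apply: I01_ext; rewrite clampE; have /andP[t0 t1] := I01val_itv t.
by rewrite (min_idPl t1) (max_idPr t0).
Qed.

Lemma clamp_itv x : 0 <= x <= 1 -> I01val (clamp x) = x.
Proof.
by move=> /andP[t0 t1]; rewrite clampE (min_idPl t1) (max_idPr t0).
Qed.

Lemma clamp_le0 x : x <= 0 -> clamp x = i0 R.
Proof.
move=> x0; apply: I01_ext; rewrite clampE [RHS]/(0 : R).
by apply/max_idPl; rewrite ge_min x0.
Qed.

Lemma clamp_ge1 x : 1 <= x -> clamp x = i1 R.
Proof.
move=> x1; apply: I01_ext; rewrite clampE (min_idPr x1).
by apply/max_idPr; exact: ler01.
Qed.

Lemma I01val0 : I01val (i0 R) = 0. Proof. by []. Qed.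
Lemma I01val1 : I01val (i1 R) = 1. Proof. by []. Qed.

Lemma scts_clamp (X : topologicalType) (f : X -> R) :
  scts f -> scts (fun x => clamp (f x)).
Proof.
move=> cf n s cs; apply: to_I01_continuous.
apply: (@scts_max X (fun=> 0) (fun x => Num.min (f x) 1)) => //.
  exact: scts_cst.
by apply: scts_min => //; exact: scts_cst.
Qed.

End simplexwise.

(** * Jointly final families *)

Section final_families.
Variable R : realType.

Definition final (I : Type) (T : I -> ngType R) (Q : topologicalType)
    (p : forall i, T i -> Q) : Prop :=
  [/\ forall i, continuous (p i),
      forall q, exists i x, p i x = q &
      forall U : set Q, (forall i, open (p i @^-1` U)) -> open U].

Lemma final_continuous (I : Type) (T : I -> ngType R) (Q Z : topologicalType)
    (p : forall i, T i -> Q) (g : Q -> Z) :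
  final p -> (forall i, continuous (g \o p i)) -> continuous g.
Proof.
move=> [_ _ pfin] cg; apply/continuousP => U oU; apply: pfin => i.
by rewrite -comp_preimage; move: U oU; apply/continuousP; exact: cg.
Qed.

(** A product with [A] preserves final families, for simplexwise continuity:
    a simplex of [Q * A] only sees [A] through some [Delta R n], which is
    locally compact, so [F] can be curried into a function space over
    [Delta R n], where finality of [p] applies. *)
Lemma final_prod (I : Type) (T : I -> ngType R) (Q : topologicalType)
    (p : forall i, T i -> Q) (A W : topologicalType) (F : Q * A -> W) :
  final p ->
  (forall i, scts R (fun z : T i * A => F (p i z.1, z.2))) ->
  scts R F.
Proof.
move=> pfin cF n s cs.
pose s2 u := (s u).2; pose s1 u := (s u).1.
have cs1 : continuous s1 by exact: (cts_comp cs (@cts_fst _ _)).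
have cs2 : continuous s2 by exact: (cts_comp cs (@cts_snd _ _)).
pose G : Q -> {compact-open, Delta R n -> W} := fun q u => F (q, s2 u).
have cFi i : scts R (fun z : T i * Delta R n => F (p i z.1, s2 z.2)).
  apply: (scts_comp (f := fun z : T i * Delta R n => (z.1, s2 z.2))
    _ (cF i)); apply: scts_pair; first exact: scts_fst.
  by apply: (scts_comp (@scts_snd _ _ _)); exact: cts_scts.
have cG : continuous G.
  apply: (final_continuous pfin) => i; apply: scts_cts.
  exact: (scts_curry (cFi i)).
have cGq q : continuous (G q).
  have [_ psurj _] := pfin; have [i [x <-]] := psurj q.
  have h := scts_comp (scts_pair (@scts_cst R (Delta R n) _ x)
    (@scts_id R (Delta R n))) (cFi i).
  apply: (simplex_retract_cts (@simplex_retract_simplex R n)); exact: h.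
have cu := continuous_uncurry_regular (@Delta_locally_compact R n)
  (@Delta_regular R n) (cts_comp cs1 cG) (fun t => cGq (s1 t)).
have cd := cts_comp (cts_pair (fun t : Delta R n => @cvg_id _ (nbhs t))
  (fun t => @cvg_id _ (nbhs t))) cu.
suff -> : F \o s = uncurry (G \o s1) \o (fun x => (x, x)) by exact: cd.
by apply/funext => t; rewrite /G/s1/s2/=; congr F; case: (s t).
Qed.

Lemma final_prodr (I : Type) (T : I -> ngType R) (Q : topologicalType)
    (p : forall i, T i -> Q) (A W : topologicalType) (F : A * Q -> W) :
  final p ->
  (forall i, scts R (fun z : A * T i => F (z.1, p i z.2))) ->
  scts R F.
Proof.
move=> pfin cF; pose F' (z : Q * A) := F (z.2, z.1).
have cF' : scts R F'.
  apply: (final_prod pfin) => i.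
  exact: (scts_comp (scts_pair (@scts_snd R (T i) A) (@scts_fst R (T i) A)) (cF i)).
have -> : F = F' \o (fun z => (z.2, z.1)) by apply/funext => -[].
exact: (scts_comp (scts_pair (@scts_snd R A Q) (@scts_fst R A Q)) cF').
Qed.

Lemma final_scts (I : Type) (T : I -> ngType R) (Q : topologicalType)
    (p : forall i, T i -> Q) (Z : topologicalType) (g : Q -> Z) :
  final p -> (forall i, scts R (g \o p i)) -> continuous g.
Proof.
by move=> pfin cg; apply: (final_continuous pfin) => i; apply: scts_cts; exact: cg.
Qed.

End final_families.
(** * Suspensions and cofibers as quotients of products with the interval *)

Section scts_rules.
Variable R : realType.

Lemma scts_fst_of (Z X Y : topologicalType) (f : Z -> X * Y) :
  scts R f -> scts R (fun z => (f z).1).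
Proof. by move=> cf; exact: (scts_comp cf (@scts_fst R X Y)). Qed.

Lemma scts_snd_of (Z X Y : topologicalType) (f : Z -> X * Y) :
  scts R f -> scts R (fun z => (f z).2).
Proof. by move=> cf; exact: (scts_comp cf (@scts_snd R X Y)). Qed.

Lemma scts_pmap (Z : topologicalType) (X Y : ptopologicalType)
    (g : pointed_map X Y) (f : Z -> X) :
  scts R f -> scts R (fun z => g (f z)).
Proof. by move=> cf; exact: (scts_comp cf (cts_scts (@pmap_cts _ _ g))). Qed.

Lemma scts_ph (Z : topologicalType) (X Y : ptopologicalType)
    (H : phomotopy R X Y) (f : Z -> I01 R) (g : Z -> X) :
  scts R f -> scts R g -> scts R (fun z => H (f z, g z)).
Proof.
by move=> cf cg; exact: (scts_comp (scts_pair cf cg) (scts_nu (@ph_cts _ _ _ H))).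
Qed.

Lemma scts_smash_in (Z : topologicalType) (X Y : ptopologicalType)
    (f : Z -> X) (g : Z -> Y) :
  scts R f -> scts R g -> scts R (fun z => smash_in R (f z) (g z)).
Proof.
by move=> cf cg; exact: (scts_comp (scts_pair cf cg)
  (scts_nu (@smash_in_continuous R X Y))).
Qed.

End scts_rules.

Section smash_quotients.
Variable R : realType.

Lemma final_relquot (T : ngType R) (r : T -> T -> Prop) :
  final (fun _ : unit => @to_relquot R T r).
Proof.
split=> [_|q|U oU].
- exact: to_relquot_continuous.
- by exists tt, (repr q); exact: class_of_repr.
- by suff: open (to_relquot r @^-1` U) by []; exact: (oU tt).
Qed.

Definition S1_in (t : I01 R) : S1 R := to_relquot _ t.

Lemma S1_in0 : S1_in (i0 R) = point.
Proof. by apply: class_of_eq; split; [left|right]. Qed.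

Lemma S1_in1 : S1_in (i1 R) = point. Proof. by []. Qed.

Lemma scts_S1_in (Z : topologicalType) (f : Z -> I01 R) :
  scts R f -> scts R (fun z => S1_in (f z)).
Proof.
by move=> cf; exact: (scts_comp cf (cts_scts (@to_relquot_continuous R _ _))).
Qed.

Section susp.
Variable X : ptopologicalType.

Definition susp_in (t : I01 R) (x : X) : susp R X := smash_in R (S1_in t) x.

Lemma susp_in0 x : susp_in (i0 R) x = point.
Proof. by rewrite /susp_in S1_in0 smash_in_pointl. Qed.

Lemma susp_in1 x : susp_in (i1 R) x = point.
Proof. by rewrite /susp_in S1_in1 smash_in_pointl. Qed.

Lemma susp_in_pt t : susp_in t point = point.
Proof. exact: smash_in_pointr. Qed.

Lemma susp_ind (P : susp R X -> Prop) :
  (forall t x, P (susp_in t x)) -> forall q, P q.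
Proof.
move=> Psusp q; rewrite -(class_of_repr q).
move: (repr q : nu R (S1 R * X)%type) => [s x].
by rewrite -(class_of_repr s); exact: Psusp.
Qed.

Definition susp_lift (W : Type) (h : I01 R -> X -> W) (q : susp R X) : W :=
  let z : nu R (S1 R * X)%type := repr q in h (repr z.1) z.2.

Lemma susp_liftE (W : Type) (h : I01 R -> X -> W) (w : W) :
  (forall x, h (i0 R) x = w) -> (forall x, h (i1 R) x = w) ->
  (forall t, h t point = w) ->
  forall t x, susp_lift h (susp_in t x) = h t x.
Proof.
move=> h0 h1 hp t x; rewrite /susp_lift/susp_in/smash_in/to_relquot.
have hS y : h (repr (S1_in t)) y = h t y.
  apply: (@genquot_fun_class _ _ _ (h^~ y)) => s s'.
  by move=> [[->|->] [->|->]]; rewrite !(h0, h1).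
have hpt y : h (repr (point : S1 R)) y = w.
  have -> : h (repr (point : S1 R)) y = h (i1 R) y.
    apply: (@genquot_fun_class _ _ _ (h^~ y)) => s s'.
    by move=> [[->|->] [->|->]]; rewrite !(h0, h1).
  exact: h1.
rewrite -[RHS]hS.
apply: (@genquot_fun_class _ _ _
  (fun z : nu R (S1 R * X)%type => h (repr z.1) z.2)) => -[s1 x1] [s2 x2].
by move=> /= [[->|->] [->|->]]; rewrite !(hpt, hp).
Qed.

Lemma scts_susp_in (Z : topologicalType) (f : Z -> I01 R) (g : Z -> X) :
  scts R f -> scts R g -> scts R (fun z => susp_in (f z) (g z)).
Proof. by move=> cf cg; apply: scts_smash_in => //; exact: scts_S1_in. Qed.

(** With [P] the interval this is the criterion for homotopies on a
    suspension; with [P] trivial, for maps. *)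
Lemma susp_scts (P W : topologicalType) (F : P * susp R X -> W) :
  scts R (fun z : P * (I01 R * X) => F (z.1, susp_in z.2.1 z.2.2)) ->
  scts R F.
Proof.
move=> cF.
apply: (final_prodr (@final_relquot _ _)) => _ /=.
(* The smash product is a quotient of S1 * X, and S1 itself one of I. *)
pose F2 (z : S1 R * (P * X)) : W := F (z.2.1, smash_in R z.1 z.2.2).
have c2 : scts R F2.
  apply: (final_prod (@final_relquot _ _)) => _ /=.
  pose k (z : I01 R * (P * X)) := (z.2.1, (z.1, z.2.2)).
  have ck : scts R k.
    apply: scts_pair.
      exact/scts_fst_of/scts_snd_of/scts_id.
    apply: scts_pair; first exact/scts_fst_of/scts_id.
    exact/scts_snd_of/scts_snd_of/scts_id.
  exact: (scts_comp ck cF).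
pose k (z : P * nu R (S1 R * X)%type) := (z.2.1, (z.1, z.2.2)).
have ck : scts R k.
  have c1 : scts R (fun z : P * nu R (S1 R * X)%type => z.2 : S1 R * X).
    exact: (scts_comp (@scts_snd R P _) (@scts_of_nu R (S1 R * X)%type)).
  apply: scts_pair; first exact: scts_fst_of.
  by apply: scts_pair; [exact/scts_fst_of/scts_id|exact: scts_snd_of].
have := scts_comp ck c2; congr (scts R _).
by apply/funext => -[y [s x]].
Qed.

Lemma susp_cts (W : topologicalType) (g : susp R X -> W) :
  scts R (fun z : I01 R * X => g (susp_in z.1 z.2)) -> continuous g.
Proof.
move=> cg; apply: scts_cts.
have c : scts R (fun z : I01 R * susp R X => g z.2).
  apply: susp_scts.
  exact: (scts_comp (@scts_snd R (I01 R) (I01 R * X)%type) cg).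
exact: (scts_comp (scts_pair (@scts_cst R (susp R X) (I01 R) (i0 R))
  (@scts_id R (susp R X))) c).
Qed.

End susp.

Section cone.
Variable X : ptopologicalType.

Definition cone_lift (W : Type) (h : I01 R -> X -> W) (q : cone R X) : W :=
  let z : nu R (I01 R * X)%type := repr q in h z.1 z.2.

Lemma cone_liftE (W : Type) (h : I01 R -> X -> W) (w : W) :
  (forall x, h (i1 R) x = w) -> (forall t, h t point = w) ->
  forall t x, cone_lift h (smash_in R t x) = h t x.
Proof.
move=> h1 hp t x; rewrite /cone_lift/smash_in/to_relquot.
apply: (@genquot_fun_class _ _ _
  (fun z : nu R (I01 R * X)%type => h z.1 z.2)) => -[s1 x1] [s2 x2].
have h1' y : h point y = w := h1 y.
by move=> /= [[->|->] [->|->]]; rewrite !(h1', hp).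
Qed.

End cone.

Section cofiber.
Variables (A X : ngType R) (i : pointed_map A X).

Definition cof_in (t : I01 R) (a : A) : cofiber i :=
  cofiber_cone_fun i (smash_in R t a).

Lemma cof_in0 a : cof_in (i0 R) a = cofiber_in i (i a).
Proof. exact/esym/cofiber_glue. Qed.

Lemma cof_in1 a : cof_in (i1 R) a = point.
Proof. by rewrite /cof_in smash_in_pointl cofiber_cone_pt. Qed.

Lemma cof_in_pt t : cof_in t point = point.
Proof. by rewrite /cof_in smash_in_pointr cofiber_cone_pt. Qed.

Lemma scts_cof_in (Z : topologicalType) (f : Z -> I01 R) (g : Z -> A) :
  scts R f -> scts R g -> scts R (fun z => cof_in (f z) (g z)).
Proof.
move=> cf cg; have := scts_smash_in cf cg.
by move=> c; exact: (scts_comp c (cts_scts (@cofiber_cone_cts R A X i))).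
Qed.

Lemma ngwedge_ind (I : pointedType) (Y : I -> ngType R) (P : ngwedge Y -> Prop) :
  (forall j y, P (@ngwedge_in R I Y j y)) -> forall q, P q.
Proof.
move=> Pin q; have : [set: ngwedge Y] q by [].
by rewrite /ngwedge -wedgeTE => -[j _ [y _ <-]]; exact: Pin.
Qed.

Lemma cof_ind (P : cofiber i -> Prop) :
  (forall x, P (cofiber_in i x)) -> (forall t a, P (cof_in t a)) ->
  forall q, P q.
Proof.
move=> Px Pa q; rewrite -(class_of_repr q).
elim/ngwedge_ind: (repr q) => -[] y; first exact: Px.
rewrite -(class_of_repr y).
by move: (repr y : nu R (I01 R * A)%type) => [t a]; exact: Pa.
Qed.

Definition cof_parts (W : Type) (f : X -> W) (h : I01 R -> A -> W) (b : bool) :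
    cof_summand A X b -> W :=
  match b return cof_summand A X b -> W with
  | true => f
  | false => cone_lift h
  end.

Definition cof_lift (W : Type) (f : X -> W) (h : I01 R -> A -> W) :
    cofiber i -> W :=
  wedge_fun (@cof_parts W f h) \o repr.

Section cof_liftE.
Variables (W : Type) (f : X -> W) (h : I01 R -> A -> W) (w : W).
Hypotheses (fp : f point = w) (h0 : forall a, h (i0 R) a = f (i a)).
Hypotheses (h1 : forall a, h (i1 R) a = w) (hp : forall t, h t point = w).

Let parts_pt (b c : bool) : @cof_parts W f h b point = @cof_parts W f h c point.
Proof.
suff E d : @cof_parts W f h d point = w by rewrite !E.
case: d => //=; rewrite -(smash_in_pointl R (I01 R) (point : A)).
rewrite (cone_liftE h1 hp); exact: hp.
Qed.

Let g_in b y : wedge_fun (@cof_parts W f h) (@ngwedge_in R bool (cof_summand A X) b y)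
  = @cof_parts W f h b y.
Proof. exact: wedge_lift_funE. Qed.

Let cof_liftE q :
  cof_lift f h (to_relquot _ q) = wedge_fun (@cof_parts W f h) q.
Proof.
apply: (@genquot_fun_class _ _ _ (wedge_fun (@cof_parts W f h))).
by move=> u v [a [-> ->]]; rewrite !g_in/= (cone_liftE h1 hp) h0.
Qed.

Lemma cof_liftE_base x : cof_lift f h (cofiber_in i x) = f x.
Proof. by rewrite [LHS]cof_liftE g_in. Qed.

Lemma cof_liftE_cone t a : cof_lift f h (cof_in t a) = h t a.
Proof. by rewrite [LHS]cof_liftE g_in/= (cone_liftE h1 hp). Qed.

End cof_liftE.

(** The summand [false] is the product with the interval and not the cone, so
    that cofibers are handled in coordinates [(t, a)] throughout. *)
Definition cof_family (b : bool) : ngType R :=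
  if b then X else (nu R (I01 R * A)%type : ngType R).

Definition cof_family_in (b : bool) : cof_family b -> cofiber i :=
  match b return cof_family b -> cofiber i with
  | true => cofiber_in i
  | false => fun z => cof_in z.1 z.2
  end.

Lemma final_cofiber : final cof_family_in.
Proof.
split=> [[]|q|U oU].
- exact: (@pmap_cts _ _ (cofiber_in i)).
- apply: (@nu_scts R (I01 R * A)%type);
  by apply: scts_cof_in; [exact: scts_fst|exact: scts_snd].
- elim/cof_ind: q => [x|t a]; first by exists true, x.
  by exists false, (t, a).
suff: open (@to_relquot R (ngwedge (cof_summand A X)) _ @^-1` U) by [].
apply/wedge_openP => -[]; first exact: (oU true).
have [_ _ fs] := final_relquot (T := nu R (I01 R * A)%type)
   (fun p q => (p.1 = point \/ p.2 = point) /\ (q.1 = point \/ q.2 = point)).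
apply: fs => _; have := oU false.
set u := (X in open X -> _); set v := (X in _ -> open X).
suff -> : v = u by [].
by apply/seteqP; split=> -[t a].
Qed.

Lemma cof_scts (P W : topologicalType) (F : P * cofiber i -> W) :
  scts R (fun z : P * X => F (z.1, cofiber_in i z.2)) ->
  scts R (fun z : P * (I01 R * A) => F (z.1, cof_in z.2.1 z.2.2)) ->
  scts R F.
Proof.
move=> cb cc.
apply: (final_prodr final_cofiber) => -[]; first exact: cb.
have c : scts R (fun z : P * nu R (I01 R * A)%type => (z.1, (z.2 : I01 R * A))).
  apply: scts_pair; first exact: scts_fst.
  exact: (scts_comp (@scts_snd R P _) (@scts_of_nu R (I01 R * A)%type)).
exact: (scts_comp c cc).
Qed.

Lemma cof_cts (W : topologicalType) (g : cofiber i -> W) :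
  continuous (g \o cofiber_in i) ->
  scts R (fun z : I01 R * A => g (cof_in z.1 z.2)) -> continuous g.
Proof.
move=> cb cc; apply: (final_scts final_cofiber) => -[]; first exact: cts_scts.
exact: (scts_comp (@scts_of_nu R (I01 R * A)%type) cc).
Qed.

End cofiber.

End smash_quotients.

(** Simplexwise continuity of a formula, by recursion on its syntax; matching
    under the binder keeps unification first-order. *)
Ltac scts_step :=
  lazymatch goal with
  | |- scts _ (fun z => z) => exact: scts_id
  | |- scts _ (fun z => fst (@?f z)) => refine (@scts_fst_of _ _ _ _ f _)
  | |- scts _ (fun z => snd (@?f z)) => refine (@scts_snd_of _ _ _ _ f _)
  | |- scts _ (fun z => (@?f z, @?g z)) => refine (@scts_pair _ _ _ _ f g _ _)
  | |- scts _ (fun z => susp_in (@?f z) (@?g z)) =>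
      refine (@scts_susp_in _ _ _ f g _ _)
  | |- scts _ (fun z => cof_in ?i (@?f z) (@?g z)) =>
      refine (@scts_cof_in _ _ _ i _ f g _ _)
  | |- scts _ (fun z => clamp (@?f z)) => refine (@scts_clamp _ _ f _)
  | |- scts _ (fun z => I01val (@?f z)) => refine (@scts_I01val _ _ f _)
  | |- scts _ (fun z => (@?f z) + (@?g z)) => refine (@sctsD _ _ f g _ _)
  | |- scts _ (fun z => (@?f z) * (@?g z)) => refine (@sctsM _ _ f g _ _)
  | |- scts _ (fun z => - (@?f z)) => refine (@sctsN _ _ f _)
  | |- scts _ (fun z => Num.max (@?f z) (@?g z)) => refine (@scts_max _ _ f g _ _)
  | |- scts _ (fun z => ph_fun ?H (@?f z, @?g z)) =>
      refine (@scts_ph _ _ _ _ H f g _ _)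
  | |- scts _ (fun z => pmap_fun ?h (@?f z)) => refine (@scts_pmap _ _ _ _ h f _)
  | |- scts _ (fun z => _) => exact: scts_cst
  end.

Ltac scts_auto := do ?scts_step.
(** * Pointed homotopies *)

Section pointed_homotopy.
Variable R : realType.

Definition mk_ph (Y Z : ptopologicalType) (F : I01 R * Y -> Z) (cF : scts R F)
    (F_pt : forall t, F (t, point) = point) : phomotopy R Y Z :=
  @PHomotopy R Y Z F (nu_scts cF) F_pt.

Definition homotopy_equiv (X Y : ptopologicalType) (e : pointed_map X Y) : Prop :=
  exists e' : pointed_map Y X,
    phomotopic R (pmap_comp e' e) (pmap_id X) /\
    phomotopic R (pmap_comp e e') (pmap_id Y).

Lemma phomotopic_refl (X Y : ptopologicalType) (f : pointed_map X Y) :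
  phomotopic R f f.
Proof.
have c : scts R (fun z : I01 R * X => f z.2) by scts_auto.
by exists (mk_ph c (fun _ => pmap_pt f)).
Qed.

Lemma phomotopic_sym (X Y : ptopologicalType) (f g : pointed_map X Y) :
  phomotopic R f g -> phomotopic R g f.
Proof.
move=> [H [H0 H1]].
have c : scts R (fun z : I01 R * X => H (clamp (1 - I01val z.1), z.2)).
  by scts_auto.
exists (mk_ph c (fun t => ph_pt H _)); split=> x /=.
  by rewrite subr0 clamp_ge1.
by rewrite clamp_le0// subrr.
Qed.

Lemma phomotopic_trans (X Y : ptopologicalType) (f g h : pointed_map X Y) :
  phomotopic R f g -> phomotopic R g h -> phomotopic R f h.
Proof.
move=> [H [H0 H1]] [K [K0 K1]].
pose F (z : I01 R * X) := if I01val z.1 <= 2^-1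
  then H (clamp (2 * I01val z.1), z.2) else K (clamp (2 * I01val z.1 - 1), z.2).
have c : scts R F.
  apply: paste_scts; [by scts_auto|by scts_auto|by scts_auto|].
  by move=> z ->; rewrite divff ?pnatr_eq0// clamp_ge1// clamp_le0 ?subrr// H1 K0.
have pt t : F (t, point) = point by rewrite /F/=; case: ifP; rewrite ph_pt.
exists (mk_ph c pt); split=> x /=; rewrite /F/=.
  by rewrite invr_ge0 ler0n mulr0 clamp_le0.
by rewrite I01val1 leNgt invf_lt1 ?ltr0n// ltr1n/= clamp_ge1//; lra.
Qed.

Lemma phomotopic_compl (X Y Z : ptopologicalType) (g : pointed_map Y Z)
    (f f' : pointed_map X Y) :
  phomotopic R f f' -> phomotopic R (pmap_comp g f) (pmap_comp g f').
Proof.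
move=> [H [H0 H1]].
have c : scts R (fun z : I01 R * X => g (H (z.1, z.2))) by scts_auto.
have pt t : g (H (t, point)) = point by rewrite ph_pt pmap_pt.
by exists (mk_ph c pt); split=> x /=; rewrite ?H0 ?H1.
Qed.

Lemma phomotopic_compr (X Y Z : ptopologicalType) (f : pointed_map X Y)
    (g g' : pointed_map Y Z) :
  phomotopic R g g' -> phomotopic R (pmap_comp g f) (pmap_comp g' f).
Proof.
move=> [H [H0 H1]].
have c : scts R (fun z : I01 R * X => H (z.1, f z.2)) by scts_auto.
have pt t : H (t, f point) = point by rewrite pmap_pt ph_pt.
by exists (mk_ph c pt); split=> x /=; rewrite ?H0 ?H1.
Qed.

Lemma pmap_compE (X Y Z : ptopologicalType) (g : pointed_map Y Z)
    (f : pointed_map X Y) x : pmap_comp g f x = g (f x).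
Proof. by []. Qed.

Lemma pmap_compA (X Y Z W : ptopologicalType) (h : pointed_map Z W)
    (g : pointed_map Y Z) (f : pointed_map X Y) :
  pmap_comp h (pmap_comp g f) = pmap_comp (pmap_comp h g) f.
Proof. exact: pmap_ext. Qed.

Lemma pmap_comp1f (X Y : ptopologicalType) (f : pointed_map X Y) :
  pmap_comp (pmap_id Y) f = f.
Proof. exact: pmap_ext. Qed.

Lemma pmap_compf1 (X Y : ptopologicalType) (f : pointed_map X Y) :
  pmap_comp f (pmap_id X) = f.
Proof. exact: pmap_ext. Qed.

Lemma homotopy_equiv_id (X : ptopologicalType) : homotopy_equiv (pmap_id X).
Proof.
by exists (pmap_id X); rewrite pmap_comp1f; split; exact: phomotopic_refl.
Qed.

Lemma homotopy_equiv_comp (X Y Z : ptopologicalType) (g : pointed_map Y Z)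
    (f : pointed_map X Y) :
  homotopy_equiv g -> homotopy_equiv f -> homotopy_equiv (pmap_comp g f).
Proof.
move=> [g' [g'g gg']] [f' [f'f ff']]; exists (pmap_comp f' g'); split.
  apply: phomotopic_trans f'f.
  have := phomotopic_compl f' (phomotopic_compr f g'g).
  by rewrite pmap_comp1f !pmap_compA.
apply: phomotopic_trans gg'.
have := phomotopic_compl g (phomotopic_compr g' ff').
by rewrite pmap_comp1f !pmap_compA.
Qed.

Lemma homotopy_equiv_phomotopic (X Y : ptopologicalType) (f g : pointed_map X Y) :
  phomotopic R f g -> homotopy_equiv f -> homotopy_equiv g.
Proof.
move=> fg [f' [f'f ff']]; exists f'; split.
  by apply: phomotopic_trans f'f; exact/phomotopic_compl/phomotopic_sym.
by apply: phomotopic_trans ff'; exact/phomotopic_compr/phomotopic_sym.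
Qed.

Lemma susp_map_in (X Y : ptopologicalType) (f : pointed_map X Y) t x :
  susp_map R f (susp_in t x) = susp_in t (f x).
Proof. exact: susp_fun_in. Qed.

Lemma susp_map_id (X : ptopologicalType) :
  susp_map R (pmap_id X) = pmap_id (susp R X).
Proof. by apply: pmap_ext; elim/susp_ind => t x; rewrite susp_map_in. Qed.

Lemma susp_map_comp (X Y Z : ptopologicalType) (g : pointed_map Y Z)
    (f : pointed_map X Y) :
  susp_map R (pmap_comp g f) = pmap_comp (susp_map R g) (susp_map R f).
Proof. by apply: pmap_ext; elim/susp_ind => t x; rewrite !(pmap_compE, susp_map_in). Qed.

Lemma susp_phomotopy (X W : ptopologicalType) (h : I01 R -> I01 R -> X -> W) :
  scts R (fun z : I01 R * (I01 R * X) => h z.1 z.2.1 z.2.2) ->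
  (forall s x, h s (i0 R) x = point) -> (forall s x, h s (i1 R) x = point) ->
  (forall s t, h s t point = point) ->
  exists H : phomotopy R (susp R X) W,
    forall s t x, H (s, susp_in t x) = h s t x.
Proof.
move=> ch h0 h1 hp.
have E s := susp_liftE (h0 s) (h1 s) (hp s).
have c : scts R (fun z : I01 R * susp R X => susp_lift (h z.1) z.2).
  by apply: susp_scts; apply: scts_ext ch => -[s [t x]] /=; rewrite E.
have pt s : susp_lift (h s) point = point.
  by rewrite -(susp_in0 R (point : X)) E h0.
by exists (mk_ph c pt) => s t x; rewrite /= E.
Qed.

Lemma susp_map_phomotopic (X Y : ptopologicalType) (f g : pointed_map X Y) :
  phomotopic R f g -> phomotopic R (susp_map R f) (susp_map R g).
Proof.
move=> [H [H0 H1]].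
have [||||K KE] := @susp_phomotopy X (susp R Y) (fun s t x => susp_in t (H (s, x))).
- by scts_auto.
- by move=> s x; exact: (susp_in0 R).
- by move=> s x; exact: (susp_in1 R).
- by move=> s t; rewrite ph_pt susp_in_pt.
exists K; split; elim/susp_ind => t x; rewrite susp_map_in KE.
  by rewrite H0.
by rewrite H1.
Qed.

Lemma susp_map_equiv (X Y : ptopologicalType) (e : pointed_map X Y) :
  homotopy_equiv e -> homotopy_equiv (susp_map R e).
Proof.
move=> [e' [e'e ee']]; exists (susp_map R e'); rewrite -!susp_map_comp.
by rewrite -!susp_map_id; split; exact: susp_map_phomotopic.
Qed.

Section susp_out.
Variables (X W : ptopologicalType) (h : I01 R -> X -> W).
Hypothesis ch : scts R (fun z : I01 R * X => h z.1 z.2).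
Hypotheses (h0 : forall x, h (i0 R) x = point) (h1 : forall x, h (i1 R) x = point).
Hypothesis hp : forall t, h t point = point.

Lemma susp_out_cts : continuous (susp_lift h).
Proof.
apply: susp_cts; apply: scts_ext ch => -[t x] /=.
by rewrite (susp_liftE h0 h1 hp).
Qed.

Lemma susp_out_pt : susp_lift h point = point.
Proof. by rewrite -(susp_in0 R (point : X)) (susp_liftE h0 h1 hp) h0. Qed.

Definition susp_out : pointed_map (susp R X) W :=
  PointedMap susp_out_cts susp_out_pt.

Lemma susp_outE t x : susp_out (susp_in t x) = h t x.
Proof. exact: (susp_liftE h0 h1 hp). Qed.

End susp_out.

Section flip.
Variable X : ptopologicalType.

Let opp (t : I01 R) := clamp (1 - I01val t).

Lemma flip_scts : scts R (fun z : I01 R * X => susp_in (opp z.1) z.2).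
Proof. by rewrite /opp; scts_auto. Qed.

Lemma flip0 (x : X) : susp_in (opp (i0 R)) x = point.
Proof. by rewrite /opp I01val0 subr0 clamp_ge1// susp_in1. Qed.

Lemma flip1 (x : X) : susp_in (opp (i1 R)) x = point.
Proof. by rewrite /opp I01val1 subrr clamp_le0// susp_in0. Qed.

(** The sign of the Puppe sequence: reversal of the suspension coordinate. *)
Definition flip : pointed_map (susp R X) (susp R X) :=
  @susp_out X (susp R X) (fun t x => susp_in (opp t) x) flip_scts
    flip0 flip1 (fun t => susp_in_pt X (opp t)).

Lemma flipE t x : flip (susp_in t x) = susp_in (clamp (1 - I01val t)) x.
Proof. exact: susp_outE. Qed.

Lemma flipK : pmap_comp flip flip = pmap_id (susp R X).
Proof.
apply: pmap_ext; elim/susp_ind => t x; rewrite !(pmap_compE, flipE); congr susp_in.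
have /andP[t0 t1] := I01val_itv t.
by rewrite clamp_itv ?subKr ?clampK//; apply/andP; split; lra.
Qed.

Lemma flip_equiv : homotopy_equiv flip.
Proof. by exists flip; rewrite flipK; split; exact: phomotopic_refl. Qed.

End flip.

Lemma flip_natural (X Y : ptopologicalType) (f : pointed_map X Y) :
  pmap_comp (flip Y) (susp_map R f) = pmap_comp (susp_map R f) (flip X).
Proof.
by apply: pmap_ext; elim/susp_ind => t x;
rewrite !(pmap_compE, susp_map_in, flipE).
Qed.

Section cofiber_maps.
Variables (A X : ngType R) (i : pointed_map A X) (W : ptopologicalType).

Lemma cof_phomotopy (f : I01 R -> X -> W) (h : I01 R -> I01 R -> A -> W) :
  scts R (fun z : I01 R * X => f z.1 z.2) ->
  scts R (fun z : I01 R * (I01 R * A) => h z.1 z.2.1 z.2.2) ->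
  (forall s, f s point = point) -> (forall s a, h s (i0 R) a = f s (i a)) ->
  (forall s a, h s (i1 R) a = point) -> (forall s t, h s t point = point) ->
  exists H : phomotopy R (cofiber i) W,
    (forall s x, H (s, cofiber_in i x) = f s x) /\
    (forall s t a, H (s, cof_in i t a) = h s t a).
Proof.
move=> cf ch fp h0 h1 hp.
have Eb s := cof_liftE_base (fp s) (h0 s) (h1 s) (hp s).
have Ec s := cof_liftE_cone (fp s) (h0 s) (h1 s) (hp s).
have c : scts R (fun z : I01 R * cofiber i => cof_lift (f z.1) (h z.1) z.2).
  apply: cof_scts; first by apply: scts_ext cf => -[s x] /=; rewrite Eb.
  by apply: scts_ext ch => -[s [t a]] /=; rewrite Ec.
have pt s : cof_lift (i := i) (f s) (h s) point = point.
  by rewrite -(cof_in1 i point) Ec h1.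
by exists (mk_ph c pt); split=> s => [x|t a] /=; rewrite ?Eb ?Ec.
Qed.

Section cof_out.
Variables (f : pointed_map X W) (h : I01 R -> A -> W).
Hypothesis ch : scts R (fun z : I01 R * A => h z.1 z.2).
Hypotheses (h0 : forall a, h (i0 R) a = f (i a)) (h1 : forall a, h (i1 R) a = point).
Hypothesis hp : forall t, h t point = point.

Lemma cof_liftE_base_pt x : cof_lift f h (cofiber_in i x) = f x.
Proof. exact: (cof_liftE_base (pmap_pt f) h0 h1 hp). Qed.

Lemma cof_liftE_cone_pt t a : cof_lift f h (cof_in i t a) = h t a.
Proof. exact: (cof_liftE_cone (pmap_pt f) h0 h1 hp). Qed.

Lemma cof_out_cts : continuous (cof_lift (i := i) f h).
Proof.
apply: cof_cts.
  rewrite (_ : _ \o _ = f); first exact: pmap_cts.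
  by apply/funext => x; rewrite /= cof_liftE_base_pt.
by apply: scts_ext ch => -[t a] /=; rewrite cof_liftE_cone_pt.
Qed.

Lemma cof_out_pt : cof_lift (i := i) f h point = point.
Proof. by rewrite -(cof_in1 i point) cof_liftE_cone_pt h1. Qed.

Definition cof_out : pointed_map (cofiber i) W :=
  PointedMap cof_out_cts cof_out_pt.

Lemma cof_outE_base x : cof_out (cofiber_in i x) = f x.
Proof. exact: cof_liftE_base_pt. Qed.

Lemma cof_outE_cone t a : cof_out (cof_in i t a) = h t a.
Proof. exact: cof_liftE_cone_pt. Qed.

End cof_out.

End cofiber_maps.

End pointed_homotopy.

(** * The Puppe sequence *)

Section puppe.
Variable R : realType.

Definition imax (s t : I01 R) : I01 R := clamp (Num.max (I01val s) (I01val t)).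

Lemma imax0 s : imax s (i0 R) = s.
Proof.
have /andP[s0 _] := I01val_itv s.
by rewrite /imax I01val0 (max_idPl s0) clampK.
Qed.

Lemma imax0l s : imax (i0 R) s = s.
Proof. by rewrite /imax maxC; exact: imax0. Qed.

Lemma imax1 s : imax s (i1 R) = i1 R.
Proof.
have /andP[_ s1] := I01val_itv s.
by rewrite /imax I01val1 (max_idPr s1) clamp_ge1.
Qed.

Lemma imax1l s : imax (i1 R) s = i1 R.
Proof. by rewrite /imax maxC; exact: imax1. Qed.

(** [tau] and [rho] describe, at stage [s], a path of two pieces: on
    [t <= s / 2] it runs down through [rho s t] from [s] to 0, and afterwards
    up through [tau s t] from 0 to 1.  At [s = 0] only the identity [tau]
    remains.  The factor [1 + s] replaces the slope [1 / (1 - s / 2)]: it is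
    large enough for 1 to be reached, after which [clamp] cuts it off. *)
Definition tau (s t : I01 R) : I01 R :=
  clamp ((1 + I01val s) * (I01val t - I01val s / 2)).

Definition rho (s t : I01 R) : I01 R := clamp (I01val s - 2 * I01val t).

Lemma tau0 t : tau (i0 R) t = t.
Proof. by rewrite /tau I01val0 mul0r subr0 addr0 mul1r clampK. Qed.

Lemma tau_le s t : I01val t - I01val s / 2 <= 0 -> tau s t = i0 R.
Proof.
move=> h; have /andP[s0 _] := I01val_itv s.
by apply: clamp_le0; apply: mulr_ge0_le0 => //; rewrite addr_ge0.
Qed.

Lemma tau1 s : tau s (i1 R) = i1 R.
Proof.
have /andP[s0 s1] := I01val_itv s; apply: clamp_ge1; rewrite I01val1; nra.
Qed.

Lemma rho0 s : rho s (i0 R) = s.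
Proof. by rewrite /rho I01val0 mulr0 subr0 clampK. Qed.

Lemma rho_ge s t : 0 <= I01val t - I01val s / 2 -> rho s t = i0 R.
Proof. by move=> h; apply: clamp_le0; lra. Qed.

Section puppe_maps.
Variables (A X : ngType R) (f : pointed_map A X).

Lemma pinch_scts : scts R (fun z : I01 R * A => susp_in z.1 z.2).
Proof. by scts_auto. Qed.

Definition pinch : pointed_map (cofiber f) (susp R A) :=
  @cof_out R A X f (susp R A) (pmap_cst X (susp R A)) (fun t a => susp_in t a) pinch_scts
    (@susp_in0 R A) (@susp_in1 R A) (susp_in_pt A).

Lemma pinch_base x : pinch (cofiber_in f x) = point.
Proof. exact: cof_outE_base. Qed.

Lemma pinch_cone t a : pinch (cof_in f t a) = susp_in t a.
Proof. exact: cof_outE_cone. Qed.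

Lemma collapse_scts : scts R (fun z : I01 R * X => point : susp R A).
Proof. by scts_auto. Qed.

(** Collapses [X u CX] inside [X u CA u CX]; a homotopy equivalence because
    [X u CX] contracts and the contraction extends over [CA]. *)
Definition collapse : pointed_map (cofiber (cofiber_in f)) (susp R A) :=
  @cof_out R X (cofiber f) (cofiber_in f) (susp R A) pinch
    (fun _ _ => point) collapse_scts
    (fun x => esym (pinch_base x)) (fun=> erefl) (fun=> erefl).

Lemma collapse_base y : collapse (cofiber_in _ y) = pinch y.
Proof. exact: cof_outE_base. Qed.

Lemma collapse_cone t x : collapse (cof_in _ t x) = point.
Proof. exact: cof_outE_cone. Qed.

Lemma collapse_in : pmap_comp collapse (cofiber_in (cofiber_in f)) = pinch.
Proof. by apply: pmap_ext => y; exact: collapse_base. Qed.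

Let j := cofiber_in f.

(** While the base of [CA] is pulled up the cone [CX] to height [s], the cone
    line over [a] is stretched: it first descends the line of [CX] over [f a]
    from height [s] to the base, and then climbs its former course in [CA]. *)
Definition unwind (s t : I01 R) (a : A) : cofiber j :=
  if I01val t - I01val s / 2 <= 0 then cof_in j (rho s t) (f a)
  else cofiber_in j (cof_in f (tau s t) a).

Lemma unwind_scts :
  scts R (fun z : I01 R * (I01 R * A) => unwind z.1 z.2.1 z.2.2).
Proof.
apply: (@paste_scts _ _ _ (fun z : I01 R * (I01 R * A) =>
  I01val z.2.1 - I01val z.1 / 2)); rewrite /rho /tau; try by scts_auto.
move=> z h; rewrite -/(rho _ _) -/(tau _ _).
by rewrite rho_ge ?h// tau_le ?h// !cof_in0.
Qed.

Lemma unwind0 s a : unwind s (i0 R) a = cof_in j s (f a).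
Proof.
have /andP[s0 _] := I01val_itv s.
by rewrite /unwind rho0 I01val0 ifT//; lra.
Qed.

Lemma unwind1 s a : unwind s (i1 R) a = point.
Proof.
have /andP[_ s1] := I01val_itv s.
rewrite /unwind tau1 I01val1 ifF; last by apply/negbTE; rewrite -ltNge; lra.
by rewrite cof_in1 pmap_pt.
Qed.

Lemma unwind_pt s t : unwind s t point = point.
Proof. by rewrite /unwind; case: ifP; rewrite ?(pmap_pt f) cof_in_pt// pmap_pt. Qed.

Lemma unwind_collapse s t a : collapse (unwind s t a) = susp_in (tau s t) a.
Proof.
rewrite /unwind; case: ifP => h; first by rewrite collapse_cone tau_le// susp_in0.
by rewrite collapse_base pinch_cone.
Qed.

Lemma uncollapse_scts : scts R (fun z : I01 R * A => unwind (i1 R) z.1 z.2).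
Proof.
exact: (scts_comp (scts_pair (@scts_cst R _ _ (i1 R)) (@scts_id R _)) unwind_scts).
Qed.

Lemma uncollapse0 a : unwind (i1 R) (i0 R) a = point.
Proof. by rewrite unwind0 cof_in1. Qed.

(** The end [s = 1] of the stretching, which factors through the suspension:
    down the line of [CX] over [f a], then up that of [CA] over [a]. *)
Definition uncollapse : pointed_map (susp R A) (cofiber j) :=
  @susp_out R A (cofiber j) (unwind (i1 R)) uncollapse_scts
    uncollapse0 (unwind1 (i1 R)) (unwind_pt (i1 R)).

Lemma uncollapseE t a : uncollapse (susp_in t a) = unwind (i1 R) t a.
Proof. exact: susp_outE. Qed.

(** Stretching by [unwind] is a homotopy from the identity to [uncollapse]
    after [collapse], and pushing it forward by [collapse] gives the homotopy
    for the other composite. *)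
Lemma collapse_equiv : homotopy_equiv R collapse.
Proof.
exists uncollapse; split; apply: phomotopic_sym.
  have [||||||K [KE0 KE1]] := @cof_phomotopy R A X f (cofiber j)
    (fun s x => cof_in j s x) unwind.
  - by scts_auto.
  - exact: unwind_scts.
  - by move=> s; exact: cof_in_pt.
  - exact: unwind0.
  - exact: unwind1.
  - exact: unwind_pt.
  have [||||||G [GE0 GE1]] := @cof_phomotopy R X (cofiber f) j (cofiber j)
    (fun s y => K (s, y)) (fun s t x => cof_in j (imax s t) x).
  - by scts_auto.
  - by rewrite /imax; scts_auto.
  - by move=> s; exact: ph_pt.
  - by move=> s x; rewrite KE0 imax0.
  - by move=> s x; rewrite imax1 cof_in1.
  - by move=> s t; exact: cof_in_pt.
  exists G; split; elim/cof_ind => [y|t x]; rewrite ?pmap_compE.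
  - rewrite GE0; elim/cof_ind: y => [x|t a]; first by rewrite KE0 cof_in0.
    rewrite KE1 /unwind I01val0 mul0r subr0 tau0.
    have /andP[t0 _] := I01val_itv t; case: ifP => // t0'.
    have -> : t = i0 R by apply: I01_ext; apply/eqP; rewrite eq_le t0 t0'.
    by rewrite rho0 !cof_in0.
  - by rewrite GE1 imax0l.
  - rewrite GE0 collapse_base; elim/cof_ind: y => [x|t a].
      by rewrite KE0 cof_in1 pinch_base (pmap_pt uncollapse).
    by rewrite KE1 pinch_cone uncollapseE.
  - by rewrite GE1 imax1l cof_in1 collapse_cone (pmap_pt uncollapse).
have [||||H HE] := @susp_phomotopy R A (susp R A) (fun s t a => susp_in (tau s t) a).
- by rewrite /tau; scts_auto.
- move=> s a; rewrite tau_le ?susp_in0// I01val0.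
  by have /andP[s0 _] := I01val_itv s; lra.
- by move=> s a; rewrite tau1 susp_in1.
- by move=> s t; exact: susp_in_pt.
exists H; split; elim/susp_ind => t a; rewrite HE; first by rewrite tau0.
rewrite pmap_compE.
by rewrite uncollapseE unwind_collapse.
Qed.


End puppe_maps.

(** In [X u CA u CX], one map collapses [X u CA] and the other [X u CX].  In
    between, at stage [s], the base [X] is sent to height [s] of the suspension,
    [CX] to what lies above it, and [CA] to what lies below; [CA] is then
    traversed downwards, hence the flip. *)
Lemma pinch_collapse (A X : ngType R) (f : pointed_map A X) :
  phomotopic R (pinch (cofiber_in f))
    (pmap_comp (flip R X) (pmap_comp (susp_map R f) (collapse f))).
Proof.
have [||||||K [KE0 KE1]] := @cof_phomotopy R A X f (susp R X)
  (fun s x => susp_in s x)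
  (fun s t a => susp_in (clamp (I01val s * (1 - I01val t))) (f a)).
- by scts_auto.
- by scts_auto.
- by move=> s; exact: susp_in_pt.
- by move=> s a; rewrite I01val0 subr0 mulr1 clampK.
- by move=> s a; rewrite I01val1 subrr mulr0 clamp_le0// susp_in0.
- by move=> s t; rewrite pmap_pt susp_in_pt.
have [||||||G [GE0 GE1]] := @cof_phomotopy R X (cofiber f) (cofiber_in f)
  (susp R X) (fun s y => K (s, y)) (fun s t x => susp_in (imax s t) x).
- by scts_auto.
- by rewrite /imax; scts_auto.
- by move=> s; exact: ph_pt.
- by move=> s x; rewrite KE0 imax0.
- by move=> s x; rewrite imax1 susp_in1.
- by move=> s t; exact: susp_in_pt.
exists G; split; elim/cof_ind => [y|t x].
- rewrite GE0 pinch_base; elim/cof_ind: y => [x|t a]; first by rewrite KE0 susp_in0.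
  by rewrite KE1 I01val0 mul0r clamp_le0// susp_in0.
- by rewrite GE1 imax0l pinch_cone.
- rewrite GE0 !pmap_compE collapse_base; elim/cof_ind: y => [x|t a].
    by rewrite KE0 susp_in1 pinch_base !(pmap_pt (susp_map R f), pmap_pt (flip R X)).
  by rewrite KE1 pinch_cone susp_map_in flipE I01val1 mul1r.
- by rewrite GE1 imax1l susp_in1 !pmap_compE collapse_cone
    !(pmap_pt (susp_map R f), pmap_pt (flip R X)).
Qed.

Lemma cofiber_id_contractible (X : ngType R) :
  phomotopic R (pmap_id (cofiber (pmap_id X)))
    (pmap_cst (cofiber (pmap_id X)) (cofiber (pmap_id X))).
Proof.
have [||||||K [KE0 KE1]] := @cof_phomotopy R X X (pmap_id X) (cofiber (pmap_id X))
  (fun s x => cof_in (pmap_id X) s x) (fun s t x => cof_in (pmap_id X) (imax s t) x).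
- by scts_auto.
- by rewrite /imax; scts_auto.
- by move=> s; exact: cof_in_pt.
- by move=> s x; rewrite imax0.
- by move=> s x; rewrite imax1 cof_in1.
- by move=> s t; exact: cof_in_pt.
exists K; split; elim/cof_ind => [x|t x] /=; rewrite ?KE0 ?KE1.
- by rewrite cof_in0.
- by rewrite imax0l.
- by rewrite cof_in1.
- by rewrite imax1l cof_in1.
Qed.

(** The cofiber of the inclusion of [X] into its cone is the suspension. *)
Lemma pinch_cofiber_in_id_equiv (X : ngType R) :
  homotopy_equiv R (pinch (cofiber_in (pmap_id X))).
Proof.
apply: (homotopy_equiv_phomotopic (phomotopic_sym (pinch_collapse (pmap_id X)))).
rewrite susp_map_id pmap_comp1f; apply: homotopy_equiv_comp (collapse_equiv _).
exact: flip_equiv.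
Qed.

End puppe.
(** * Embeddings and wedge sums *)

Section embeddings.
Variable R : realType.

Lemma embedding_retract (A X : topologicalType) (i : A -> X) (r : X -> A) :
  continuous i -> continuous r -> cancel i r -> embedding i.
Proof.
move=> /continuousP ci /continuousP cr ir; split; first exact: can_inj ir.
move=> U; split=> [oU|[V oV ->]]; last exact: ci.
exists (r @^-1` U); first exact: cr.
by rewrite -comp_preimage (_ : r \o i = id)//; apply/funext => a; exact: ir.
Qed.

Lemma embedding_id (X : ptopologicalType) : embedding (pmap_id X).
Proof.
by apply: (@embedding_retract _ _ _ id) => //; exact: (@pmap_cts _ _ (pmap_id X)).
Qed.

Section cofiber_in.
Variables (A X : ngType R) (i : pointed_map A X).

(** Extends [U] into the cone by a collar, and around the vertex when the
    base point lies in [U]; the two parts are compatible along the line over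
    the base point, which is collapsed.  This is what makes the inclusion into
    a cofiber an embedding. *)
Definition cof_thicken (U : set X) : set (cofiber i) :=
  cof_lift U (fun (t : I01 R) a =>
    (I01val t < 1 /\ U (i a)) \/ (2^-1 < I01val t /\ U point)).

Let thicken0 (U : set X) a : ((I01val (i0 R) < 1 /\ U (i a)) \/
  (2^-1 < I01val (i0 R) /\ U point)) = U (i a).
Proof.
rewrite I01val0; apply/propext; split=> [[[]//|[]]|Ua].
  by rewrite invr_lt0 ltrn0.
by left; rewrite ltr01.
Qed.

Let thicken1 (U : set X) a : ((I01val (i1 R) < 1 /\ U (i a)) \/
  (2^-1 < I01val (i1 R) /\ U point)) = U point.
Proof.
rewrite I01val1; apply/propext; split=> [[[]|[]//]|Ua].
  by rewrite ltxx.
by right; rewrite invf_lt1 ?ltr0n// ltr1n.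
Qed.

Let thickenp (U : set X) (t : I01 R) : ((I01val t < 1 /\ U (i point)) \/
  (2^-1 < I01val t /\ U point)) = U point.
Proof.
rewrite pmap_pt; apply/propext; split=> [[[]|[]]//|Ua].
have [t1|] := ltP (I01val t) 1; [by left|move=> t1; right].
by split=> //; apply: lt_le_trans t1; rewrite invf_lt1 ?ltr0n// ltr1n.
Qed.

Lemma cof_thicken_base U x : cof_thicken U (cofiber_in i x) = U x.
Proof. exact: (cof_liftE_base erefl (@thicken0 U) (@thicken1 U) (@thickenp U)). Qed.

Lemma cof_thicken_cone U (t : I01 R) a : cof_thicken U (cof_in i t a) =
  ((I01val t < 1 /\ U (i a)) \/ (2^-1 < I01val t /\ U point)).
Proof. exact: (cof_liftE_cone erefl (@thicken0 U) (@thicken1 U) (@thickenp U)). Qed.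

Lemma cof_thicken_open U : open U -> open (cof_thicken U).
Proof.
move=> oU; have [_ _ ofin] := final_cofiber i; apply: ofin => -[] /=.
  rewrite (_ : _ @^-1` _ = U)//.
  by apply/seteqP; split=> x; rewrite /preimage/= cof_thicken_base.
have c1 : continuous (fun z : nu R (I01 R * A)%type => I01val z.1).
  by apply: (@nu_scts R (I01 R * A)%type _ (fun z : I01 R * A => I01val z.1)); scts_auto.
have c2 : continuous (fun z : nu R (I01 R * A)%type => i z.2).
  by apply: (@nu_scts R (I01 R * A)%type _ (fun z : I01 R * A => i z.2)); scts_auto.
set V := _ @^-1` _.
have -> : V = ((fun z : nu R (I01 R * A)%type => I01val z.1) @^-1` [set x | x < 1] `&`
   (fun z : nu R (I01 R * A)%type => i z.2) @^-1` U) `|`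
   ((fun z : nu R (I01 R * A)%type => I01val z.1) @^-1` [set x | 2^-1 < x] `&`
   (fun z : nu R (I01 R * A)%type => point : X) @^-1` U).
  by apply/seteqP; split=> -[t a]; rewrite /V /preimage/= cof_thicken_cone.
apply: openU; apply: openI.
- by move/continuousP: c1; apply; exact: open_lt.
- by move/continuousP: c2; apply.
- by move/continuousP: c1; apply; exact: open_gt.
- by have /continuousP := @cst_continuous (nu R (I01 R * A)%type) X point; apply.
Qed.

Lemma embedding_cofiber_in : embedding (cofiber_in i).
Proof.
split=> [x y xy|U].
  have : cof_thicken [set y] (cofiber_in i x) by rewrite xy cof_thicken_base.
  by rewrite cof_thicken_base.
split=> [oU|[V oV ->]].
  exists (cof_thicken U); first exact: cof_thicken_open.
  by apply/seteqP; split=> x; rewrite /preimage/= cof_thicken_base.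
by have /continuousP := @pmap_cts _ _ (cofiber_in i); apply.
Qed.

End cofiber_in.

End embeddings.

Section wedge_self.
Variables (R : realType) (X : ngType R).

Definition wedge_incl (b : bool) : pointed_map X (wedge_self X) :=
  PointedMap (@ngwedge_in_continuous R bool (fun=> X) b)
    (@ngwedge_in_point R bool (fun=> X) b).

Lemma wedge_self_map_incl g b x : wedge_self_map g (wedge_incl b x) = g b x.
Proof. exact: wedge_self_fun_in. Qed.

Lemma wedge_proj_incl b : pmap_comp (wedge_proj X b) (wedge_incl b) = pmap_id X.
Proof. by apply: pmap_ext => x; rewrite pmap_compE wedge_self_map_incl eqxx. Qed.

Lemma wedge_proj_incl_ne b c x : b != c -> wedge_proj X b (wedge_incl c x) = point.
Proof. by rewrite eq_sym wedge_self_map_incl => /negbTE ->. Qed.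

Lemma wedge_fold_incl b : pmap_comp (wedge_fold X) (wedge_incl b) = pmap_id X.
Proof. by apply: pmap_ext => x; rewrite pmap_compE wedge_self_map_incl. Qed.

Lemma final_wedge : final (fun b => wedge_incl b : X -> wedge_self X).
Proof.
split=> [b|q|U oU]; first exact: pmap_cts.
  by elim/ngwedge_ind: q => b x; exists b, x.
exact/wedge_openP.
Qed.

Lemma wedge_self_ind (P : wedge_self X -> Prop) :
  (forall b x, P (wedge_incl b x)) -> forall q, P q.
Proof. by move=> Pin q; elim/ngwedge_ind: q => b x; exact: Pin. Qed.

Lemma wedge_scts (P W : topologicalType) (F : P * wedge_self X -> W) :
  (forall b, scts R (fun z : P * X => F (z.1, wedge_incl b z.2))) -> scts R F.
Proof.
by move=> cF; exact: (final_prodr final_wedge).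
Qed.

Variable c : bool.
Let j := wedge_incl c.

Lemma wedge_collapse0 a : point = wedge_proj X (~~ c) (j a).
Proof. by rewrite wedge_proj_incl_ne//; case: c. Qed.

Lemma wedge_collapse_scts : scts R (fun z : I01 R * X => point : X).
Proof. exact: scts_cst. Qed.

Definition wedge_collapse : pointed_map (cofiber j) X :=
  @cof_out R X (wedge_self X) j X (wedge_proj X (~~ c)) (fun _ _ => point)
    wedge_collapse_scts wedge_collapse0 (fun=> erefl) (fun=> erefl).

Lemma wedge_collapse_base w : wedge_collapse (cofiber_in j w) = wedge_proj X (~~ c) w.
Proof. exact: cof_outE_base. Qed.

Lemma wedge_collapse_cone t x : wedge_collapse (cof_in j t x) = point.
Proof. exact: cof_outE_cone. Qed.

(** Coning off one summand of [X v X] leaves the other: the coned summand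
    slides up its cone to the vertex while the other one stays fixed. *)
Lemma wedge_collapse_equiv : homotopy_equiv R wedge_collapse.
Proof.
exists (pmap_comp (cofiber_in j) (wedge_incl (~~ c))); split; last first.
  rewrite pmap_compA (_ : pmap_comp wedge_collapse _ = wedge_proj X (~~ c)).
    by rewrite wedge_proj_incl; exact: phomotopic_refl.
  by apply: pmap_ext => w; rewrite pmap_compE wedge_collapse_base.
pose f0 s b (x : X) : cofiber j :=
  if b == c then cof_in j s x else cofiber_in j (wedge_incl b x).
have f0p s b : f0 s b point = point.
  by rewrite /f0; case: ifP => _; rewrite ?cof_in_pt// !pmap_pt.
pose f s : wedge_self X -> cofiber j := wedge_fun (p0 := fun=> point : X) (f0 s).
have fE s b x : f s (wedge_incl b x) = f0 s b x.
  by apply: wedge_lift_funE => b1 b2; rewrite !f0p.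
apply: phomotopic_sym.
have [||||||G [GE0 GE1]] := @cof_phomotopy R X (wedge_self X) j (cofiber j) f
  (fun s t x => cof_in j (imax s t) x).
- apply: wedge_scts => b; apply: (scts_ext (fun z => esym (fE z.1 b z.2))).
  by rewrite /f0; case: (b == c); scts_auto.
- by rewrite /imax; scts_auto.
- by move=> s; rewrite -(pmap_pt (wedge_incl c)) fE f0p.
- by move=> s x; rewrite imax0 fE /f0 eqxx.
- by move=> s x; rewrite imax1 cof_in1.
- by move=> s t; exact: cof_in_pt.
exists G; split; elim/cof_ind => [w|t x].
- rewrite GE0; elim/wedge_self_ind: w => b x; rewrite fE /f0.
  by case: eqP => // ->; rewrite cof_in0.
- by rewrite GE1 imax0l.
- rewrite !pmap_compE GE0 wedge_collapse_base.
  elim/wedge_self_ind: w => b x; rewrite fE /f0; case: eqP => [->|/eqP bc].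
    by rewrite -wedge_collapse0 !pmap_pt cof_in1.
  have -> : b = ~~ c by move: bc; case: b; case: (c).
  by rewrite -(pmap_compE (wedge_proj _ _)) wedge_proj_incl.
- by rewrite !pmap_compE GE1 imax1l cof_in1 wedge_collapse_cone !pmap_pt.
Qed.

Lemma embedding_wedge_incl : embedding j.
Proof.
apply: (@embedding_retract _ _ _ (wedge_proj X c)).
- exact: pmap_cts.
- exact: pmap_cts.
- by move=> x; rewrite -(pmap_compE (wedge_proj _ _)) wedge_proj_incl.
Qed.

End wedge_self.

(** * Coexact sequences *)

Section coexact.
Variables (R : realType) (C : ngType R -> Prop) (hC : admissible C).

(** Being a cofiber sequence of an embedding is imposed only up to homotopy:
    this is what survives suspension, as a suspended embedding need not be
    one. *)
Definition coexact (A X Y : obj C) (f : pointed_map A X) (g : pointed_map X Y) :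
    Prop :=
  exists (A' X' : obj C) (i : pointed_map A' X') (ei : embedding i)
    (a : pointed_map A' A) (x : pointed_map X' X)
    (y : pointed_map (cofiber_obj hC ei) Y),
  [/\ homotopy_equiv R a, homotopy_equiv R x, homotopy_equiv R y,
      phomotopic R (pmap_comp f a) (pmap_comp x i) &
      phomotopic R (pmap_comp g x) (pmap_comp y (cofiber_in i))].

Lemma coexact_cofiber (A X : obj C) (i : pointed_map A X) (ei : embedding i) :
  @coexact A X (cofiber_obj hC ei) i (cofiber_in i).
Proof.
exists A, X, i, ei, (pmap_id A), (pmap_id X), (pmap_id (cofiber_obj hC ei)).
split; try exact: homotopy_equiv_id;
  by rewrite pmap_comp1f pmap_compf1; exact: phomotopic_refl.
Qed.

Lemma coexact_wedge (X : obj C) (c : bool) :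
  @coexact X (wedge_obj hC X) X (wedge_incl X c) (wedge_proj X (~~ c)).
Proof.
exists X, (wedge_obj hC X), (wedge_incl X c), (@embedding_wedge_incl R X c),
  (pmap_id X), (pmap_id (wedge_self X)), (wedge_collapse X c).
split; [exact: homotopy_equiv_id|exact: homotopy_equiv_id|
  exact: wedge_collapse_equiv| |].
  by rewrite pmap_comp1f pmap_compf1; exact: phomotopic_refl.
rewrite pmap_compf1; set u := pmap_comp _ _.
have -> : u = wedge_proj X (~~ c).
  by apply: pmap_ext => w; rewrite /u pmap_compE wedge_collapse_base.
exact: phomotopic_refl.
Qed.

(** The flip sits on the middle map, so that both squares comparing the
    continued Puppe sequence with the suspended one commute up to homotopy:
    in the first it cancels against the flip of [pinch_collapse], in the second
    it is moved across by naturality. *)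
Lemma puppe_square1 (A X : ngType R) (f : pointed_map A X) :
  phomotopic R (pmap_comp (susp_map R f) (collapse f))
    (pmap_comp (pmap_comp (flip R X) (collapse (cofiber_in f)))
      (cofiber_in (cofiber_in (cofiber_in f)))).
Proof.
apply: phomotopic_sym; rewrite -pmap_compA collapse_in.
have := phomotopic_compl (flip R X) (pinch_collapse f).
by rewrite !pmap_compA flipK pmap_comp1f.
Qed.

Lemma puppe_square2 (A X : ngType R) (f : pointed_map A X) :
  let j := cofiber_in f in
  phomotopic R (pmap_comp (susp_map R j) (pmap_comp (flip R X) (collapse j)))
    (pmap_comp (collapse (cofiber_in j)) (cofiber_in (cofiber_in (cofiber_in j)))).
Proof.
move=> j; apply: phomotopic_sym; rewrite collapse_in.
have := pinch_collapse j.
by rewrite !pmap_compA flip_natural.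
Qed.

Lemma susp_square (A X A' X' Z W : ptopologicalType) (f : pointed_map A X)
    (a : pointed_map A' A) (x : pointed_map X' X) (i : pointed_map A' X')
    (e : pointed_map Z (susp R A')) (e' : pointed_map W (susp R X'))
    (l : pointed_map Z W) :
  phomotopic R (pmap_comp f a) (pmap_comp x i) ->
  phomotopic R (pmap_comp (susp_map R i) e) (pmap_comp e' l) ->
  phomotopic R (pmap_comp (susp_map R f) (pmap_comp (susp_map R a) e))
    (pmap_comp (pmap_comp (susp_map R x) e') l).
Proof.
move=> fa ie; rewrite pmap_compA -susp_map_comp -pmap_compA.
apply: (phomotopic_trans (phomotopic_compr e (susp_map_phomotopic fa))).
by rewrite susp_map_comp -pmap_compA; exact: phomotopic_compl.
Qed.

(** Three steps along the Puppe sequence amount to one suspension, and each of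
    those steps is the inclusion into a cofiber, hence an embedding. *)
Lemma coexact_susp (A X Y : obj C) (f : pointed_map A X) (g : pointed_map X Y) :
  coexact f g ->
  @coexact (susp_obj hC A) (susp_obj hC X) (susp_obj hC Y)
    (susp_map R f) (susp_map R g).
Proof.
move=> [A' [X' [i [ei [a [x [y [ha hx hy fa gx]]]]]]]].
pose Y' : obj C := cofiber_obj hC ei.
pose j : pointed_map X' Y' := cofiber_in i.
pose Z : obj C := cofiber_obj hC (embedding_cofiber_in i : embedding j).
pose k : pointed_map Y' Z := cofiber_in j.
pose W : obj C := cofiber_obj hC (embedding_cofiber_in j : embedding k).
pose l : pointed_map Z W := cofiber_in k.
exists Z, W, l, (embedding_cofiber_in k),
  (pmap_comp (susp_map R a) (collapse i)),
  (pmap_comp (susp_map R x) (pmap_comp (flip R X') (collapse j))),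
  (pmap_comp (susp_map R y) (collapse k)).
split.
- by apply: homotopy_equiv_comp (collapse_equiv i); exact: susp_map_equiv.
- apply: homotopy_equiv_comp; first exact: susp_map_equiv.
  by apply: homotopy_equiv_comp (collapse_equiv j); exact: flip_equiv.
- by apply: homotopy_equiv_comp (collapse_equiv k); exact: susp_map_equiv.
- exact: (susp_square fa (puppe_square1 i)).
- exact: (susp_square gx (puppe_square2 i)).
Qed.

End coexact.
(** * Homotopy groups *)

Section cubes.
Variable R : realType.

Lemma simplex_retract_of (K L : topologicalType) (s : K -> L) (r : L -> K) :
  continuous s -> continuous r -> cancel s r ->
  simplex_retract R L -> simplex_retract R K.
Proof.
move=> cs cr sr [N [s' [r' [cs' cr' sr']]]]; exists N, (s' \o s), (r \o r').
split; [exact: (cts_comp cs cs')|exact: (cts_comp cr' cr)|].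
by move=> k /=; rewrite sr' sr.
Qed.

Lemma chead_subproof n (v : cube R n.+1) : 0 <= cube_coord v ord0 <= 1.
Proof. exact: cube_coord_itv. Qed.

Definition chead n (v : cube R n.+1) : I01 R := mkI01 (chead_subproof v).

Definition ctail n (v : cube R n.+1) : cube R n :=
  mk_cube (fun i => cube_coord_itv v (lift ord0 i)).

Lemma ccons_subproof n (t : I01 R) (u : cube R n) (i : 'I_n.+1) :
  0 <= (if unlift ord0 i is Some j then cube_coord u j else I01val t) <= 1.
Proof. by case: unlift => [j|]; [exact: cube_coord_itv|exact: I01val_itv]. Qed.

Definition ccons n (t : I01 R) (u : cube R n) : cube R n.+1 :=
  mk_cube (ccons_subproof t u).

Lemma cube_ext n (u v : cube R n) : cube_coord u =1 cube_coord v -> u = v.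
Proof. by move=> uv; apply: val_inj; apply/rowP => i; exact: uv. Qed.

Lemma ccons_coord0 n t (u : cube R n) : cube_coord (ccons t u) ord0 = I01val t.
Proof. by rewrite mk_cubeE unlift_none. Qed.

Lemma ccons_coordS n t (u : cube R n) i :
  cube_coord (ccons t u) (lift ord0 i) = cube_coord u i.
Proof. by rewrite mk_cubeE liftK. Qed.

Lemma cheadE n (v : cube R n.+1) : I01val (chead v) = cube_coord v ord0.
Proof. by []. Qed.

Lemma ccons_head n t (u : cube R n) : chead (ccons t u) = t.
Proof. by apply: I01_ext; rewrite cheadE ccons_coord0. Qed.

Lemma ccons_tail n t (u : cube R n) : ctail (ccons t u) = u.
Proof. by apply: cube_ext => i; rewrite mk_cubeE ccons_coordS. Qed.

Lemma cconsK n (v : cube R n.+1) : ccons (chead v) (ctail v) = v.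
Proof.
apply: cube_ext => i; case: (unliftP ord0 i) => [j ->|->].
  by rewrite ccons_coordS mk_cubeE.
by rewrite ccons_coord0.
Qed.

Lemma cube_bd_ccons n t (u : cube R n) :
  cube_bd (ccons t u) <-> [\/ t = i0 R, t = i1 R | cube_bd u].
Proof.
split=> [[i]|[->|->|[i hi]]].
- case: (unliftP ord0 i) => [j ->|->]; first
    by rewrite ccons_coordS; constructor 3; exists j.
  by rewrite ccons_coord0 => -[h|h]; [constructor 1|constructor 2]; exact: I01_ext.
- by exists ord0; left; rewrite ccons_coord0.
- by exists ord0; right; rewrite ccons_coord0.
- by exists (lift ord0 i); rewrite ccons_coordS.
Qed.

Lemma cube_bd_cons n (v : cube R n.+1) :
  cube_bd v <-> [\/ chead v = i0 R, chead v = i1 R | cube_bd (ctail v)].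
Proof. by rewrite -{1}(cconsK v) cube_bd_ccons. Qed.

Lemma scts_chead (Z : topologicalType) n (f : Z -> cube R n.+1) :
  scts R f -> scts R (fun z => chead (f z)).
Proof.
move=> cf; apply: (scts_comp cf); apply: cts_scts; apply: to_I01_continuous.
exact: cube_coord_continuous.
Qed.

Lemma scts_ctail (Z : topologicalType) n (f : Z -> cube R n.+1) :
  scts R f -> scts R (fun z => ctail (f z)).
Proof.
move=> cf; apply: (scts_comp cf); apply: cts_scts; apply: to_cube_continuous => i.
under eq_fun do rewrite mk_cubeE; exact: cube_coord_continuous.
Qed.

Lemma ccons_continuous n :
  continuous (fun z : I01 R * cube R n => ccons z.1 z.2).
Proof.
apply: to_cube_continuous => i; under eq_fun do rewrite mk_cubeE.
case: unlift => [j|].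
  exact: (cts_comp (@cts_snd _ _) (@cube_coord_continuous R n j)).
exact: (cts_comp (@cts_fst _ _) (@I01val_continuous R)).
Qed.

Lemma scts_ccons (Z : topologicalType) n (f : Z -> I01 R) (g : Z -> cube R n) :
  scts R f -> scts R g -> scts R (fun z => ccons (f z) (g z)).
Proof.
by move=> cf cg; exact: (scts_comp (scts_pair cf cg) (cts_scts (@ccons_continuous n))).
Qed.

Lemma simplex_retract_cube n : simplex_retract R (cube R n).
Proof.
elim: n => [|n IHn].
  have f0 (i : 'I_1) : 0 <= (1 : R) by exact: ler01.
  have f1 : \sum_(i < 1) (1 : R) = 1 by rewrite big_ord_recl big_ord0 addr0.
  have c01 (i : 'I_0) : 0 <= (0 : R) <= 1 by rewrite lexx ler01.
  exists 0%N, (fun _ => mkDelta f0 f1), (fun _ => mk_cube c01).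
  split; [exact: cst_continuous|exact: cst_continuous|].
  by move=> u; apply: cube_ext => -[].
apply: (@simplex_retract_of _ (I01 R * cube R n)%type
  (fun v => (chead v, ctail v)) (fun z => ccons z.1 z.2)).
- apply: cts_pair; first by apply: to_I01_continuous; exact: cube_coord_continuous.
  apply: to_cube_continuous => i; under eq_fun do rewrite mk_cubeE.
  exact: cube_coord_continuous.
- exact: ccons_continuous.
- exact: cconsK.
- by apply: simplex_retract_prod => //; exact: simplex_retract_I01.
Qed.

Lemma simplex_retract_I01_cube n : simplex_retract R (I01 R * cube R n)%type.
Proof.
apply: simplex_retract_prod; first exact: simplex_retract_I01.
exact: simplex_retract_cube.
Qed.

Lemma scts_gloop (Z X : topologicalType) n (x : X) (a : gloop R n x)
    (f : Z -> cube R n) : scts R f -> scts R (fun z => a (f z)).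
Proof. by move=> cf; exact: (scts_comp cf (cts_scts (@gl_cts _ _ _ _ a))). Qed.

End cubes.

Ltac scts_cube_step :=
  lazymatch goal with
  | |- scts _ (fun z => ccons (@?f z) (@?g z)) => refine (@scts_ccons _ _ _ f g _ _)
  | |- scts _ (fun z => chead (@?f z)) => refine (@scts_chead _ _ _ f _)
  | |- scts _ (@fst _ _) => exact: scts_fst
  | |- scts _ (@snd _ _) => exact: scts_snd
  | |- scts _ (@chead _ _) => exact/scts_chead/scts_id
  | |- scts _ (@ctail _ _) => exact/scts_ctail/scts_id
  | |- scts _ (fun z => ctail (@?f z)) => refine (@scts_ctail _ _ _ f _)
  | |- scts _ (fun z => gl_fun ?a (@?f z)) => refine (@scts_gloop _ _ _ _ _ a f _)
  | |- scts _ (fun z => Num.min (@?f z) (@?g z)) => refine (@scts_min _ _ f g _ _)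
  end.

Ltac scts_auto ::= do ?first [scts_cube_step | scts_step].

Section gloops.
Variable R : realType.

Definition hclass n (X : topologicalType) (x : X) (a : gloop R n x) :
  hgroup R n x := class_of (@gloop_homotopic R n X x) a.

Section gloop_relation.
Variables (n : nat) (X : topologicalType) (x : X).
Implicit Types a b c : gloop R n x.

Lemma gloop_homotopicP a b :
  (exists H : I01 R * cube R n -> X,
    [/\ scts R H, forall t, H (i0 R, t) = a t, forall t, H (i1 R, t) = b t &
      forall s t, cube_bd t -> H (s, t) = x]) -> gloop_homotopic a b.
Proof.
move=> [H [cH H0 H1 Hb]]; exists H; split=> //.
exact: simplex_retract_cts (@simplex_retract_I01_cube R n) cH.
Qed.

Lemma gloop_homotopic_eq a b : a =1 b -> gloop_homotopic a b.
Proof.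
move=> ab; apply: gloop_homotopicP; exists (fun z => a z.2); split=> //.
  by apply: scts_gloop; exact: scts_snd.
by move=> s t; exact: gl_bd.
Qed.

Lemma gloop_homotopic_sym a b : gloop_homotopic a b -> gloop_homotopic b a.
Proof.
move=> [H [cH H0 H1 Hb]]; apply: gloop_homotopicP.
exists (fun z => H (clamp (1 - I01val z.1), z.2)); split=> [|t|t|s t bt].
- by apply: (scts_comp _ (cts_scts cH)); scts_auto.
- by rewrite I01val0 subr0 clamp_ge1.
- by rewrite I01val1 subrr clamp_le0.
- exact: Hb.
Qed.

Lemma gloop_homotopic_trans a b c :
  gloop_homotopic a b -> gloop_homotopic b c -> gloop_homotopic a c.
Proof.
move=> [H [cH H0 H1 Hb]] [K [cK K0 K1 Kb]]; apply: gloop_homotopicP.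
pose F (z : I01 R * cube R n) := if I01val z.1 <= 2^-1
  then H (clamp (2 * I01val z.1), z.2) else K (clamp (2 * I01val z.1 - 1), z.2).
exists F; split=> [|t|t|s t bt].
- apply: paste_scts; first by scts_auto.
  + by apply: (scts_comp _ (cts_scts cH)); scts_auto.
  + by apply: (scts_comp _ (cts_scts cK)); scts_auto.
  + by move=> z ->; rewrite divff ?pnatr_eq0// clamp_ge1// clamp_le0 ?subrr// H1 K0.
- by rewrite /F/= I01val0 invr_ge0 ler0n mulr0 clamp_le0.
- by rewrite /F/= I01val1 leNgt invf_lt1 ?ltr0n// ltr1n/= clamp_ge1//; lra.
- by rewrite /F/=; case: ifP => _; rewrite ?Hb ?Kb.
Qed.

(** Homotopy of loops is already an equivalence relation, so equality in the
    quotient by the generated one yields an actual homotopy. *)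
Lemma hgroup_eqP a b : hclass a = hclass b <-> gloop_homotopic a b.
Proof.
split=> [/eqmodP/asboolP|]; last exact: class_of_eq.
elim=> {a b} [//|a|a b _ ab|a b c _ ab _ bc].
- exact: gloop_homotopic_eq.
- exact: gloop_homotopic_sym.
- exact: gloop_homotopic_trans ab bc.
Qed.

Lemma hgroup_ind (P : hgroup R n x -> Prop) :
  (forall a, P (hclass a)) -> forall q, P q.
Proof. by move=> Pa q; rewrite -(class_of_repr q); exact: Pa. Qed.

Lemma gloop_repr_class a : gloop_homotopic (repr (hclass a)) a.
Proof. by apply/hgroup_eqP; exact: class_of_repr. Qed.

End gloop_relation.

Section functoriality.
Variables (n : nat) (X Y : topologicalType) (f : X -> Y) (cf : continuous f).
Variables (x : X) (y : Y) (fx : f x = y).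

Lemma gloop_map_homotopic (a b : gloop R n x) :
  gloop_homotopic a b ->
  gloop_homotopic (gloop_map cf fx a) (gloop_map cf fx b).
Proof.
move=> [H [cH H0 H1 Hb]]; exists (f \o H); split.
- exact: cts_comp.
- by move=> t; rewrite /= H0.
- by move=> t; rewrite /= H1.
- by move=> s t bt; rewrite /= Hb.
Qed.

Lemma hgroup_map_class (a : gloop R n x) :
  hgroup_map cf fx (hclass a) = hclass (gloop_map cf fx a).
Proof.
by apply/hgroup_eqP/gloop_map_homotopic; exact: gloop_repr_class.
Qed.

End functoriality.

Section product.
Variables (n : nat) (X : topologicalType) (x : X).
Implicit Types a b c : gloop R n.+1 x.

Lemma concatE a b v : concat a b v =
  if I01val (chead v) <= 2^-1 then a (ccons (clamp (2 * I01val (chead v))) (ctail v))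
  else b (ccons (clamp (2 * I01val (chead v) - 1)) (ctail v)).
Proof.
rewrite [LHS]/(concat_fun a b v) /concat_fun cheadE.
have /andP[t0 t1] := cube_coord_itv v ord0.
case: ifP => _; [congr (a _)|congr (b _)]; apply: cube_ext => i;
  rewrite mk_cubeE; case: (unliftP ord0 i) => [j ->|->];
  rewrite ?(ccons_coordS, ccons_coord0) ?mk_cubeE ?eqxx//= clampE.
- by apply/esym/max_idPr; rewrite le_min ler01 andbT mulr_ge0.
- by rewrite maxC; congr (Num.max _ _); apply/esym/min_idPl; lra.
Qed.

Lemma scts_concat_fun (Z : topologicalType) (g : Z -> I01 R) (f1 f2 : I01 R * Z -> X) :
  scts R g -> scts R f1 -> scts R f2 ->
  (forall z, f1 (i1 R, z) = f2 (i0 R, z)) ->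
  scts R (fun z => if I01val (g z) <= 2^-1 then f1 (clamp (2 * I01val (g z)), z)
    else f2 (clamp (2 * I01val (g z) - 1), z)).
Proof.
move=> cg c1 c2 f12; apply: paste_scts.
- exact: scts_I01val.
- apply: (scts_comp _ c1); apply: scts_pair; last exact: scts_id.
  by apply: scts_clamp; apply: sctsM; [exact: scts_cst|exact: scts_I01val].
- apply: (scts_comp _ c2); apply: scts_pair; last exact: scts_id.
  apply: scts_clamp; apply: sctsD; last exact: scts_cst.
  by apply: sctsM; [exact: scts_cst|exact: scts_I01val].
- by move=> z ->; rewrite divff ?pnatr_eq0// clamp_ge1// clamp_le0 ?subrr.
Qed.

Lemma concat_homotopic a a' b b' : gloop_homotopic a a' -> gloop_homotopic b b' ->
  gloop_homotopic (concat a b) (concat a' b').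
Proof.
move=> [H [cH H0 H1 Hb]] [K [cK K0 K1 Kb]]; apply: gloop_homotopicP.
pose f1 (z : I01 R * (I01 R * cube R n.+1)) := H (z.2.1, ccons z.1 (ctail z.2.2)).
pose f2 (z : I01 R * (I01 R * cube R n.+1)) := K (z.2.1, ccons z.1 (ctail z.2.2)).
have c12 : scts R (fun z : I01 R * (I01 R * cube R n.+1) =>
    (z.2.1, ccons z.1 (ctail z.2.2))).
  by scts_auto.
pose g (z : I01 R * cube R n.+1) := chead z.2.
exists (fun z => if I01val (g z) <= 2^-1 then f1 (clamp (2 * I01val (g z)), z)
    else f2 (clamp (2 * I01val (g z) - 1), z)); split.
- apply: scts_concat_fun.
  + by rewrite /g; scts_auto.
  + exact: (scts_comp c12 (cts_scts cH)).
  + exact: (scts_comp c12 (cts_scts cK)).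
  + move=> z; rewrite /f1 /f2 Hb ?Kb//; apply/cube_bd_ccons;
    by [constructor 1|constructor 2].
- by move=> v; rewrite concatE /f1 /f2 /g/= H0 K0.
- by move=> v; rewrite concatE /f1 /f2 /g/= H1 K1.
- move=> s v bv; rewrite -(concat_bd a b bv) -[RHS]/(concat a b v) concatE /f1/f2/g/=.
  have [h|h|h] := (cube_bd_cons v).1 bv.
  + rewrite h I01val0 invr_ge0 ler0n mulr0 clamp_le0// Hb ?gl_bd//;
    by apply/cube_bd_ccons; constructor 1.
  + rewrite h I01val1 leNgt invf_lt1 ?ltr0n// ltr1n/= clamp_ge1; last by lra.
    by rewrite Kb ?gl_bd//; apply/cube_bd_ccons; constructor 2.
  + by case: ifP => _; rewrite ?(Hb, Kb) ?gl_bd//; apply/cube_bd_ccons; constructor 3.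
Qed.

Lemma hgroup_mul_class a b : hgroup_mul (hclass a) (hclass b) = hclass (concat a b).
Proof. by apply/hgroup_eqP/concat_homotopic; exact: gloop_repr_class. Qed.

Definition lerp (s p q : I01 R) : I01 R :=
  clamp ((1 - I01val s) * I01val p + I01val s * I01val q).

Lemma lerp0 p q : lerp (i0 R) p q = p.
Proof. by rewrite /lerp I01val0 subr0 mul1r mul0r addr0 clampK. Qed.

Lemma lerp1 p q : lerp (i1 R) p q = q.
Proof. by rewrite /lerp I01val1 subrr mul1r mul0r add0r clampK. Qed.

Lemma lerp_id s p : lerp s p p = p.
Proof. by rewrite /lerp -mulrDl subrK mul1r clampK. Qed.

Definition endpoint (t : I01 R) := t = i0 R \/ t = i1 R.

(** Two reparametrizations of the first coordinate with the same end points
    are linearly homotopic.  All the group laws below are instances, since both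
    sides of each law run through the same loop at different speeds. *)
Lemma reparam_homotopic (c a b : gloop R n.+1 x) (p q : I01 R -> I01 R) :
  scts R p -> scts R q ->
  endpoint (p (i0 R)) -> endpoint (p (i1 R)) ->
  p (i0 R) = q (i0 R) -> p (i1 R) = q (i1 R) ->
  (forall v, a v = c (ccons (p (chead v)) (ctail v))) ->
  (forall v, b v = c (ccons (q (chead v)) (ctail v))) ->
  gloop_homotopic a b.
Proof.
move=> cp cq p0 p1 pq0 pq1 aE bE; apply: gloop_homotopicP.
exists (fun z => c (ccons (lerp z.1 (p (chead z.2)) (q (chead z.2))) (ctail z.2))).
split.
- have ch : scts R (fun z : I01 R * cube R n.+1 => chead z.2).
    by scts_auto.
  have chp := scts_comp ch cp; have chq := scts_comp ch cq.
  by rewrite /lerp; scts_auto; [exact: chp|exact: chq].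
- by move=> v; rewrite aE lerp0.
- by move=> v; rewrite bE lerp1.
- have ep t (u : cube R n) : endpoint t -> c (ccons t u) = x.
    by move=> et; apply: gl_bd; apply/cube_bd_ccons; case: et => ->;
      [constructor 1|constructor 2].
  move=> s v /cube_bd_cons[h|h|h]/=.
  + by rewrite h -pq0 lerp_id; exact: ep.
  + by rewrite h -pq1 lerp_id; exact: ep.
  + by apply: gl_bd; apply/cube_bd_ccons; constructor 3.
Qed.

Definition gloop_cst : gloop R n.+1 x :=
  GLoop (@cst_continuous _ _ x) (fun _ _ => erefl x).

Lemma gl_endpoint a t (u : cube R n) : endpoint t -> a (ccons t u) = x.
Proof.
by move=> et; apply: gl_bd; apply/cube_bd_ccons; case: et => ->;
  [constructor 1|constructor 2].
Qed.

Lemma concat_cst a : gloop_homotopic (concat a gloop_cst) a.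
Proof.
apply: (@reparam_homotopic a _ _ (fun t => clamp (2 * I01val t)) (fun t => t)).
- by scts_auto.
- exact: scts_id.
- by left; rewrite I01val0 mulr0 clamp_le0.
- by right; rewrite I01val1 clamp_ge1//; lra.
- by rewrite I01val0 mulr0 clamp_le0.
- by rewrite I01val1 clamp_ge1//; lra.
- move=> v; rewrite concatE; case: ifP => // /negbT; rewrite -ltNge => h.
  rewrite (_ : clamp (2 * I01val (chead v)) = i1 R);
    first by rewrite [RHS]gl_endpoint//; right.
  by apply: clamp_ge1; lra.
- by move=> v; rewrite cconsK.
Qed.

Lemma cst_concat a : gloop_homotopic (concat gloop_cst a) a.
Proof.
apply: (@reparam_homotopic a _ _ (fun t => clamp (2 * I01val t - 1)) (fun t => t)).
- by scts_auto.
- exact: scts_id.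
- by left; rewrite I01val0 mulr0 clamp_le0//; lra.
- by right; rewrite I01val1 clamp_ge1//; lra.
- by rewrite I01val0 mulr0 clamp_le0//; lra.
- by rewrite I01val1 clamp_ge1//; lra.
- move=> v; rewrite concatE; case: ifP => // h.
  rewrite (_ : clamp (2 * I01val (chead v) - 1) = i0 R);
    first by rewrite [RHS]gl_endpoint//; left.
  by apply: clamp_le0; lra.
- by move=> v; rewrite cconsK.
Qed.

Section inverse.
Variable a : gloop R n.+1 x.

Definition gloop_inv_fun (v : cube R n.+1) : X :=
  a (ccons (clamp (1 - I01val (chead v))) (ctail v)).

Lemma gloop_inv_cts : continuous gloop_inv_fun.
Proof.
apply: simplex_retract_cts (@simplex_retract_cube R n.+1) _.
by rewrite /gloop_inv_fun; scts_auto.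
Qed.

Lemma gloop_inv_bd v : cube_bd v -> gloop_inv_fun v = x.
Proof.
move=> /cube_bd_cons[h|h|h]; apply: gl_bd; apply/cube_bd_ccons.
- by constructor 2; rewrite h I01val0 subr0 clamp_ge1.
- by constructor 1; rewrite h I01val1 subrr clamp_le0.
- by constructor 3.
Qed.

Definition gloop_inv : gloop R n.+1 x := GLoop gloop_inv_cts gloop_inv_bd.

Lemma concat_inv : gloop_homotopic (concat a gloop_inv) gloop_cst.
Proof.
apply: (@reparam_homotopic a _ _
  (* out and back along [a] *)
  (fun t => clamp (Num.min (2 * I01val t) (2 - 2 * I01val t))) (fun _ => i0 R)).
- by scts_auto.
- exact: scts_cst.
- left; rewrite I01val0 mulr0 clamp_le0// ge_min lexx//.
- by left; rewrite I01val1 mulr1 subrr clamp_le0// ge_min lexx orbT.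
- by rewrite I01val0 mulr0 clamp_le0// ge_min lexx.
- by rewrite I01val1 mulr1 subrr clamp_le0// ge_min lexx orbT.
- move=> v; rewrite concatE; have /andP[t0 t1] := I01val_itv (chead v).
  case: ifP => [h|/negbT]; first by congr (a (ccons (clamp _) _));
    apply/esym/min_idPl; lra.
  rewrite -ltNge => h; rewrite [LHS]/(gloop_inv_fun _) /gloop_inv_fun.
  rewrite ccons_head ccons_tail clamp_itv; last by apply/andP; split; lra.
  congr (a (ccons (clamp _) _)); rewrite (min_idPr _); lra.
- by move=> v; rewrite [RHS]gl_endpoint//; left.
Qed.

Lemma inv_concat : gloop_homotopic (concat gloop_inv a) gloop_cst.
Proof.
apply: (@reparam_homotopic a _ _
  (fun t => clamp (Num.max (1 - 2 * I01val t) (2 * I01val t - 1))) (fun _ => i1 R)).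
- by scts_auto.
- exact: scts_cst.
- right; rewrite I01val0 mulr0 clamp_ge1// le_max subr0 lexx//.
- by right; rewrite I01val1 mulr1 clamp_ge1// le_max; apply/orP; right; lra.
- by rewrite I01val0 mulr0 clamp_ge1// le_max subr0 lexx.
- by rewrite I01val1 mulr1 clamp_ge1// le_max; apply/orP; right; lra.
- move=> v; rewrite concatE; have /andP[t0 t1] := I01val_itv (chead v).
  case: ifP => [h|/negbT].
    rewrite [LHS]/(gloop_inv_fun _) /gloop_inv_fun.
    rewrite ccons_head ccons_tail clamp_itv; last by apply/andP; split; lra.
    by congr (a (ccons (clamp _) _)); rewrite (max_idPl _)//; lra.
  rewrite -ltNge => h; congr (a (ccons (clamp _) _)).
  by rewrite (max_idPr _)//; lra.
- by move=> v; rewrite [RHS]gl_endpoint//; right.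
Qed.

End inverse.

Lemma concatA a b c :
  gloop_homotopic (concat (concat a b) c) (concat a (concat b c)).
Proof.
(* The change of speed has slopes 2, 1, 1/2 on [0, 1/4], [1/4, 1/2], [1/2, 1];
   being concave it is the minimum of its three affine pieces. *)
pose p (t : I01 R) := clamp (Num.min (2 * I01val t)
  (Num.min (I01val t + 4^-1) ((I01val t + 1) / 2))).
have p0 : p (i0 R) = i0 R by rewrite /p I01val0 mulr0 clamp_le0// ge_min lexx.
have p1 : p (i1 R) = i1 R.
  by rewrite /p I01val1 clamp_ge1// !le_min; apply/and3P; split; lra.
apply: (@reparam_homotopic (concat a (concat b c)) _ _ p (fun t => t)) => //.
- by rewrite /p; scts_auto.
- by rewrite p0; left.
- by rewrite p1; right.
2: by move=> v; rewrite cconsK.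
move=> v; set t := chead v; set u := ctail v.
have /andP[t0 t1] := I01val_itv t.
have pv (r : R) : Num.min (2 * I01val t)
    (Num.min (I01val t + 4^-1) ((I01val t + 1) / 2)) = r -> 0 <= r <= 1 ->
    I01val (p t) = r.
  by move=> E r01; rewrite /p E clamp_itv.
rewrite concatE -/t -/u [RHS]concatE ccons_head ccons_tail.
case: ifP => [h|/negbT].
  have h2 : I01val (clamp (2 * I01val t)) = 2 * I01val t.
    by rewrite clamp_itv//; apply/andP; split; lra.
  rewrite concatE ccons_head ccons_tail h2; case: ifP => [h4|/negbT].
    have pE : I01val (p t) = 2 * I01val t.
      apply: pv; last by apply/andP; split; lra.
      by apply/min_idPl; rewrite le_min; apply/andP; split; lra.
    by rewrite pE h4.
  rewrite -ltNge => h4.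
  have pE : I01val (p t) = I01val t + 4^-1.
    apply: pv; last by apply/andP; split; lra.
    have h5 : I01val t + 4^-1 <= (I01val t + 1) / 2 by lra.
    by rewrite (min_idPl h5); apply/min_idPr; lra.
  rewrite pE ifF; last by apply/negbTE; rewrite -ltNge; lra.
  rewrite concatE ccons_head ccons_tail.
  rewrite (@clamp_itv _ (2 * (I01val t + 4^-1) - 1)); last by apply/andP; split; lra.
  rewrite ifT; last by lra.
  by congr (b (ccons (clamp _) _)); lra.
rewrite -ltNge => h.
have pE : I01val (p t) = (I01val t + 1) / 2.
  apply: pv; last by apply/andP; split; lra.
  have h5 : (I01val t + 1) / 2 <= I01val t + 4^-1 by lra.
  by rewrite (min_idPr h5); apply/min_idPr; lra.
rewrite pE ifF; last by apply/negbTE; rewrite -ltNge; lra.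
rewrite concatE ccons_head ccons_tail.
rewrite (@clamp_itv _ (2 * ((I01val t + 1) / 2) - 1)); last by apply/andP; split; lra.
rewrite ifF; last by apply/negbTE; rewrite -ltNge; lra.
by congr (c (ccons (clamp _) _)); lra.
Qed.

Local Notation "p ** q" := (hgroup_mul p q) (at level 40).

Lemma hgroup_mulA (p q r : hgroup R n.+1 x) : p ** (q ** r) = (p ** q) ** r.
Proof.
elim/hgroup_ind: p => a; elim/hgroup_ind: q => b; elim/hgroup_ind: r => c.
by rewrite !hgroup_mul_class; apply/esym/hgroup_eqP; exact: concatA.
Qed.

Lemma hgroup_mul1 (p : hgroup R n.+1 x) : p ** point = p.
Proof.
by elim/hgroup_ind: p => a; rewrite [LHS]hgroup_mul_class; apply/hgroup_eqP/concat_cst.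
Qed.

Lemma hgroup_1mul (p : hgroup R n.+1 x) : point ** p = p.
Proof.
by elim/hgroup_ind: p => a; rewrite [LHS]hgroup_mul_class; apply/hgroup_eqP/cst_concat.
Qed.

Definition hgroup_inv (p : hgroup R n.+1 x) : hgroup R n.+1 x :=
  hclass (gloop_inv (repr p)).

Lemma hgroup_mulV (p : hgroup R n.+1 x) : p ** hgroup_inv p = point.
Proof.
rewrite -{1}(class_of_repr p) [LHS]hgroup_mul_class.
by apply/hgroup_eqP; exact: concat_inv.
Qed.

Lemma hgroup_mulVg (p : hgroup R n.+1 x) : hgroup_inv p ** p = point.
Proof.
rewrite -{2}(class_of_repr p) [LHS]hgroup_mul_class.
by apply/hgroup_eqP; exact: inv_concat.
Qed.

End product.

Lemma hgroup_map_mul n (X Y : topologicalType) (f : X -> Y) (cf : continuous f)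
    (x : X) (y : Y) (fx : f x = y) (p q : hgroup R n.+1 x) :
  hgroup_map cf fx (hgroup_mul p q) =
  hgroup_mul (hgroup_map cf fx p) (hgroup_map cf fx q).
Proof.
elim/hgroup_ind: p => a; elim/hgroup_ind: q => b.
rewrite hgroup_mul_class !hgroup_map_class hgroup_mul_class.
apply/hgroup_eqP; apply: gloop_homotopic_eq => v.
by rewrite [LHS]/= /concat_fun [RHS]/= /concat_fun; case: ifP.
Qed.

End gloops.

Section pi.
Variable R : realType.

Lemma pi_map_class n (X Y : ptopologicalType) (f : pointed_map X Y)
    (a : gloop R n (point : X)) :
  pi_map f (hclass a) = hclass (gloop_map (@pmap_cts _ _ f) (pmap_pt f) a).
Proof. exact: hgroup_map_class. Qed.

Lemma pi_map_id n (X : ptopologicalType) (p : pi_n R n X) :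
  pi_map (pmap_id X) p = p.
Proof.
elim/hgroup_ind: p => a; rewrite pi_map_class; apply/hgroup_eqP.
exact: gloop_homotopic_eq.
Qed.

Lemma pi_map_comp n (X Y Z : ptopologicalType) (g : pointed_map Y Z)
    (f : pointed_map X Y) (p : pi_n R n X) :
  pi_map (pmap_comp g f) p = pi_map g (pi_map f p).
Proof.
elim/hgroup_ind: p => a; rewrite !pi_map_class; apply/hgroup_eqP.
exact: gloop_homotopic_eq.
Qed.

Lemma pi_map_homotopic n (X Y : ptopologicalType) (f g : pointed_map X Y)
    (p : pi_n R n X) :
  phomotopic R f g -> pi_map f p = pi_map g p.
Proof.
move=> [H [H0 H1]]; elim/hgroup_ind: p => a; rewrite !pi_map_class.
apply/hgroup_eqP; apply: gloop_homotopicP; exists (fun z => H (z.1, a z.2)); split.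
- by scts_auto.
- by move=> t; rewrite H0.
- by move=> t; rewrite H1.
- by move=> s t bt; rewrite (gl_bd a bt) ph_pt.
Qed.

Lemma pi_map_point n (X Y : ptopologicalType) (f : pointed_map X Y) :
  pi_map f (point : pi_n R n X) = point.
Proof.
rewrite [LHS]pi_map_class; apply/hgroup_eqP; apply: gloop_homotopic_eq => t.
exact: pmap_pt.
Qed.

Lemma pi_map_mul n (X Y : ptopologicalType) (f : pointed_map X Y)
    (p q : pi_n R n.+1 X) :
  pi_map f (hgroup_mul p q) = hgroup_mul (pi_map f p) (pi_map f q).
Proof. exact: hgroup_map_mul. Qed.

End pi.
(** * Homotopy fibers and loops *)

Section hfiber_maps.
Variable R : realType.

Lemma I01_locally_compact : locally_compact [set: I01 R].
Proof.
move=> t _; exists setT; first by rewrite withinET; exact: filterT.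
split; last exact: closedT.
by apply: set_type_compact; exact: segment_compact.
Qed.

Lemma I01_regular : regular_space (I01 R).
Proof. exact: uniform_regular. Qed.

Lemma inj_surj_bijective (A B : Type) (h : A -> B) :
  injective h -> (forall y, exists x, h x = y) -> bijective h.
Proof.
move=> hi hs; exists (fun y => projT1 (cid (hs y))) => [x|y].
  by apply: hi; exact: (projT2 (cid (hs (h x)))).
exact: (projT2 (cid (hs y))).
Qed.

(** The target is based at [g point], equal but not convertible to [point]. *)
Lemma weak_equiv_pi (Z W : ptopologicalType) (g : pointed_map Z W) n :
  weak_equiv R g -> bijective (@pi_map R n Z W g).
Proof.
move=> /(_ n point) gb.
have E : forall (w : W) (gw : g point = w),
    bijective (@hgroup_map R n Z W g (@pmap_cts _ _ g) point w gw).
  by move=> w; case: w /.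
exact: E.
Qed.

Lemma pi_map_cst n (X Y : ptopologicalType) (p : pi_n R n X) :
  pi_map (pmap_cst X Y) p = point.
Proof.
elim/hgroup_ind: p => a; rewrite pi_map_class.
by apply/hgroup_eqP; exact: gloop_homotopic_eq.
Qed.

Lemma homotopy_equiv_pi (X Y : ptopologicalType) (e : pointed_map X Y) n :
  homotopy_equiv R e -> bijective (@pi_map R n X Y e).
Proof.
move=> [e' [e'e ee']]; exists (pi_map e') => p; rewrite -pi_map_comp.
  by rewrite (pi_map_homotopic _ e'e) pi_map_id.
by rewrite (pi_map_homotopic _ ee') pi_map_id.
Qed.

Section hfiber.
Variables (P Q : ptopologicalType) (f : pointed_map P Q).

Lemma hfiber_path0 (e : hfiber R f) :
  path_fun (hfiber_path e) (i0 R) = f (hfiber_fst e).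
Proof. exact/esym/(set_valP (set_val e)). Qed.

Lemma hfiber_path1 (e : hfiber R f) : path_fun (hfiber_path e) (i1 R) = point.
Proof. exact: (set_valP e). Qed.

Lemma hfiber_eq (e e' : hfiber R f) : hfiber_fst e = hfiber_fst e' ->
  path_fun (hfiber_path e) =1 path_fun (hfiber_path e') -> e = e'.
Proof. by move=> h1 h2; apply: hfiber_ext => //; apply/continuousEP => t; exact: h2. Qed.

Lemma hfiber_val_cts :
  continuous (fun e : hfiber R f => set_val (set_val e) : P * paths R Q).
Proof.
have c1 : continuous (fun e : hfiber R f => set_val e : mapping_path R f).
  exact: set_val_continuous.
have c2 : continuous (fun e : mapping_path R f => set_val e : P * paths R Q).
  exact: set_val_continuous.
exact: (cts_comp c1 c2).
Qed.

Lemma hfiber_fst_cts : continuous (@hfiber_fst R P Q f).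
Proof.
exact: (cts_comp hfiber_val_cts (@cts_fst P (paths R Q))).
Qed.

Definition hfiber_proj : pointed_map (hfiber R f) P :=
  @PointedMap (hfiber R f) P (@hfiber_fst R P Q f) hfiber_fst_cts erefl.

Lemma hfiber_path_cts : continuous (@hfiber_path R P Q f).
Proof.
exact: (cts_comp hfiber_val_cts (@cts_snd P (paths R Q))).
Qed.

Lemma hfiber_eval_cts :
  continuous (fun z : hfiber R f * I01 R => path_fun (hfiber_path z.1) z.2).
Proof.
have c := cts_comp hfiber_path_cts (@initial_continuous _ _ (@path_fun R Q)).
have cu := continuous_uncurry_regular I01_locally_compact I01_regular c
  (fun e => @cts_fun _ _ (hfiber_path e : continuousType (I01 R) Q)).
suff -> : (fun z : hfiber R f * I01 R => path_fun (hfiber_path z.1) z.2) =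
  uncurry (@path_fun R Q \o @hfiber_path R P Q f) by exact: cu.
by apply/funext => -[].
Qed.

Lemma scts_hfiber_eval (Z : topologicalType) (e : Z -> hfiber R f) (t : Z -> I01 R) :
  scts R e -> scts R t -> scts R (fun z => path_fun (hfiber_path (e z)) (t z)).
Proof.
by move=> ce ct; exact: (scts_comp (scts_pair ce ct) (cts_scts hfiber_eval_cts)).
Qed.

Section to_hfiber.
Variables (K : topologicalType) (x : K -> P) (l : I01 R * K -> Q).
Hypotheses (cx : continuous x) (cl : continuous l).
Hypotheses (l0 : forall k, f (x k) = l (i0 R, k)).
Hypotheses (l1 : forall k, l (i1 R, k) = point).

Lemma to_hfiber_slice k : continuous (fun t => l (t, k)).
Proof.
exact: (cts_comp (cts_pair (fun t => @cvg_id _ (nbhs t)) (@cst_continuous _ _ k)) cl).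
Qed.

Definition to_hfiber (k : K) : hfiber R f :=
  @mk_hfiber R P Q f (x k) (mk_paths (@to_hfiber_slice k)) (l0 k) (l1 k).

Lemma to_hfiber_cts : continuous to_hfiber.
Proof.
apply: to_set_type_continuous; apply: to_set_type_continuous.
apply: (@cts_pair _ _ _ x (fun k => mk_paths (@to_hfiber_slice k))) => //.
apply: (@continuous_comp_initial _ _ _ (@path_fun R Q)).
have cs : continuous (fun p : K * I01 R => l (p.2, p.1)).
  exact: (cts_comp (cts_pair (@cts_snd _ _) (@cts_fst _ _)) cl).
exact: (continuous_curry_fun cs).
Qed.

End to_hfiber.

End hfiber.

Section fibration.
Variables (B : ngType R) (P Q : ptopologicalType).
Variables (i : pointed_map B P) (f : pointed_map P Q) (H : phomotopy R B Q).
Hypothesis H_null : null_homotopy (pmap_comp f i) H.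
Let g := fibration_map H_null.
Hypothesis g_bij : forall n, bijective (@pi_map R n B (hfiber R f) g).

(** A null homotopy of [f o a] is exactly a lift of [a] to the homotopy fiber,
    and the fiber has the homotopy groups of [B]. *)
Lemma fibration_exact n (p : pi_n R n P) :
  pi_map f p = point <-> exists b, pi_map i b = p.
Proof.
split=> [|[b <-]]; last first.
  rewrite -pi_map_comp -(pi_map_cst Q b); apply: pi_map_homotopic.
  by exists H; exact: H_null.
elim/hgroup_ind: p => a; rewrite pi_map_class => /hgroup_eqP[G [cG G0 G1 Gb]].
have G0' u : f (a u) = G (i0 R, u) by rewrite G0.
pose e := to_hfiber (x := a) cG G0' G1.
have e_bd u : cube_bd u -> e u = point.
  move=> bu; apply: hfiber_eq; first exact: (gl_bd a bu).
  by move=> t; exact: Gb.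
have ce : continuous e by apply: to_hfiber_cts; exact: gl_cts.
pose ge := GLoop ce e_bd.
have [h _ hK] := g_bij n; exists (h (hclass ge)).
have -> : i = pmap_comp (hfiber_proj f) g by exact: pmap_ext.
rewrite pi_map_comp hK pi_map_class.
by apply/hgroup_eqP; exact: gloop_homotopic_eq.
Qed.

End fibration.

Section loops.
Variables (B S : ptopologicalType) (M : phomotopy R B S).
Hypotheses (M0 : forall b, M (i0 R, b) = point) (M1 : forall b, M (i1 R, b) = point).
Variable n : nat.

Section gloop_loop.
Variable a : gloop R n (point : B).

Definition gloop_loop_fun (v : cube R n.+1) : S := M (chead v, a (ctail v)).

Lemma gloop_loop_cts : continuous gloop_loop_fun.
Proof.
apply: simplex_retract_cts (@simplex_retract_cube R n.+1) _.
by rewrite /gloop_loop_fun; scts_auto.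
Qed.

Lemma gloop_loop_bd v : cube_bd v -> gloop_loop_fun v = point.
Proof.
rewrite /gloop_loop_fun => /cube_bd_cons[->|->|h]; rewrite ?M0 ?M1//.
by rewrite (gl_bd a h) ph_pt.
Qed.

Definition gloop_loop : gloop R n.+1 (point : S) := GLoop gloop_loop_cts gloop_loop_bd.

End gloop_loop.

(** The map B -> Loops S adjoint to a homotopy between constant maps. *)
Definition pi_loop (p : pi_n R n B) : pi_n R n.+1 S := hclass (gloop_loop (repr p)).

Lemma pi_loop_class a : pi_loop (hclass a) = hclass (gloop_loop a).
Proof.
apply/hgroup_eqP; have [G [cG G0 G1 Gb]] := gloop_repr_class a.
apply: gloop_homotopicP.
exists (fun z => M (chead z.2, G (z.1, ctail z.2))); split.
- have c : scts R (fun z : I01 R * cube R n.+1 => G (z.1, ctail z.2)).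
    by apply: (scts_comp _ (cts_scts cG)); scts_auto.
  by apply: scts_ph => //; scts_auto.
- by move=> v; rewrite /= G0.
- by move=> v; rewrite /= G1.
- move=> s v /cube_bd_cons[h|h|h].
  + by rewrite [chead _]h M0.
  + by rewrite [chead _]h M1.
  + by rewrite Gb// ph_pt.
Qed.

End loops.

Section fiber_loops.
Variables (P Q S : ptopologicalType) (f : pointed_map P Q) (c : pointed_map Q S).
Hypothesis cf : forall x, c (f x) = point.
Variable n : nat.

Section fiber_loop.
Variable e : gloop R n (point : hfiber R f).

(** As [c o f] is constant, [c] turns the path of a point of the homotopy fiber
    into a loop; [fiber_loop_inj] and [fiber_loop_lift] say that this map from
    the fiber to the loops of [S] is bijective on homotopy groups when [P] is
    contractible and [c] a homotopy equivalence. *)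
Definition fiber_loop_fun (v : cube R n.+1) : S :=
  c (path_fun (hfiber_path (e (ctail v))) (chead v)).

Lemma fiber_loop_cts : continuous fiber_loop_fun.
Proof.
apply: simplex_retract_cts (@simplex_retract_cube R n.+1) _.
by rewrite /fiber_loop_fun; apply: scts_pmap; apply: scts_hfiber_eval; scts_auto.
Qed.

Lemma fiber_loop_bd v : cube_bd v -> fiber_loop_fun v = point.
Proof.
rewrite /fiber_loop_fun => /cube_bd_cons[->|->|h].
- by rewrite hfiber_path0 cf.
- by rewrite hfiber_path1 pmap_pt.
- by rewrite (gl_bd e h) (pmap_pt c).
Qed.

Definition fiber_loop : gloop R n.+1 (point : S) := GLoop fiber_loop_cts fiber_loop_bd.

End fiber_loop.

Lemma fiber_loop_homotopic (e e' : gloop R n (point : hfiber R f)) :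
  gloop_homotopic e e' -> gloop_homotopic (fiber_loop e) (fiber_loop e').
Proof.
move=> [G [cG G0 G1 Gb]]; apply: gloop_homotopicP.
exists (fun z => c (path_fun (hfiber_path (G (z.1, ctail z.2))) (chead z.2))); split.
- apply: scts_pmap; apply: scts_hfiber_eval; last by scts_auto.
  by apply: (scts_comp _ (cts_scts cG)); scts_auto.
- by move=> v; rewrite /= G0.
- by move=> v; rewrite /= G1.
- move=> s v /cube_bd_cons[h|h|h].
  + by rewrite [chead _]h hfiber_path0 cf.
  + by rewrite [chead _]h hfiber_path1 pmap_pt.
  + by rewrite Gb// (pmap_pt c).
Qed.

Section lift_loop.
Variable w : gloop R n.+1 (point : Q).

Lemma lift_loop_path_cts : continuous (fun z : I01 R * cube R n => w (ccons z.1 z.2)).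
Proof. exact: (cts_comp (@ccons_continuous R n) (@gl_cts _ _ _ _ w)). Qed.

Lemma lift_loop0 u : f point = w (ccons (i0 R) u).
Proof. by rewrite pmap_pt gl_endpoint//; left. Qed.

Lemma lift_loop1 u : w (ccons (i1 R) u) = point.
Proof. by rewrite gl_endpoint//; right. Qed.

Definition lift_loop_fun : cube R n -> hfiber R f :=
  to_hfiber (x := fun=> point) lift_loop_path_cts lift_loop0 lift_loop1.

Lemma lift_loop_cts : continuous lift_loop_fun.
Proof. by apply: to_hfiber_cts; exact: cst_continuous. Qed.

Lemma lift_loop_bd u : cube_bd u -> lift_loop_fun u = point.
Proof.
move=> bu; apply: hfiber_eq => // t.
by apply: (gl_bd w); apply/cube_bd_ccons; constructor 3.
Qed.

Definition lift_loop : gloop R n (point : hfiber R f) :=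
  GLoop lift_loop_cts lift_loop_bd.

End lift_loop.

Lemma lift_loop_homotopic (w w' : gloop R n.+1 (point : Q)) :
  gloop_homotopic w w' -> gloop_homotopic (lift_loop w) (lift_loop w').
Proof.
move=> [G [cG G0 G1 Gb]].
pose l (z : I01 R * (I01 R * cube R n)) := G (z.2.1, ccons z.1 z.2.2).
have cl : continuous l.
  apply: simplex_retract_cts.
    apply: simplex_retract_prod (@simplex_retract_I01_cube R n).
    exact: simplex_retract_I01.
  by apply: (scts_comp _ (cts_scts cG)); scts_auto.
have l0 k : f point = l (i0 R, k).
  by rewrite /l Gb ?pmap_pt//; apply/cube_bd_ccons; constructor 1.
have l1 k : l (i1 R, k) = point.
  by rewrite /l Gb//; apply/cube_bd_ccons; constructor 2.
exists (to_hfiber (x := fun=> point) cl l0 l1); split.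
- by apply: to_hfiber_cts; exact: cst_continuous.
- by move=> u; apply: hfiber_eq => // t; exact: G0.
- by move=> u; apply: hfiber_eq => // t; exact: G1.
- move=> s u bu; apply: hfiber_eq => // t.
  by apply: Gb; apply/cube_bd_ccons; constructor 3.
Qed.

Lemma fiber_loop_lift (w : gloop R n.+1 (point : Q)) :
  fiber_loop (lift_loop w) =1 gloop_map (@pmap_cts _ _ c) (pmap_pt c) w.
Proof. by move=> v; rewrite /= -[in RHS](cconsK v). Qed.

Section straighten.
Variable K : phomotopy R P P.
Hypotheses (K0 : forall x, K (i0 R, x) = x) (K1 : forall x, K (i1 R, x) = point).
Variable e : gloop R n (point : hfiber R f).

(** Moves a point [(x, l)] of the homotopy fiber to one over the base point: at
    stage [s] the point [x] has moved to [K (s, x)], and the path retraces the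
    image of this motion before following [l].  The stages are those of [tau]
    and [rho]. *)
Definition straighten (s t : I01 R) (u : cube R n) : Q :=
  if I01val t - I01val s / 2 <= 0 then f (K (rho s t, hfiber_fst (e u)))
  else path_fun (hfiber_path (e u)) (tau s t).

Lemma straighten_scts :
  scts R (fun z : I01 R * (I01 R * cube R n) => straighten z.2.1 z.1 z.2.2).
Proof.
apply: (@paste_scts _ _ _ (fun z : I01 R * (I01 R * cube R n) =>
  I01val z.1 - I01val z.2.1 / 2)); first by scts_auto.
- apply: scts_pmap; apply: scts_ph; first by rewrite /rho; scts_auto.
  have c1 : scts R (fun z : I01 R * (I01 R * cube R n) => e z.2.2) by scts_auto.
  exact: (scts_comp c1 (cts_scts (@hfiber_fst_cts P Q f))).
- by apply: scts_hfiber_eval; rewrite /tau; scts_auto.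
by move=> z h; rewrite rho_ge ?h// tau_le ?h// K0 hfiber_path0.
Qed.

Lemma straighten0 s u : f (K (s, hfiber_fst (e u))) = straighten s (i0 R) u.
Proof.
have /andP[s0 _] := I01val_itv s.
by rewrite /straighten rho0 I01val0 ifT//; lra.
Qed.

Lemma straighten1 s u : straighten s (i1 R) u = point.
Proof.
have /andP[_ s1] := I01val_itv s.
rewrite /straighten tau1 I01val1 ifF; last by apply/negbTE; rewrite -ltNge; lra.
exact: hfiber_path1.
Qed.

Lemma straighten_bd s t u : cube_bd u -> straighten s t u = point.
Proof.
move=> bu; rewrite /straighten (gl_bd e bu); case: ifP => // _.
by rewrite -(pmap_pt f); congr (f _); exact: ph_pt.
Qed.

Definition straight_loop_fun (v : cube R n.+1) : Q :=
  straighten (i1 R) (chead v) (ctail v).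

Lemma straight_loop_cts : continuous straight_loop_fun.
Proof.
apply: simplex_retract_cts (@simplex_retract_cube R n.+1) _.
pose k (v : cube R n.+1) := (chead v, (i1 R, ctail v)).
have ck : scts R k by rewrite /k; scts_auto.
exact: (scts_comp ck straighten_scts).
Qed.

Lemma straight_loop_bd v : cube_bd v -> straight_loop_fun v = point.
Proof.
rewrite /straight_loop_fun => /cube_bd_cons[->|->|h].
- by rewrite -straighten0 K1 pmap_pt.
- exact: straighten1.
- exact: straighten_bd.
Qed.

Definition straight_loop : gloop R n.+1 (point : Q) :=
  GLoop straight_loop_cts straight_loop_bd.

Lemma straight_loop_homotopic : gloop_homotopic e (lift_loop straight_loop).
Proof.
have cx : continuous (fun z : I01 R * cube R n => K (z.1, hfiber_fst (e z.2))).
  apply: simplex_retract_cts (@simplex_retract_I01_cube R n) _.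
  apply: scts_ph; first by scts_auto.
  have c1 : scts R (fun z : I01 R * cube R n => e z.2) by scts_auto.
  exact: (scts_comp c1 (cts_scts (@hfiber_fst_cts P Q f))).
have cl : continuous (fun z : I01 R * (I01 R * cube R n) => straighten z.2.1 z.1 z.2.2).
  apply: simplex_retract_cts straighten_scts.
  apply: simplex_retract_prod (@simplex_retract_I01_cube R n).
  exact: simplex_retract_I01.
exists (to_hfiber (x := fun z => K (z.1, hfiber_fst (e z.2))) cl
  (fun k => straighten0 k.1 k.2) (fun k => straighten1 k.1 k.2)).
split.
- exact: to_hfiber_cts.
- move=> u; apply: hfiber_eq; first exact: K0.
  move=> t; rewrite -[LHS]/(straighten (i0 R) t u) /straighten.
  rewrite I01val0 mul0r subr0 tau0; case: ifP => // t0'.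
  have /andP[t0 _] := I01val_itv t.
  have -> : t = i0 R by apply: I01_ext; apply/eqP; rewrite eq_le t0 t0'.
  by rewrite rho0 K0 hfiber_path0.
- move=> u; apply: hfiber_eq; first exact: K1.
  move=> t; rewrite -[LHS]/(straighten (i1 R) t u).
  by rewrite -[RHS]/(straight_loop_fun (ccons t u)) /straight_loop_fun
    ccons_head ccons_tail.
- move=> s u bu; apply: hfiber_eq.
    by rewrite -[LHS]/(K (s, hfiber_fst (e u))) (gl_bd e bu); exact: (ph_pt K s).
  by move=> t; exact: straighten_bd.
Qed.

End straighten.

(** After straightening, a loop in the fiber is a loop in [Q] of one dimension
    more, where [c] is injective on homotopy classes. *)
Lemma fiber_loop_inj (e0 e1 : gloop R n (point : hfiber R f)) :
  phomotopic R (pmap_id P) (pmap_cst P P) -> homotopy_equiv R c ->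
  gloop_homotopic (fiber_loop e0) (fiber_loop e1) -> gloop_homotopic e0 e1.
Proof.
move=> [K [K0 K1]] hc e01.
have s0 := straight_loop_homotopic K0 K1 e0.
have s1 := straight_loop_homotopic K0 K1 e1.
apply: (gloop_homotopic_trans s0); apply: gloop_homotopic_trans (gloop_homotopic_sym s1).
apply: lift_loop_homotopic; apply/hgroup_eqP.
apply: (bij_inj (homotopy_equiv_pi n.+1 hc)).
rewrite !pi_map_class; apply/hgroup_eqP.
apply: gloop_homotopic_trans (gloop_homotopic_eq (fiber_loop_lift _)).
apply: (gloop_homotopic_trans (gloop_homotopic_sym
  (gloop_homotopic_eq (fiber_loop_lift _)))).
apply: gloop_homotopic_trans (fiber_loop_homotopic s1).
by apply: gloop_homotopic_trans e01; exact/gloop_homotopic_sym/fiber_loop_homotopic.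
Qed.

End fiber_loops.

(** The loop map of [M] is the comparison of [B] with the homotopy fiber
    followed by [fiber_loop]. *)
Lemma pi_loop_bijective (B : ngType R) (P Q S : ptopologicalType)
    (i : pointed_map B P) (f : pointed_map P Q) (H : phomotopy R B Q)
    (H_null : null_homotopy (pmap_comp f i) H) (c : pointed_map Q S)
    (M : phomotopy R B S) (M0 : forall b, M (i0 R, b) = point)
    (M1 : forall b, M (i1 R, b) = point) n :
  hfibration_seq H_null -> phomotopic R (pmap_id P) (pmap_cst P P) ->
  homotopy_equiv R c -> (forall x, c (f x) = point) ->
  (forall t b, M (t, b) = c (H (t, b))) ->
  bijective (@pi_loop B S M M0 M1 n).
Proof.
move=> wH PK hc cf ME; have gb := weak_equiv_pi n wH.
have ML (b : gloop R n (point : B)) : gloop_loop M0 M1 b =1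
    fiber_loop cf (gloop_map (@pmap_cts _ _ (fibration_map H_null))
      (pmap_pt (fibration_map H_null)) b).
  by move=> v; exact: ME.
apply: inj_surj_bijective.
  move=> p q; elim/hgroup_ind: p => a; elim/hgroup_ind: q => b.
  rewrite !pi_loop_class => /hgroup_eqP ab.
  apply: (bij_inj gb); rewrite !pi_map_class; apply/hgroup_eqP.
  apply: (fiber_loop_inj (cf := cf) PK hc).
  apply: gloop_homotopic_trans (gloop_homotopic_eq (ML b)).
  by apply: gloop_homotopic_trans ab; exact/gloop_homotopic_sym/gloop_homotopic_eq.
elim/hgroup_ind => w; have [c' [_ cc']] := hc.
pose w' := gloop_map (@pmap_cts _ _ c') (pmap_pt c') w.
have [h _ hK] := gb; exists (h (hclass (lift_loop f w'))).
have := hK (hclass (lift_loop f w')).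
elim/hgroup_ind: (h _) => a; rewrite pi_map_class => /hgroup_eqP aw.
have E : pi_map c (pi_map c' (hclass w)) = hclass w.
  by rewrite -pi_map_comp (pi_map_homotopic _ cc') pi_map_id.
rewrite -{}E pi_loop_class !pi_map_class; apply/hgroup_eqP.
apply: gloop_homotopic_trans (gloop_homotopic_eq (fiber_loop_lift cf _)).
apply: (gloop_homotopic_trans (gloop_homotopic_eq (ML a))).
exact: fiber_loop_homotopic.
Qed.

End hfiber_maps.
(** * Homotopy groups of linear functors *)

Section linear_functors.
Variables (R : realType) (C : ngType R -> Prop) (T : enriched_functor C).

Lemma pf_map_phomotopic (X Y : obj C) (f g : pointed_map X Y) :
  phomotopic R f g -> phomotopic R (pf_map T f) (pf_map T g).
Proof.
move=> [H [H0 H1]]; exists (ef_homotopy T H); split=> u.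
  rewrite [LHS]/(pf_map T (ph_at H (i0 R)) u); congr (pf_map T _ u).
  exact: pmap_ext.
rewrite [LHS]/(pf_map T (ph_at H (i1 R)) u); congr (pf_map T _ u).
exact: pmap_ext.
Qed.

Lemma Tpi_map_id n (X : obj C) (p : Tpi T n X) : Tpi_map (pmap_id X) p = p.
Proof. by rewrite /Tpi_map pf_id; exact: pi_map_id. Qed.

Lemma Tpi_map_comp n (X Y Z : obj C) (g : pointed_map Y Z) (f : pointed_map X Y)
    (p : Tpi T n X) :
  Tpi_map (pmap_comp g f) p = Tpi_map g (Tpi_map f p).
Proof. by rewrite /Tpi_map pf_comp; exact: pi_map_comp. Qed.

Lemma Tpi_map_homotopic n (X Y : obj C) (f g : pointed_map X Y) (p : Tpi T n X) :
  phomotopic R f g -> Tpi_map f p = Tpi_map g p.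
Proof. by move=> /pf_map_phomotopic; exact: pi_map_homotopic. Qed.

Lemma Tpi_map_point n (X Y : obj C) (f : pointed_map X Y) :
  Tpi_map f (point : Tpi T n X) = point.
Proof. exact: pi_map_point. Qed.

Lemma Tpi_map_cst n (X Y : obj C) (f : pointed_map X Y) (p : Tpi T n X) :
  (forall x, f x = point) -> Tpi_map f p = point.
Proof.
move=> f0; rewrite /Tpi_map (_ : pf_map T f = pmap_cst (T X) (T Y)).
  exact: pi_map_cst.
by apply: pmap_ext => u; exact: ef_pcst.
Qed.

Lemma Tpi_map_mul n (X Y : obj C) (f : pointed_map X Y) (p q : Tpi T n.+1 X) :
  Tpi_map f (hgroup_mul p q : Tpi T n.+1 X) =
  hgroup_mul (Tpi_map f p) (Tpi_map f q) :> Tpi T n.+1 Y.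
Proof. exact: pi_map_mul. Qed.

Lemma Tpi_map_equiv n (X Y : obj C) (e : pointed_map X Y) :
  homotopy_equiv R e -> bijective (@Tpi_map R C T n X Y e).
Proof.
move=> [e' [e'e ee']]; exists (Tpi_map (e' : pointed_map Y X)) => p.
  by rewrite -Tpi_map_comp (Tpi_map_homotopic _ e'e) Tpi_map_id.
by rewrite -Tpi_map_comp (Tpi_map_homotopic _ ee') Tpi_map_id.
Qed.

Variables (hC : admissible C) (hT : linear_functor hC T).

Lemma Tpi_exact_cofiber n (A X : obj C) (i : pointed_map A X) (ei : embedding i)
    (p : Tpi T n X) :
  Tpi_map (cofiber_in i : pointed_map X (cofiber_obj hC ei)) p = point <->
  exists a, Tpi_map i a = p.
Proof.
have gb m := weak_equiv_pi m (hT ei).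
exact: (fibration_exact gb p).
Qed.

Lemma Tpi_exact n (A X Y : obj C) (f : pointed_map A X) (g : pointed_map X Y)
    (p : Tpi T n X) :
  coexact hC f g ->
  Tpi_map g p = point <-> exists a, Tpi_map f a = p.
Proof.
move=> [A' [X' [i [ei [a [x [y [ha hx hy fa gx]]]]]]]].
have [x' _ xK] := Tpi_map_equiv n hx; have [a' _ aK] := Tpi_map_equiv n ha.
split=> [|[q <-]]; last first.
  rewrite -(aK q) -(Tpi_map_comp f) (Tpi_map_homotopic _ fa) Tpi_map_comp.
  rewrite -(Tpi_map_comp g) (Tpi_map_homotopic _ gx) (Tpi_map_comp y).
  have [_ ->] := Tpi_exact_cofiber ei (Tpi_map i (a' q)).
    exact: Tpi_map_point.
  by exists (a' q).
rewrite -(xK p) -(Tpi_map_comp g) (Tpi_map_homotopic _ gx) (Tpi_map_comp y).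
rewrite -(Tpi_map_point n y) => /(bij_inj (Tpi_map_equiv n hy)).
move=> /(Tpi_exact_cofiber ei)[q <-]; exists (Tpi_map a q).
by rewrite -(Tpi_map_comp f) (Tpi_map_homotopic _ fa) Tpi_map_comp.
Qed.

Lemma susp_loop_scts (X : ptopologicalType) :
  scts R (fun z : I01 R * X => susp_in z.1 z.2).
Proof. by scts_auto. Qed.

Definition susp_loop (X : ptopologicalType) : phomotopy R X (susp R X) :=
  mk_ph (@susp_loop_scts X) (susp_in_pt X).

Section Tloop.
Variable X : obj C.

Definition Tloop : phomotopy R (T X) (T (susp_obj hC X)) :=
  @ef_homotopy R C T X (susp_obj hC X) (susp_loop X).

Lemma TloopE t u : Tloop (t, u) =
  pf_map T (ph_at (susp_loop X) t : pointed_map X (susp_obj hC X)) u.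
Proof. by []. Qed.

Lemma Tloop0 u : Tloop (i0 R, u) = point.
Proof. by rewrite TloopE; apply: ef_pcst => x; exact: susp_in0. Qed.

Lemma Tloop1 u : Tloop (i1 R, u) = point.
Proof. by rewrite TloopE; apply: ef_pcst => x; exact: susp_in1. Qed.

Definition Tpi_susp n (p : Tpi T n X) : Tpi T n.+1 (susp_obj hC X) :=
  pi_loop Tloop0 Tloop1 p.

(** Linearity for the embedding of [X] in its cone [D]: the null homotopy of
    [T X -> T Y] composed with the equivalence [pinch] is [Tloop]. *)
Lemma Tpi_susp_bijective n : bijective (@Tpi_susp n).
Proof.
pose D : obj C := cofiber_obj hC (@embedding_id X : embedding (pmap_id X)).
pose j : pointed_map X D := cofiber_in (pmap_id X).
have ej : embedding j := embedding_cofiber_in (pmap_id X).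
pose Y : obj C := cofiber_obj hC ej.
pose c : pointed_map Y (susp_obj hC X) := pinch j.
apply: (pi_loop_bijective (c := pf_map T c) Tloop0 Tloop1 n (hT ej)).
- have := pf_map_phomotopic (@cofiber_id_contractible R X :
    phomotopic R (pmap_id D) (pmap_cst D D)).
  rewrite pf_id (_ : pf_map T (pmap_cst D D) = pmap_cst (T D) (T D))//.
  by apply: pmap_ext => u; exact: ef_pcst.
- have [c' [c'c cc']] := @pinch_cofiber_in_id_equiv R X.
  exists (pf_map T (c' : pointed_map (susp_obj hC X) Y)).
  rewrite -!pf_comp -!pf_id; split; exact: pf_map_phomotopic.
- move=> u; rewrite -pmap_compE -pf_comp; apply: ef_pcst => x.
  by rewrite pmap_compE; exact: pinch_base.
- move=> t u; rewrite TloopE.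
  rewrite -[RHS]/(pf_map T c
    (pf_map T (ph_at (Defs.contraction j) t : pointed_map X Y) u)).
  rewrite -[RHS]pmap_compE -pf_comp; congr (pf_map T _ u).
  by apply: pmap_ext => x; exact/esym/pinch_cone.
Qed.

Lemma Tpi_susp_inj n : injective (@Tpi_susp n).
Proof. exact: bij_inj (@Tpi_susp_bijective n). Qed.

Lemma Tpi_susp_surj n q : exists p, @Tpi_susp n p = q.
Proof. by have [h _ hK] := @Tpi_susp_bijective n; exists (h q). Qed.

Lemma Tpi_susp_point n : @Tpi_susp n point = point.
Proof.
rewrite [LHS]pi_loop_class; apply/hgroup_eqP; apply: gloop_homotopic_eq => v.
exact: (ph_pt Tloop).
Qed.

End Tloop.

Lemma Tpi_susp_natural n (X Y : obj C) (f : pointed_map X Y) (p : Tpi T n X) :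
  Tpi_susp (Tpi_map f p) =
  Tpi_map (susp_map R f : pointed_map (susp_obj hC X) (susp_obj hC Y)) (Tpi_susp p).
Proof.
elim/hgroup_ind: p => a.
rewrite /Tpi_susp /Tpi_map pi_map_class !pi_loop_class [RHS]pi_map_class.
apply/hgroup_eqP; apply: gloop_homotopic_eq => v.
transitivity (Tloop Y (chead v, pf_map T f (a (ctail v)))) => //.
transitivity (pf_map T (susp_map R f : pointed_map (susp_obj hC X) (susp_obj hC Y))
  (Tloop X (chead v, a (ctail v)))) => //.
rewrite (@TloopE Y) (@TloopE X) -!pmap_compE -!pf_comp; congr (pf_map T _ _).
by apply: pmap_ext => x; exact/esym/susp_map_in.
Qed.

(** The operation of [Tpi T n X] is analysed on [Tpi T n.+1] of the suspension,
    where products of loops are available. *)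
Section addition.
Variables (n : nat) (X : obj C).

Notation W := (wedge_obj hC X).
Notation SX := (susp_obj hC X).
Notation SW := (susp_obj hC W).
Implicit Types (p q : Tpi T n.+1 SW) (a : Tpi T n.+1 SX).

Let prj (b : bool) : pointed_map SW SX := susp_map R (wedge_proj X b).
Let inc (b : bool) : pointed_map SX SW := susp_map R (wedge_incl X b).
Let fold : pointed_map SW SX := susp_map R (wedge_fold X).

Let prj_inc b : pmap_comp (prj b) (inc b) = pmap_id SX.
Proof. by rewrite /prj /inc -susp_map_comp wedge_proj_incl susp_map_id. Qed.

Let fold_inc b : pmap_comp fold (inc b) = pmap_id SX.
Proof. by rewrite /fold /inc -susp_map_comp wedge_fold_incl susp_map_id. Qed.

Let prj_inc_ne b c a : b != c -> Tpi_map (prj b) (Tpi_map (inc c) a) = point.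
Proof.
move=> bc; rewrite -Tpi_map_comp; apply: Tpi_map_cst.
elim/susp_ind => t x; rewrite pmap_compE !susp_map_in wedge_proj_incl_ne//.
exact: susp_in_pt.
Qed.

(** Split exactness.  Exactness only controls kernels, hence the passage to the
    quotient [r] of [p] by [q]. *)
Let prj_inj p q : Tpi_map (prj true) p = Tpi_map (prj true) q ->
  Tpi_map (prj false) p = Tpi_map (prj false) q -> p = q.
Proof.
move=> pq1 pq2; pose r : Tpi T n.+1 SW := hgroup_mul p (hgroup_inv q).
have r0 b : Tpi_map (prj b) r = point.
  rewrite Tpi_map_mul; have -> : Tpi_map (prj b) p = Tpi_map (prj b) q by case: b.
  by rewrite -Tpi_map_mul hgroup_mulV; exact: Tpi_map_point.
have ex : coexact hC (inc false) (prj true) :=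
  coexact_susp (@coexact_wedge R C hC X false).
have [a ar] := (Tpi_exact r ex).1 (r0 true).
have a0 : a = point.
  by rewrite -(Tpi_map_id a) -(prj_inc false) Tpi_map_comp ar r0.
have rE : r = point by rewrite -ar a0; exact: Tpi_map_point.
rewrite -(hgroup_mul1 p) -(hgroup_mulVg q) hgroup_mulA -/r rE.
exact: hgroup_1mul.
Qed.

Definition pair_susp (a b : Tpi T n.+1 SX) : Tpi T n.+1 SW :=
  hgroup_mul (Tpi_map (inc true) a) (Tpi_map (inc false) b).

Let prj_true (a b : Tpi T n.+1 SX) : Tpi_map (prj true) (pair_susp a b) = a.
Proof.
rewrite Tpi_map_mul (prj_inc_ne b (isT : true != false)) -Tpi_map_comp prj_inc Tpi_map_id.
exact: hgroup_mul1.
Qed.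

Let prj_false (a b : Tpi T n.+1 SX) : Tpi_map (prj false) (pair_susp a b) = b.
Proof.
rewrite Tpi_map_mul (prj_inc_ne a (isT : false != true)) -Tpi_map_comp prj_inc Tpi_map_id.
exact: hgroup_1mul.
Qed.

Let fold_pair (a b : Tpi T n.+1 SX) : Tpi_map fold (pair_susp a b) = hgroup_mul a b.
Proof. by rewrite Tpi_map_mul -!Tpi_map_comp !fold_inc !Tpi_map_id. Qed.

Lemma hgroup_mulC_susp (a b : Tpi T n.+1 SX) : hgroup_mul a b = hgroup_mul b a.
Proof.
rewrite -fold_pair.
have -> : pair_susp a b =
    hgroup_mul (Tpi_map (inc false) b) (Tpi_map (inc true) a) :> Tpi T n.+1 SW.
  apply: prj_inj; rewrite ?prj_true ?prj_false.
    rewrite Tpi_map_mul (prj_inc_ne b (isT : true != false)) -Tpi_map_comp prj_inc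
      Tpi_map_id.
    exact/esym/hgroup_1mul.
  rewrite Tpi_map_mul (prj_inc_ne a (isT : false != true)) -Tpi_map_comp prj_inc
    Tpi_map_id.
  exact/esym/hgroup_mul1.
by rewrite Tpi_map_mul -!Tpi_map_comp !fold_inc !Tpi_map_id.
Qed.

Lemma Tpi_proj_bijective : bijective (@Tpi_proj R C hC T n X).
Proof.
apply: inj_surj_bijective => [p q [pq1 pq2]|[a b]].
  apply: Tpi_susp_inj; apply: prj_inj; rewrite -!Tpi_susp_natural;
    by [rewrite pq1|rewrite pq2].
have [c cE] := Tpi_susp_surj (pair_susp (Tpi_susp a) (Tpi_susp b)).
exists c; congr pair; apply: Tpi_susp_inj; rewrite Tpi_susp_natural cE.
  exact: prj_true.
exact: prj_false.
Qed.

Lemma Tpi_addE (a b : Tpi T n X) (c : Tpi T n W) : Tpi_proj c = (a, b) ->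
  Tpi_add hC a b = Tpi_map (wedge_fold X : pointed_map W X) c.
Proof.
move=> cab; rewrite /Tpi_add; congr (Tpi_map _ _).
case: xgetP => [d _ dab|/(_ c)//].
by apply: (bij_inj Tpi_proj_bijective); rewrite cab.
Qed.

Lemma Tpi_susp_add (a b : Tpi T n X) :
  Tpi_susp (Tpi_add hC a b) = hgroup_mul (Tpi_susp a) (Tpi_susp b) :> Tpi T n.+1 SX.
Proof.
have [h _ hK] := Tpi_proj_bijective; have := hK (a, b).
set c := h _ => cab; rewrite (Tpi_addE cab) Tpi_susp_natural -fold_pair.
congr (Tpi_map _ _); move: cab => [ca cb].
by apply: prj_inj; rewrite -Tpi_susp_natural ?ca ?cb ?prj_true ?prj_false.
Qed.

End addition.

(** In positive degrees the product of the images of [a] and [b] under the two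
    inclusions is the element with projections [a] and [b]. *)
Lemma Tpi_add_mul n (X : obj C) (a b : Tpi T n.+1 X) :
  Tpi_add hC a b = hgroup_mul a b.
Proof.
pose W := wedge_obj hC X.
pose inc (c : bool) : pointed_map X W := wedge_incl X c.
pose prj (c : bool) : pointed_map W X := wedge_proj X c.
pose fold : pointed_map W X := wedge_fold X.
pose c : Tpi T n.+1 W := hgroup_mul (Tpi_map (inc true) a) (Tpi_map (inc false) b).
have ne b1 b2 (q : Tpi T n.+1 X) : b1 != b2 ->
    Tpi_map (prj b1) (Tpi_map (inc b2) q) = point.
  move=> h; rewrite -Tpi_map_comp; apply: Tpi_map_cst => x.
  exact: wedge_proj_incl_ne.
have eq b1 (q : Tpi T n.+1 X) : Tpi_map (prj b1) (Tpi_map (inc b1) q) = q.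
  by rewrite -Tpi_map_comp /prj /inc wedge_proj_incl Tpi_map_id.
have fq b1 (q : Tpi T n.+1 X) : Tpi_map fold (Tpi_map (inc b1) q) = q.
  by rewrite -Tpi_map_comp /fold /inc wedge_fold_incl Tpi_map_id.
rewrite (@Tpi_addE n.+1 X a b c); first by rewrite Tpi_map_mul !fq.
congr pair; rewrite Tpi_map_mul eq ne//; [exact: hgroup_mul1|exact: hgroup_1mul].
Qed.

Section zmodule.
Variables (n : nat) (X : obj C).
Implicit Types a b c : Tpi T n X.

Lemma Tpi_addA a b c : Tpi_add hC a (Tpi_add hC b c) = Tpi_add hC (Tpi_add hC a b) c.
Proof. by apply: Tpi_susp_inj; rewrite !Tpi_susp_add; exact: hgroup_mulA. Qed.

Lemma Tpi_addC a b : Tpi_add hC a b = Tpi_add hC b a.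
Proof. by apply: Tpi_susp_inj; rewrite !Tpi_susp_add; exact: hgroup_mulC_susp. Qed.

Lemma Tpi_add0 a : Tpi_add hC point a = a.
Proof.
by apply: Tpi_susp_inj; rewrite Tpi_susp_add Tpi_susp_point; exact: hgroup_1mul.
Qed.

Definition Tpi_opp a : Tpi T n X := xget point [set b | Tpi_add hC b a = point].

Lemma Tpi_addN a : Tpi_add hC (Tpi_opp a) a = point.
Proof.
have [b bE] := Tpi_susp_surj (hgroup_inv (Tpi_susp a) : Tpi T n.+1 (susp_obj hC X)).
apply: (@xgetPex _ point [set b | Tpi_add hC b a = point]).
suff ba : Tpi_add hC b a = point by exists b.
apply: Tpi_susp_inj; rewrite Tpi_susp_add Tpi_susp_point bE.
exact: hgroup_mulVg.
Qed.

End zmodule.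

Lemma Tpi_map_add n (X Y : obj C) (f : pointed_map X Y) (a b : Tpi T n X) :
  Tpi_map f (Tpi_add hC a b) = Tpi_add hC (Tpi_map f a) (Tpi_map f b).
Proof.
apply: Tpi_susp_inj; rewrite Tpi_susp_natural !Tpi_susp_add !Tpi_susp_natural.
exact: Tpi_map_mul.
Qed.

End linear_functors.
(** * The homology theory *)

Section homology.
Variables (R : realType) (C : ngType R -> Prop) (hC : admissible C).
Variables (T : enriched_functor C) (hT : linear_functor hC T).

(** The proof of linearity is an argument because the group structure depends
    on it, although the carrier does not. *)
Definition Tgrp (_ : linear_functor hC T) (n : nat) (X : obj C) : Type := Tpi T n X.

HB.instance Definition _ n X := Choice.copy (Tgrp hT n X) (hgroup R n (point : T X)).
HB.instance Definition _ n X := GRing.isZmodule.Build (Tgrp hT n X)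
  (@Tpi_addA R C T hC hT n X) (@Tpi_addC R C T hC hT n X)
  (@Tpi_add0 R C T hC hT n X) (@Tpi_addN R C T hC hT n X).

Definition Tgrp_map n (X Y : obj C) (f : pointed_map X Y) :
  Tgrp hT n X -> Tgrp hT n Y := @Tpi_map R C T n X Y f.

Lemma Tgrp_map_additive n (X Y : obj C) (f : pointed_map X Y) :
  nmod_morphism (@Tgrp_map n X Y f).
Proof.
by split; [exact: Tpi_map_point|exact: (Tpi_map_add hT)].
Qed.

HB.instance Definition _ n X Y f := GRing.isNmodMorphism.Build
  (Tgrp hT n X) (Tgrp hT n Y) (@Tgrp_map n X Y f) (@Tgrp_map_additive n X Y f).

Definition Tgrp_susp n (X : obj C) : Tgrp hT n X -> Tgrp hT n.+1 (susp_obj hC X) :=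
  @Tpi_susp R C T hC X n.

Lemma Tgrp_susp_additive n (X : obj C) : nmod_morphism (@Tgrp_susp n X).
Proof.
split; first exact: Tpi_susp_point.
move=> a b; apply: (etrans (Tpi_susp_add hT a b)).
exact/esym/(Tpi_add_mul hT).
Qed.

HB.instance Definition _ n X := GRing.isNmodMorphism.Build
  (Tgrp hT n X) (Tgrp hT n.+1 (susp_obj hC X)) (@Tgrp_susp n X)
  (@Tgrp_susp_additive n X).

Lemma susp_iter_map_id k (X : obj C) :
  susp_iter_map hC k (pmap_id X) = pmap_id (susp_iter hC k X).
Proof. by elim: k => //= k ->; exact: susp_map_id. Qed.

Lemma susp_iter_map_comp k (X Y Z : obj C) (g : pointed_map Y Z) (f : pointed_map X Y) :
  susp_iter_map hC k (pmap_comp g f : pointed_map X Z) =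
  pmap_comp (susp_iter_map hC k g) (susp_iter_map hC k f).
Proof. by elim: k => //= k ->; exact: susp_map_comp. Qed.

Lemma susp_iter_map_phomotopic k (X Y : obj C) (f g : pointed_map X Y) :
  phomotopic R f g -> phomotopic R (susp_iter_map hC k f) (susp_iter_map hC k g).
Proof. by move=> fg; elim: k => //= k; exact: susp_map_phomotopic. Qed.

Lemma coexact_susp_iter k (A X Y : obj C) (f : pointed_map A X) (g : pointed_map X Y) :
  coexact hC f g -> coexact hC (susp_iter_map hC k f) (susp_iter_map hC k g).
Proof. by move=> fg; elim: k => //= k; exact: coexact_susp. Qed.

(** The suspension isomorphism in negative degrees only permutes suspensions:
    the new one is the innermost factor on one side and the outermost on the
    other. *)
Fixpoint shift k (X : obj C) :
    pointed_map (susp_iter hC k.+1 X) (susp_iter hC k (susp_obj hC X)) :=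
  match k with
  | 0%N => pmap_id (susp_obj hC X)
  | k'.+1 => susp_map R (shift k' X)
  end.

Fixpoint unshift k (X : obj C) :
    pointed_map (susp_iter hC k (susp_obj hC X)) (susp_iter hC k.+1 X) :=
  match k with
  | 0%N => pmap_id (susp_obj hC X)
  | k'.+1 => susp_map R (unshift k' X)
  end.

Lemma shiftK k (X : obj C) : pmap_comp (unshift k X) (shift k X) = pmap_id _.
Proof.
elim: k => [|k IHk] /=; first exact: pmap_comp1f.
by rewrite -susp_map_comp [pmap_comp _ _]IHk; exact: susp_map_id.
Qed.

Lemma unshiftK k (X : obj C) : pmap_comp (shift k X) (unshift k X) = pmap_id _.
Proof.
elim: k => [|k IHk] /=; first exact: pmap_comp1f.
by rewrite -susp_map_comp [pmap_comp _ _]IHk; exact: susp_map_id.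
Qed.

Lemma shift_natural k (X Y : obj C) (f : pointed_map X Y) :
  pmap_comp (shift k Y) (susp_iter_map hC k.+1 f) =
  pmap_comp (susp_iter_map hC k
    (susp_map R f : pointed_map (susp_obj hC X) (susp_obj hC Y))) (shift k X).
Proof.
elim: k => [|k IHk]; first exact: pmap_ext.
rewrite -[LHS]/(pmap_comp (susp_map R (shift k Y)) (susp_map R (susp_iter_map hC k.+1 f))).
rewrite -susp_map_comp IHk; exact: susp_map_comp.
Qed.

Definition Thgrp (n : int) (X : obj C) : zmodType :=
  match n with
  | Posz k => Tgrp hT k X
  | Negz k => Tgrp hT 0 (susp_iter hC k.+1 X)
  end.

Definition Thmap (n : int) (X Y : obj C) (f : pointed_map X Y) :
    {additive Thgrp n X -> Thgrp n Y} :=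
  match n return {additive Thgrp n X -> Thgrp n Y} with
  | Posz k => @Tgrp_map k X Y f
  | Negz k => @Tgrp_map 0 _ _ (susp_iter_map hC k.+1 f)
  end.

(** The successor by cases, for which the degrees of the suspension maps match
    by computation; [inextE] transports them to [n + 1]. *)
Definition inext (n : int) : int :=
  match n with
  | Posz k => Posz k.+1
  | Negz 0 => Posz 0
  | Negz k.+1 => Negz k
  end.

Lemma inextE n : inext n = n + 1.
Proof.
case: n => [k|[|k]] //=; first by rewrite -PoszD addn1.
by rewrite !NegzE -[k.+2]addn1 PoszD opprD subrK.
Qed.

Definition Thsusp (n : int) (X : obj C) :
    {additive Thgrp n X -> Thgrp (inext n) (susp_obj hC X)} :=
  match n return {additive Thgrp n X -> Thgrp (inext n) (susp_obj hC X)} with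
  | Posz k => @Tgrp_susp k X
  | Negz 0 => @Tgrp_map 0 _ _ (shift 0 X)
  | Negz k.+1 => @Tgrp_map 0 _ _ (shift k.+1 X)
  end.

Lemma Tgrp_shift_bijective k (X : obj C) :
  bijective (@Tgrp_map 0 _ _ (shift k X)).
Proof.
exists (@Tgrp_map 0 _ _ (unshift k X)) => a.
  by rewrite /Tgrp_map -Tpi_map_comp shiftK Tpi_map_id.
by rewrite /Tgrp_map -Tpi_map_comp unshiftK Tpi_map_id.
Qed.

Lemma Thsusp_bijective n (X : obj C) : bijective (@Thsusp n X).
Proof.
case: n => [k|[|k]]; first exact: (Tpi_susp_bijective hT).
  exact: (Tgrp_shift_bijective 0).
exact: (Tgrp_shift_bijective k.+1).
Qed.

Lemma Tgrp_shift_natural k (X Y : obj C) (f : pointed_map X Y) a :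
  @Tgrp_map 0 _ _ (shift k Y) (Tgrp_map (susp_iter_map hC k.+1 f) a) =
  Tgrp_map (susp_iter_map hC k
    (susp_map R f : pointed_map (susp_obj hC X) (susp_obj hC Y)))
    (Tgrp_map (shift k X) a).
Proof. by rewrite /Tgrp_map -!Tpi_map_comp shift_natural. Qed.

Lemma Thsusp_natural n (X Y : obj C) (f : pointed_map X Y) (a : Thgrp n X) :
  Thsusp n Y (Thmap n f a) =
  Thmap (inext n) (susp_map R f : pointed_map (susp_obj hC X) (susp_obj hC Y))
    (Thsusp n X a).
Proof.
case: n a => [k|[|k]] a; first exact: Tpi_susp_natural.
  exact: (Tgrp_shift_natural (k := 0)).
exact: (Tgrp_shift_natural (k := k.+1)).
Qed.

Lemma Thmap_id n (X : obj C) : Thmap n (pmap_id X) =1 id.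
Proof.
case: n => k a; first exact: Tpi_map_id.
rewrite [LHS]/(Tpi_map (susp_iter_map hC k.+1 (pmap_id X)) a).
by rewrite susp_iter_map_id; exact: Tpi_map_id.
Qed.

Lemma Thmap_comp n (X Y Z : obj C) (g : pointed_map Y Z) (f : pointed_map X Y) :
  Thmap n (pmap_comp g f : pointed_map X Z) =1 Thmap n g \o Thmap n f.
Proof.
case: n => k a; first exact: Tpi_map_comp.
rewrite [LHS]/(Tpi_map (susp_iter_map hC k.+1 (pmap_comp g f : pointed_map X Z)) a).
by rewrite susp_iter_map_comp; exact: Tpi_map_comp.
Qed.

Lemma Thmap_homotopy n (X Y : obj C) (f g : pointed_map X Y) :
  phomotopic R f g -> Thmap n f =1 Thmap n g.
Proof.
by case: n => k fg a; apply: Tpi_map_homotopic => //; exact: susp_iter_map_phomotopic.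
Qed.

Lemma Thmap_exact n (A X : obj C) (i : pointed_map A X) (ei : embedding i)
    (x : Thgrp n X) :
  Thmap n (cofiber_in i : pointed_map X (cofiber_obj hC ei)) x = 0 <->
  exists a : Thgrp n A, Thmap n i a = x.
Proof.
have ex := coexact_cofiber hC ei.
case: n x => k x; first exact: (Tpi_exact hT).
by apply: (Tpi_exact hT); exact: coexact_susp_iter k.+1 _ _ _ _ _ ex.
Qed.

Lemma Thsusp_next (n m : int) : inext n = m ->
  exists s : forall X : obj C, {additive Thgrp n X -> Thgrp m (susp_obj hC X)},
    (forall X, bijective (s X)) /\
    (forall (X Y : obj C) (f : pointed_map X Y) (a : Thgrp n X),
      s Y (Thmap n f a) =
      Thmap m (susp_map R f : pointed_map (susp_obj hC X) (susp_obj hC Y)) (s X a)).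
Proof.
case: m /; exists (Thsusp n); split; first exact: Thsusp_bijective.
exact: Thsusp_natural.
Qed.

Definition Thsusp1 (n : int) := projT1 (cid (Thsusp_next (inextE n))).

Definition linear_homology : homology_theory hC :=
  @HomologyTheory R C hC Thgrp Thmap Thmap_id Thmap_comp Thsusp1
    (fun n => (projT2 (cid (Thsusp_next (inextE n)))).1)
    (fun n => (projT2 (cid (Thsusp_next (inextE n)))).2)
    Thmap_homotopy Thmap_exact.

Lemma Tgrp_iso n (X : obj C) : Tpi_iso hC (id : Tgrp hT n X -> Tpi T n X).
Proof.
split => //.
- by exists id.
- exact: (Tpi_proj_bijective hT).
- by case: n => // n a b; exact: (Tpi_add_mul hT).
Qed.

End homology.

Theorem theorem6p4 (R : realType) (C : ngType R -> Prop) (hC : admissible C)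
    (T : enriched_functor C) (hT : linear_functor hC T) :
  exists h : homology_theory hC,
    (forall n : nat,
      exists phi : forall X : obj C, hgrp h n%:Z X -> Tpi T n X,
        (forall X : obj C, Tpi_iso hC (phi X)) /\
        (forall (X Y : obj C) (f : pointed_map X Y) (a : hgrp h n%:Z X),
          phi Y (hmap h n%:Z f a) = Tpi_map f (phi X a))) /\
    (forall n : nat, (0 < n)%N ->
      exists phi : forall X : obj C,
          hgrp h (- n%:Z) X -> Tpi T 0 (susp_iter hC n X),
        (forall X : obj C, Tpi_iso hC (phi X)) /\
        (forall (X Y : obj C) (f : pointed_map X Y) (a : hgrp h (- n%:Z) X),
          phi Y (hmap h (- n%:Z) f a) =
          Tpi_map (susp_iter_map hC n f) (phi X a))).
Proof.
exists (linear_homology hT); split=> [n|[//|n] _].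
  by exists (fun X => id); split=> // X; exact: Tgrp_iso.
by exists (fun X => id); split=> // X; exact: Tgrp_iso.
Qed.
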